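(* Let $\mathcal{S}\subset\mathbb{R}^m$ be a locally compact semialgebraic set, let $\mathcal{Q}\subset\mathbb{R}^n$ be a Nash manifold with (divisorial) corners and let $f:\mathcal{S}\to\mathcal{Q}$ be a continuous semialgebraic map. Then for every strictly positive continuous semialgebraic function $\varepsilon:\mathcal{S}\to\mathbb{R}$ there exists a Nash map $g:\mathcal{S}\to\mathcal{Q}$ with $\|f(x)-g(x)\|<\varepsilon(x)$ for all $x\in\mathcal{S}$.
   Context: A Nash map on a semialgebraic set $\mathcal{S}$ is the restriction to $\mathcal{S}$ of a $C^\infty$ semialgebraic map defined on an open semialgebraic neighborhood of $\mathcal{S}$. A Nash manifold with corners is a semialgebraic set that is a $C^\infty$ submanifold with corners of $\mathbb{R}^n$; $\partial\mathcal{Q}$ is the set of its non-smooth points. Standing assumption (divisorial corners): there is a Nash manifold $M\subset\mathbb{R}^n$ of the same dimension containing $\mathcal{Q}$ as a closed subset such that the smallest Nash subset of $M$ containing $\partial\mathcal{Q}$ is a Nash normal-crossings divisor of $M$ (its irreducible components are codimension-one Nash submanifolds meeting transversally). *)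

(* Defs.v *)
From HB Require Import structures.
From mathcomp Require Import all_boot all_order all_algebra.
From mathcomp Require Import all_classical all_reals all_analysis.
Set Implicit Arguments. Unset Strict Implicit. Unset Printing Implicit Defensive.
Import Order.TTheory GRing.Theory Num.Theory.
Import numFieldNormedType.Exports.
Local Open Scope classical_set_scope.
Local Open Scope ring_scope.

Section Defs.
Variable R : realType.

Inductive pexpr (n : nat) : Type :=
  | PConst of R
  | PVar of 'I_n
  | PAdd of pexpr n & pexpr n
  | PMul of pexpr n & pexpr n.

Fixpoint peval n (p : pexpr n) (x : 'rV[R]_n) : R :=
  match p with
  | PConst c => c
  | PVar i => x 0 i
  | PAdd p q => peval p x + peval q x
  | PMul p q => peval p x * peval q x
  end.

(** Semialgebraic subsets of R^n: the boolean algebra generated by the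
    sets {x | p(x) > 0}, p a polynomial (this contains {p = 0}, {p >= 0}). *)
Inductive semialgebraic (n : nat) : set 'rV[R]_n -> Prop :=
  | SA_pos (p : pexpr n) : semialgebraic [set x | 0 < peval p x]
  | SA_union A B : semialgebraic A -> semialgebraic B -> semialgebraic (A `|` B)
  | SA_compl A : semialgebraic A -> semialgebraic (~` A).

Definition semialgebraic_map m k (S : set 'rV[R]_m) (f : 'rV[R]_m -> 'rV[R]_k) :=
  semialgebraic [set z : 'rV[R]_(m + k) | exists2 x, S x & z = row_mx x (f x)].

Definition as_row m (e : 'rV[R]_m -> R) : 'rV[R]_m -> 'rV[R]_1 :=
  fun x => \row_(j < 1) e x.

Definition ebasis n (i : 'I_n) : 'rV[R]_n := delta_mx 0 i.

Fixpoint Ck_on m k (j : nat) (U : set 'rV[R]_m) (f : 'rV[R]_m -> 'rV[R]_k) : Prop :=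
  match j with
  | 0%N => {in U, continuous f}
  | j'.+1 => {in U, continuous f} /\
      forall i : 'I_m, (forall x, U x -> derivable f x (ebasis i)) /\
                       Ck_on j' U (fun x => 'D_(ebasis i) f x)
  end.

Definition smooth_on m k (U : set 'rV[R]_m) (f : 'rV[R]_m -> 'rV[R]_k) :=
  forall j, Ck_on j U f.

Definition Nash_on m k (S : set 'rV[R]_m) (g : 'rV[R]_m -> 'rV[R]_k) :=
  exists U : set 'rV[R]_m, exists G : 'rV[R]_m -> 'rV[R]_k,
    [/\ open U /\ semialgebraic U, S `<=` U, smooth_on U G,
        semialgebraic_map U G & forall x, S x -> g x = G x].

Definition diffeo n (U V : set 'rV[R]_n) (phi psi : 'rV[R]_n -> 'rV[R]_n) :=
  [/\ open U /\ open V, smooth_on U phi, smooth_on V psi,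
      (forall x, U x -> V (phi x) /\ psi (phi x) = x) &
      (forall y, V y -> U (psi y) /\ phi (psi y) = y)].

Definition quadrant n (d k : nat) : set 'rV[R]_n :=
  [set y | forall i : 'I_n, ((i < k)%N -> 0 <= y 0 i) /\ ((d <= i)%N -> y 0 i = 0)].

Definition corner_chart n (Q : set 'rV[R]_n) (x : 'rV[R]_n) (d k : nat)
    (U : set 'rV[R]_n) (phi : 'rV[R]_n -> 'rV[R]_n) :=
  exists V psi, [/\ U x, diffeo U V phi psi &
     forall y, U y -> (Q y <-> @quadrant n d k (phi y))].

Definition submanifold_corners n (d : nat) (Q : set 'rV[R]_n) :=
  (d <= n)%N /\
  forall x, Q x -> exists k U phi, (k <= d)%N /\ corner_chart Q x d k U phi.

Definition submanifold n (d : nat) (M : set 'rV[R]_n) :=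
  (d <= n)%N /\ forall x, M x -> exists U phi, corner_chart M x d 0 U phi.

Definition Nash_manifold n d (M : set 'rV[R]_n) := semialgebraic M /\ submanifold d M.
Definition Nash_manifold_corners n d (Q : set 'rV[R]_n) :=
  semialgebraic Q /\ submanifold_corners d Q.

Definition smooth_point n (Q : set 'rV[R]_n) (x : 'rV[R]_n) :=
  exists d U phi, (d <= n)%N /\ corner_chart Q x d 0 U phi.
Definition corner_boundary n (Q : set 'rV[R]_n) : set 'rV[R]_n :=
  [set x | Q x /\ ~ smooth_point Q x].

Definition Nash_subset n (M X : set 'rV[R]_n) :=
  X `<=` M /\ exists h : 'rV[R]_n -> 'rV[R]_1,
    Nash_on M h /\ X = [set x | M x /\ h x = 0].

Definition Nash_irreducible n (M X : set 'rV[R]_n) :=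
  [/\ Nash_subset M X, X !=set0 &
      forall Y1 Y2, Nash_subset M Y1 -> Nash_subset M Y2 -> X = Y1 `|` Y2 ->
        Y1 = X \/ Y2 = X].

Definition Nash_closure n (M A Z : set 'rV[R]_n) :=
  [/\ Nash_subset M Z, A `<=` Z &
      forall Y, Nash_subset M Y -> A `<=` Y -> Z `<=` Y].

(** Z is a Nash normal-crossings divisor of the d-dimensional Nash manifold M:
    its irreducible components X_0,...,X_(r-1) (irreducible, pairwise non-nested,
    covering Z) are codimension-one Nash submanifolds meeting transversally,
    i.e. near each point x of M there is a chart straightening M onto R^d x 0
    in which the components through x are distinct coordinate hyperplanes. *)
Definition Nash_normal_crossings n (d : nat) (M Z : set 'rV[R]_n) :=
  exists (r : nat) (X : 'I_r -> set 'rV[R]_n),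
  [/\ forall i, Nash_irreducible M (X i),
      forall i, Nash_manifold d.-1 (X i),
      forall i j, i != j -> ~ (X i `<=` X j),
      Z = \bigcup_i X i &
      forall x, M x -> exists U phi (sigma : 'I_r -> 'I_n),
        [/\ corner_chart M x d 0 U phi,
            forall i, X i x -> (sigma i < d)%N,
            forall i j, X i x -> X j x -> sigma i = sigma j -> i = j &
            forall i, X i x -> forall y, U y ->
              (X i y <-> M y /\ phi y 0 (sigma i) = 0)]].

Definition Nash_manifold_divisorial_corners n (Q : set 'rV[R]_n) :=
  exists d, Nash_manifold_corners d Q /\
    exists M, [/\ Nash_manifold d M, Q `<=` M,
      (forall x, M x -> closure Q x -> Q x) &
      exists Z, Nash_closure M (corner_boundary Q) Z /\ Nash_normal_crossings d M Z].

Definition locally_compact_set m (S : set 'rV[R]_m) :=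
  forall x, S x -> exists K, [/\ compact K, K `<=` S &
     exists2 e : R, 0 < e & ball x e `&` S `<=` K].

Definition enorm n (v : 'rV[R]_n) : R := Num.sqrt (\sum_(i < n) v 0 i ^+ 2).

End Defs.

(* Main.v *)
Require Import Defs.
From HB Require Import structures.
From mathcomp Require Import all_boot all_order all_algebra.
From mathcomp Require Import all_classical all_reals all_analysis.
From mathcomp Require Import ring lra.
From mathcomp Require ordered_qelim qe_rcf polyrcf.
Set Implicit Arguments. Unset Strict Implicit. Unset Printing Implicit Defensive.
Import Order.TTheory GRing.Theory Num.Theory.
Import numFieldNormedType.Exports.
Local Open Scope classical_set_scope.
Local Open Scope ring_scope.

(** A point [w] belongs to the tube around [Q] if it has a foot point [y] in [Q]
    with [4 |<w - y, y' - y>| <= |y' - y|^2] for all [y'] in [Q].  The foot point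
    is unique and Lipschitz in [w]; in a chart it solves the first order
    conditions, so by the implicit function theorem it is a Nash function of [w]
    on the interior of the tube.  A Nash map into this interior can therefore be
    retracted onto [Q].

    At its boundary points [Q] does not lie in the interior of the tube, so [f]
    is first pushed inwards.  The inward directions at [f x] are the hypertangent
    directions of the tube, in the sense of Clarke; they form an open convex cone,
    which is nonempty because, in a chart, the sum of the coordinate directions
    tangent to [Q] belongs to it.  The points reached from [f x] by a small push
    in a chosen inward direction again form an open convex set.

    Both choices are made by a selection theorem: on a locally compact
    semialgebraic set, a relatively open semialgebraic relation with nonempty
    convex fibres contains the graph of a Nash map.  The point of least norm at a
    fixed depth in the fibre is a semialgebraic selection, whose coordinates are
    roots of polynomials with Nash coefficients.  Up to an error [T ^- N], where
    [T] is a Nash exhaustion function, these roots are taken among finitely many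
    Nash functions.  By Lojasiewicz's inequality such an error is harmless, and
    the finitely many maps obtained are glued by convex combinations whose weights
    are again approximated by Nash functions. *)

(** * Semialgebraic sets and quantifier elimination *)

Section Semialgebraic.
Variable R : realType.
Import ordered_qelim.ord.

(** Two obstacles shape the proof. Nash functions have no compactly supported cut-offs, so nothing
    can be patched exactly: every choice is made under an open condition, the room left by the
    condition is bounded below by a power of [T], and continuous semialgebraic data are replaced by
    Nash data with an error of higher order. Secondly, the nearest-point map onto [Q] is in general
    not smooth, because at a face its first order conditions are inequalities. The absolute value in
    the tube condition turns them into equations in all [d] tangent directions of a chart, as if [Q]
    continued beyond its faces. The price is that a nearest point of a pushed point has to be kept
    off the faces, which is the purpose of the inward directions. The factor 4 is chosen so that two
    tube inequalities together use up only half of the squared distance of two foot points; the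
    other half yields the Lipschitz estimate. Direction and pushed point are selected one after the
    other because pushes of a point in one fixed direction can be averaged: the larger of two
    admissible radii serves for both. *)

Lemma sa_ext n (A B : set 'rV[R]_n) :
  (forall x, A x <-> B x) -> semialgebraic A -> semialgebraic B.
Proof. by move=> AB; suff -> : A = B by []; apply/seteqP; split=> x /AB. Qed.

Lemma sa_setI n (A B : set 'rV[R]_n) :
  semialgebraic A -> semialgebraic B -> semialgebraic (A `&` B).
Proof.
move=> hA hB; rewrite -[A]setCK -[B]setCK -setCU.
by apply/SA_compl/SA_union; apply: SA_compl.
Qed.

Lemma sa_eq0 n (p : pexpr R n) : semialgebraic [set x | peval p x = 0].
Proof.
pose np := PMul (PConst n (-1)) p.
apply: (@sa_ext _ (~` ([set x | 0 < peval p x] `|` [set x | 0 < peval np x]))).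
  move=> x; split=> [|/= ->]; last by rewrite mulr0 ltxx => -[].
  move=> /not_orP[] /= /negP; rewrite -leNgt => h1 /negP; rewrite -leNgt.
  by rewrite mulN1r oppr_le0 => h2; apply/eqP; rewrite eq_le h1.
by apply: SA_compl; apply: SA_union; apply: SA_pos.
Qed.

Lemma sa_const n (P : Prop) : semialgebraic [set _ : 'rV[R]_n | P].
Proof.
have [hP|hP] := pselect P.
  by apply: sa_ext (SA_pos (PConst n 1)) => x /=; split=> // _; exact: ltr01.
by apply: sa_ext (SA_pos (PConst n 0)) => x /=; rewrite ltxx; split.
Qed.

Fixpoint psubst n m (F : 'I_n -> pexpr R m) (p : pexpr R n) : pexpr R m :=
  match p with
  | PConst c => PConst m c
  | PVar i => F i
  | PAdd p q => PAdd (psubst F p) (psubst F q)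
  | PMul p q => PMul (psubst F p) (psubst F q)
  end.

Lemma peval_subst n m (F : 'I_n -> pexpr R m) p x :
  peval (psubst F p) x = peval p (\row_i peval (F i) x).
Proof. by elim: p => //= [i|p -> q ->|p -> q ->] //; rewrite mxE. Qed.

Lemma sa_preim n m (F : 'I_n -> pexpr R m) (A : set 'rV[R]_n) :
  semialgebraic A -> semialgebraic [set x | A (\row_i peval (F i) x)].
Proof.
elim=> [p|B C _ hB _ hC|B _ hB].
- by apply: sa_ext (SA_pos (psubst F p)) => x /=; rewrite peval_subst.
- exact: SA_union hB hC.
- exact: SA_compl hB.
Qed.

Definition env n (v : 'rV[R]_n) : seq R := [seq v 0 i | i <- enum 'I_n].

Lemma size_env n (v : 'rV[R]_n) : size (env v) = n.
Proof. by rewrite size_map size_enum_ord. Qed.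

Lemma nth_env n (v : 'rV[R]_n) (i : 'I_n) : (env v)`_i = v 0 i.
Proof. by rewrite (nth_map i) ?size_enum_ord // nth_ord_enum. Qed.

Fixpoint term_of n (p : pexpr R n) : GRing.term R :=
  match p with
  | PConst c => GRing.Const c
  | PVar i => GRing.Var R i
  | PAdd p q => GRing.Add (term_of p) (term_of q)
  | PMul p q => GRing.Mul (term_of p) (term_of q)
  end.

Lemma eval_term_of n (p : pexpr R n) v :
  GRing.eval (env v) (term_of p) = peval p v.
Proof. by elim: p => //= [i|p -> q ->|p -> q ->] //; rewrite nth_env. Qed.

Lemma sa_formula n (A : set 'rV[R]_n) : semialgebraic A ->
  exists f : formula R, forall v, A v <-> holds (env v) f.
Proof.
elim=> [p|B C _ [f hf] _ [g hg]|B _ [f hf]].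
- by exists (Lt (GRing.NatConst R 0) (term_of p)) => v /=; rewrite eval_term_of.
- by exists (Or f g) => v /=; rewrite -hf -hg.
- by exists (Not f) => v /=; rewrite -hf.
Qed.

Lemma pexpr_of_term n (t : GRing.term R) : GRing.rterm t ->
  exists p : pexpr R n, forall v, peval p v = GRing.eval (env v) t.
Proof.
elim: t => //=.
- move=> k _; have [kn|kn] := ltnP k n.
    by exists (PVar R (Ordinal kn)) => v /=; rewrite -nth_env.
  by exists (PConst n 0) => v /=; rewrite nth_default ?size_env.
- by move=> c _; exists (PConst n c).
- by move=> k _; exists (PConst n k%:R).
- by move=> t ht s hs /andP[/ht[p hp] /hs[q hq]]; exists (PAdd p q) => v /=; rewrite hp hq.
- by move=> t ht /ht[p hp]; exists (PMul (PConst n (-1)) p) => v /=; rewrite hp mulN1r.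
- move=> t ht k /ht[p hp]; exists (PMul (PConst n k%:R) p) => v /=.
  by rewrite hp mulr_natl.
- by move=> t ht s hs /andP[/ht[p hp] /hs[q hq]]; exists (PMul p q) => v /=; rewrite hp hq.
- move=> t ht k /ht[p hp]; elim: k => [|k [q hq]].
    by exists (PConst n 1) => v /=; rewrite expr0.
  by exists (PMul p q) => v /=; rewrite hp hq exprS.
Qed.

Lemma sa_qf n (f : formula R) : qf_form f && rformula f ->
  semialgebraic [set v : 'rV[R]_n | holds (env v) f].
Proof.
elim: f => //=.
- by move=> b _; exact: sa_const.
- move=> s t /andP[/(pexpr_of_term n)[p hp] /(pexpr_of_term n)[q hq]].
  apply: sa_ext (sa_eq0 (PAdd p (PMul (PConst n (-1)) q))) => v /=.
  by rewrite hp hq mulN1r; split=> [/eqP|->]; rewrite ?subrr // subr_eq0 => /eqP.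
- move=> s t /andP[/(pexpr_of_term n)[p hp] /(pexpr_of_term n)[q hq]].
  apply: sa_ext (SA_pos (PAdd q (PMul (PConst n (-1)) p))) => v /=.
  by rewrite hp hq mulN1r subr_gt0.
- move=> s t /andP[/(pexpr_of_term n)[p hp] /(pexpr_of_term n)[q hq]].
  apply: sa_ext (SA_compl (SA_pos (PAdd p (PMul (PConst n (-1)) q)))) => v /=.
  by rewrite hp hq mulN1r subr_gt0 leNgt; split=> /negP.
- move=> f hf g hg; rewrite andbACA => /andP[/hf sf /hg sg]; exact: sa_setI.
- move=> f hf g hg; rewrite andbACA => /andP[/hf sf /hg sg]; exact: SA_union.
- move=> f hf g hg; rewrite andbACA => /andP[/hf sf /hg sg].
  apply: sa_ext (SA_union (SA_compl sf) sg) => v /=.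
  by split=> [[]//|h]; have [/h|] := pselect (holds (env v) f); [right|left].
- by move=> f hf /hf sf; exact: SA_compl.
Qed.

(** Tarski's theorem: the elimination procedure for real closed fields yields an equivalent
    quantifier-free formula, to which [sa_qf] applies. *)
Lemma sa_holds n (f : formula R) :
  semialgebraic [set v : 'rV[R]_n | holds (env v) f].
Proof.
(* [to_rform] first removes inverses, since the elimination and [sa_qf] treat ring formulas. *)
set g := quantifier_elim
  (fun k s => qe_rcf.qfr_to_formula (@qe_rcf.wproj R k s)) (to_rform f).
have hg : qf_form g && rformula g.
  by apply: (quantifier_elim_wf (@qe_rcf.wf_QE_wproj R)); exact: to_rform_rformula.
apply: sa_ext (sa_qf n hg) => v /=.
have /andP[qg _] := hg.
split.
  by move=> /(qf_evalP _ qg) h; apply/(qe_rcf.rcf_satP (env v) f).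
by move=> /(qe_rcf.rcf_satP (env v) f) h; apply/(qf_evalP _ qg).
Qed.

Lemma holds_exists (f : formula R) k (e : seq R) :
  holds e (foldr (@Exists R) f (iota (size e) k)) <->
  exists2 s, size s = k & holds (e ++ s) f.
Proof.
elim: k e => [|k IH] e /=.
  split=> [h|[s /size0nil ->]]; last by rewrite cats0.
  by exists [::] => //; rewrite cats0.
have hset (x : R) : set_nth 0 e (size e) x = rcons e x.
  by elim: e {IH} => //= a e ->.
split=> [[x]|[[//|x s] /= [hs] h]].
  rewrite hset => h.
  have := IH (rcons e x); rewrite size_rcons => /iffLR /(_ h)[s hs hsf].
  by exists (x :: s); rewrite /= ?hs // -cat_rcons.
exists x; rewrite hset.
have := IH (rcons e x); rewrite size_rcons => /iffRL; apply.
by exists s => //; rewrite cat_rcons.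
Qed.

Lemma env_row_mx n k (x : 'rV[R]_n) (y : 'rV[R]_k) :
  env (row_mx x y) = env x ++ env y.
Proof.
apply: (@eq_from_nth _ 0); rewrite ?size_cat !size_env // => i hi.
rewrite nth_cat size_env (nth_env _ (Ordinal hi)).
case: ltnP => h.
  rewrite (nth_env x (Ordinal h)) -(row_mxEl x y); congr (row_mx _ _ _ _).
  exact: val_inj.
have h2 : (i - n < k)%N by rewrite ltn_subLR.
rewrite (nth_env y (Ordinal h2)) -(row_mxEr x y); congr (row_mx _ _ _ _).
by apply: val_inj; rewrite /= subnKC.
Qed.

Lemma sa_proj n k (A : set 'rV[R]_(n + k)) : semialgebraic A ->
  semialgebraic [set x : 'rV[R]_n | exists y : 'rV[R]_k, A (row_mx x y)].
Proof.
move=> /sa_formula[f hf].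
apply: sa_ext (sa_holds n (foldr (@Exists R) f (iota n k))) => v /=.
have := holds_exists f k (env v); rewrite size_env => ->.
split=> [[s hs hsf]|[y /hf]].
  exists (\row_i s`_i); apply/hf; rewrite env_row_mx.
  suff -> : env (\row_(i < k) s`_i) = s by [].
  apply: (@eq_from_nth _ 0); rewrite ?size_env ?hs // => i hi.
  by rewrite (nth_env _ (Ordinal hi)) mxE.
by rewrite env_row_mx => h; exists (env y); rewrite ?size_env.
Qed.

End Semialgebraic.

(** * Definable predicates and functions *)

(* Codings of types by row vectors, so that semialgebraicity makes sense for
   relations between numbers, rows and tuples of these. *)
Class Enc (R : realType) (T : Type) := {
  esz : nat;
  eto : T -> 'rV[R]_esz;
  eof : 'rV[R]_esz -> T;
  etoK : cancel eto eof;
  eofK : cancel eof eto }.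
Arguments esz {R} T {_}.

#[global] Instance enc_row (R : realType) n : Enc R 'rV[R]_n :=
  @Build_Enc R 'rV[R]_n n id id (fun _ => erefl) (fun _ => erefl).

#[global, refine] Instance enc_real (R : realType) : Enc R R :=
  @Build_Enc R R 1 (fun x => \row_j x) (fun v => v 0 0) _ _.
Proof.
- by move=> x; rewrite mxE.
- by move=> v; apply/rowP => i; rewrite mxE (ord1 i).
Defined.

#[global, refine] Instance enc_prod (R : realType) T U (eT : Enc R T) (eU : Enc R U) :
    Enc R (T * U) :=
  @Build_Enc R (T * U) (esz T + esz U) (fun p => row_mx (eto p.1) (eto p.2))
    (fun v => (eof (lsubmx v), eof (rsubmx v))) _ _.
Proof.
- by case=> x y /=; rewrite row_mxKl row_mxKr !etoK.
- by move=> v /=; rewrite !eofK hsubmxK.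
Defined.

Section Definability.
Variable R : realType.

Definition dP {T} {eT : Enc R T} (P : T -> Prop) : Prop :=
  semialgebraic [set v | P (eof v)].

(** The graph is taken over the whole type: a map that matters only on a subset has to be continued
    by a definable default value. *)
Definition dfun {T U} {eT : Enc R T} {eU : Enc R U} (t : T -> U) : Prop :=
  dP (fun p : T * U => t p.1 = p.2).

(** Substitution of polynomials needs no projection. It supplies the rearrangements of tuples from
    which the composition of definable maps is built. *)
Definition pmap {T U} {eT : Enc R T} {eU : Enc R U} (t : T -> U) : Prop :=
  exists F : 'I_(esz U) -> pexpr R (esz T),
    forall x, eto (t x) = \row_i peval (F i) (eto x).

Section Gen0.
Context {T : Type} {eT : Enc R T}.
Implicit Types (P Q : T -> Prop).

Lemma dP_ext P Q : (forall x, P x <-> Q x) -> dP P -> dP Q.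
Proof. by move=> h; apply: sa_ext => v; exact: h. Qed.
Lemma dP_cst (A : Prop) : dP (fun _ : T => A).
Proof. exact: sa_const. Qed.
Lemma dP_and P Q : dP P -> dP Q -> dP (fun x => P x /\ Q x).
Proof. exact: sa_setI. Qed.
Lemma dP_or P Q : dP P -> dP Q -> dP (fun x => P x \/ Q x).
Proof. exact: SA_union. Qed.
Lemma dP_not P : dP P -> dP (fun x => ~ P x).
Proof. exact: SA_compl. Qed.
Lemma dP_imp P Q : dP P -> dP Q -> dP (fun x => P x -> Q x).
Proof.
move=> hP hQ; apply: (@dP_ext (fun x => ~ P x \/ Q x)); last exact: dP_or (dP_not hP) hQ.
by move=> x; split=> [[]//|h]; have [/h|] := pselect (P x); [right|left].
Qed.
Lemma dP_iff P Q : dP P -> dP Q -> dP (fun x => P x <-> Q x).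
Proof. by move=> hP hQ; apply: dP_and; apply: dP_imp. Qed.

End Gen0.

Section Gen.
Context {T U V : Type} {eT : Enc R T} {eU : Enc R U} {eV : Enc R V}.
Implicit Types (P Q : T -> Prop).

Lemma dP_pmap (P : U -> Prop) (t : T -> U) : dP P -> pmap t -> dP (fun x => P (t x)).
Proof.
move=> hP [F hF]; apply: sa_ext (sa_preim F hP) => v /=.
by rewrite -[v in X in P (eof X) <-> _]eofK -hF etoK.
Qed.

Lemma dP_ex (P : T -> U -> Prop) : dP (fun p : T * U => P p.1 p.2) ->
  dP (fun x => exists y, P x y).
Proof.
move=> hP; apply: sa_ext (sa_proj hP) => v /=.
split=> [[y]|[y hy]]; first by rewrite row_mxKl row_mxKr; exists (eof y).
by exists (eto y); rewrite row_mxKl row_mxKr etoK.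
Qed.

Lemma dP_all (P : T -> U -> Prop) : dP (fun p : T * U => P p.1 p.2) ->
  dP (fun x => forall y, P x y).
Proof.
move=> hP; apply: (@dP_ext _ _ (fun x => ~ exists y, ~ P x y)).
  by move=> x; split=> [h y|h [y]]; [apply: contrapT => hy; apply: h; exists y|apply].
by apply: dP_not; apply: (@dP_ex (fun x y => ~ P x y)); exact: (dP_not hP).
Qed.

Lemma dP_big_all (I : finType) (P : I -> T -> Prop) :
  (forall i, dP (P i)) -> dP (fun x => forall i, P i x).
Proof.
move=> hP; apply: (@dP_ext _ _ (fun x => forall i, i \in enum I -> P i x)).
  by move=> x; split=> h i => [|_]; [apply: h; rewrite mem_enum|exact: h].
elim: (enum I) => [|i s IH]; first by apply: dP_ext (dP_cst True).
apply: dP_ext (dP_and (hP i) IH) => x; split=> [[h1 h2] j|h].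
  by rewrite inE => /orP[/eqP->|/h2].
by split=> [|j hj]; apply: h; rewrite inE ?eqxx // hj orbT.
Qed.

Lemma dP_big_ex (I : finType) (P : I -> T -> Prop) :
  (forall i, dP (P i)) -> dP (fun x => exists i, P i x).
Proof.
move=> hP; apply: (@dP_ext _ _ (fun x => ~ forall i, ~ P i x)).
  move=> x; split=> [h|[i hi] h]; last exact: h hi.
  by apply: contrapT => h'; apply: h => i hi; apply: h'; exists i.
by apply: dP_not; apply: dP_big_all => i; apply: dP_not.
Qed.

Lemma pmap_id : pmap (fun x : T => x).
Proof. by exists (fun i => PVar R i) => x; apply/rowP => i; rewrite mxE. Qed.
Lemma pmap_fst : pmap (fun p : T * U => p.1).
Proof.
exists (fun i => PVar R (lshift _ i)) => x; apply/rowP => i.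
by rewrite mxE /= row_mxEl.
Qed.
Lemma pmap_snd : pmap (fun p : T * U => p.2).
Proof.
exists (fun i => PVar R (rshift _ i)) => x; apply/rowP => i.
by rewrite mxE /= row_mxEr.
Qed.
Lemma pmap_pair (s : T -> U) (t : T -> V) :
  pmap s -> pmap t -> pmap (fun x => (s x, t x)).
Proof.
move=> [F hF] [G hG].
exists (fun i => match fintype.split i with inl j => F j | inr j => G j end) => x.
apply/rowP => i; rewrite mxE /= hF hG -(splitK i).
by case: (fintype.split i) => j; rewrite ?(unsplitK (inl _)) ?(unsplitK (inr _)) ?row_mxEl ?row_mxEr mxE.
Qed.
Lemma pmap_comp (s : U -> V) (t : T -> U) :
  pmap s -> pmap t -> pmap (fun x => s (t x)).
Proof.
move=> [F hF] [G hG]; exists (fun i => psubst G (F i)) => x.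
by apply/rowP => i; rewrite mxE hF mxE peval_subst hG.
Qed.
End Gen.

Section Gen2.
Context {T U V : Type} {eT : Enc R T} {eU : Enc R U} {eV : Enc R V}.

Lemma dP_eqU : dP (fun p : U * U => p.1 = p.2).
Proof.
apply: (@dP_ext _ _ (fun p : U * U => forall i, eto p.1 0 i = eto p.2 0 i)).
  move=> p; split=> [h|->//]; apply: (can_inj etoK); exact/rowP.
apply: dP_big_all => i.
pose p := PAdd (PVar R (lshift (esz U) i)) (PMul (PConst _ (-1)) (PVar R (rshift (esz U) i))).
apply: sa_ext (sa_eq0 p) => v /=.
rewrite !eofK mulN1r.
have -> : v 0 (lshift (esz U) i) = lsubmx v 0 i by rewrite mxE.
have -> : v 0 (rshift (esz U) i) = rsubmx v 0 i by rewrite mxE.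
by split=> [/eqP|->]; rewrite ?subrr // subr_eq0 => /eqP.
Qed.

Lemma dfun_pmap (t : T -> U) : pmap t -> dfun t.
Proof.
move=> ht; apply: (@dP_pmap _ _ _ _ (fun p : U * U => p.1 = p.2)
   (fun p : T * U => (t p.1, p.2))); first exact: dP_eqU.
by apply: pmap_pair; [apply: pmap_comp => //; exact: pmap_fst|exact: pmap_snd].
Qed.

Lemma dP_fun (P : U -> Prop) (t : T -> U) : dP P -> dfun t -> dP (fun x => P (t x)).
Proof.
move=> hP ht; apply: (@dP_ext _ _ (fun x => exists y, t x = y /\ P y)).
  by move=> x; split=> [[y [->]]|h] //; exists (t x).
apply: dP_ex; apply: dP_and; first exact: ht.
exact: (dP_pmap hP pmap_snd).
Qed.
End Gen2.

Section Gen3.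
Context {T U V : Type} {eT : Enc R T} {eU : Enc R U} {eV : Enc R V}.

Lemma dfun_comp (s : U -> V) (t : T -> U) : dfun s -> dfun t -> dfun (fun x => s (t x)).
Proof.
move=> hs ht.
apply: (@dP_ext _ _ (fun p : T * V => exists y, t p.1 = y /\ s y = p.2)).
  by move=> p; split=> [[y [<-]]|h] //; exists (t p.1).
apply: dP_ex; apply: dP_and.
  apply: (@dP_pmap _ _ _ _ (fun p : T * U => t p.1 = p.2)
    (fun q : T * V * U => (q.1.1, q.2)) ht).
  apply: pmap_pair; last exact: pmap_snd.
  by apply: (pmap_comp pmap_fst pmap_fst).
apply: (@dP_pmap _ _ _ _ (fun p : U * V => s p.1 = p.2)
    (fun q : T * V * U => (q.2, q.1.2)) hs).
apply: pmap_pair; first exact: pmap_snd.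
by apply: (pmap_comp pmap_snd pmap_fst).
Qed.

End Gen3.

Section Gen3b.
Context {T U V : Type} {eT : Enc R T} {eU : Enc R U} {eV : Enc R V}.

Lemma dfun_id : dfun (fun x : T => x). Proof. exact: (dfun_pmap pmap_id). Qed.
Lemma dfun_fst (t : T -> U * V) : dfun t -> dfun (fun x => (t x).1).
Proof. move=> h; exact: dfun_comp (dfun_pmap pmap_fst) h. Qed.
Lemma dfun_snd (t : T -> U * V) : dfun t -> dfun (fun x => (t x).2).
Proof. move=> h; exact: dfun_comp (dfun_pmap pmap_snd) h. Qed.
Lemma dfun_pair (s : T -> U) (t : T -> V) :
  dfun s -> dfun t -> dfun (fun x => (s x, t x)).
Proof.
move=> hs ht.
apply: (@dP_ext _ _ (fun p : T * (U * V) => s p.1 = p.2.1 /\ t p.1 = p.2.2)).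
  by move=> [x [y z]] /=; split=> [[-> ->]|[-> ->]].
apply: dP_and.
  apply: (@dP_pmap _ _ _ _ (fun p : T * U => s p.1 = p.2)
    (fun q : T * (U * V) => (q.1, q.2.1)) hs).
  apply: pmap_pair; first exact: pmap_fst.
  by apply: (pmap_comp pmap_fst pmap_snd).
apply: (@dP_pmap _ _ _ _ (fun p : T * V => t p.1 = p.2)
    (fun q : T * (U * V) => (q.1, q.2.2)) ht).
apply: pmap_pair; first exact: pmap_fst.
by apply: (pmap_comp pmap_snd pmap_snd).
Qed.
End Gen3b.

Section Gen4.
Context {T U V : Type} {eT : Enc R T} {eU : Enc R U} {eV : Enc R V}.

Lemma dfun_cst (c : U) : dfun (fun _ : T => c).
Proof.
apply: dfun_pmap; exists (fun i => PConst _ (eto c 0 i)) => x.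
by apply/rowP => i; rewrite mxE.
Qed.
Lemma dfun_ext (s t : T -> U) : (forall x, s x = t x) -> dfun s -> dfun t.
Proof. by move=> h; apply: dP_ext => p; rewrite h. Qed.
Lemma dP_eq (s t : T -> U) : dfun s -> dfun t -> dP (fun x => s x = t x).
Proof.
by move=> hs ht; exact: (@dP_fun _ _ _ _ (fun p => p.1 = p.2) _ dP_eqU (dfun_pair hs ht)).
Qed.
Lemma dP_fun2 (P : U -> V -> Prop) (s : T -> U) (t : T -> V) :
  dP (fun p : U * V => P p.1 p.2) -> dfun s -> dfun t -> dP (fun x => P (s x) (t x)).
Proof. by move=> hP hs ht; exact: (dP_fun hP (dfun_pair hs ht)). Qed.

Lemma dfun_unique (P : T -> U -> Prop) (t : T -> U) :
  dP (fun p : T * U => P p.1 p.2) -> (forall x y, t x = y <-> P x y) -> dfun t.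
Proof. by move=> hP h; apply: dP_ext hP => p; rewrite h. Qed.

Lemma dfun_if (P : T -> Prop) (s t : T -> U) : dP P -> dfun s -> dfun t ->
  dfun (fun x => if `[< P x >] then s x else t x).
Proof.
move=> hP hs ht; apply: (@dP_ext _ _ (fun p : T * U =>
  (P p.1 /\ s p.1 = p.2) \/ (~ P p.1 /\ t p.1 = p.2))).
  move=> p; case: asboolP => h; split=> [[[]|[]]//|]; by [left|right].
have hP1 := @dP_pmap (T * U) T _ _ P (fun p => p.1) hP pmap_fst.
by apply: dP_or; apply: dP_and => //; exact: dP_not.
Qed.
End Gen4.

Lemma dP_gt0 : dP (fun x : R => 0 < x).
Proof. exact: (SA_pos (PVar R (0 : 'I_1))). Qed.

Lemma dfun_add0 : dfun (fun p : R * R => p.1 + p.2).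
Proof.
apply: dfun_pmap; exists (fun _ => PAdd (PVar R (lshift 1 0)) (PVar R (rshift 1 0))).
move=> x; apply/rowP => i; rewrite !mxE /=.
by rewrite (row_mxEl _ _ 0) (row_mxEr _ _ 0) !mxE.
Qed.
Lemma dfun_mul0 : dfun (fun p : R * R => p.1 * p.2).
Proof.
apply: dfun_pmap; exists (fun _ => PMul (PVar R (lshift 1 0)) (PVar R (rshift 1 0))).
move=> x; apply/rowP => i; rewrite !mxE /=.
by rewrite (row_mxEl _ _ 0) (row_mxEr _ _ 0) !mxE.
Qed.

Section Reals.
Context {T : Type} {eT : Enc R T}.
Implicit Types s t : T -> R.
Lemma dfun_add s t : dfun s -> dfun t -> dfun (fun x => s x + t x).
Proof. by move=> hs ht; exact: (dfun_comp dfun_add0 (dfun_pair hs ht)). Qed.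
Lemma dfun_mul s t : dfun s -> dfun t -> dfun (fun x => s x * t x).
Proof. by move=> hs ht; exact: (dfun_comp dfun_mul0 (dfun_pair hs ht)). Qed.
Lemma dfun_opp s : dfun s -> dfun (fun x => - s x).
Proof.
move=> hs; apply: (@dfun_ext _ _ _ _ (fun x => (-1) * s x)).
  by move=> x; rewrite mulN1r.
by apply: dfun_mul => //; exact: dfun_cst.
Qed.
Lemma dfun_sub s t : dfun s -> dfun t -> dfun (fun x => s x - t x).
Proof. by move=> hs ht; apply: dfun_add => //; exact: dfun_opp. Qed.
Lemma dfun_exp s k : dfun s -> dfun (fun x => s x ^+ k).
Proof.
move=> hs; elim: k => [|k IH].
  by apply: (@dfun_ext _ _ _ _ (fun _ => 1)); [move=> x; rewrite expr0|exact: dfun_cst].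
by apply: (@dfun_ext _ _ _ _ (fun x => s x * s x ^+ k));
  [move=> x; rewrite exprS|exact: dfun_mul].
Qed.
Lemma dP_lt s t : dfun s -> dfun t -> dP (fun x => s x < t x).
Proof.
move=> hs ht; apply: (@dP_ext _ _ (fun x => 0 < t x - s x)).
  by move=> x; rewrite subr_gt0.
exact: (dP_fun dP_gt0 (dfun_sub ht hs)).
Qed.
Lemma dP_le s t : dfun s -> dfun t -> dP (fun x => s x <= t x).
Proof.
move=> hs ht; apply: (@dP_ext _ _ (fun x => ~ t x < s x)).
  by move=> x; rewrite leNgt; split=> /negP.
by apply: dP_not; apply: dP_lt.
Qed.
Lemma dfun_sum (I : Type) (r : seq I) (Q : pred I) (F : I -> T -> R) :
  (forall i, dfun (F i)) -> dfun (fun x => \sum_(i <- r | Q i) F i x).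
Proof.
move=> hF; elim: r => [|i r IH].
  by apply: (@dfun_ext _ _ _ _ (fun _ => 0)); [move=> x; rewrite big_nil|exact: dfun_cst].
case E: (Q i).
  by apply: (@dfun_ext _ _ _ _ (fun x => F i x + \sum_(i <- r | Q i) F i x));
   [move=> x; rewrite big_cons E|exact: dfun_add].
by apply: dfun_ext IH => x; rewrite big_cons E.
Qed.
Lemma dfun_prod (I : Type) (r : seq I) (Q : pred I) (F : I -> T -> R) :
  (forall i, dfun (F i)) -> dfun (fun x => \prod_(i <- r | Q i) F i x).
Proof.
move=> hF; elim: r => [|i r IH].
  by apply: (@dfun_ext _ _ _ _ (fun _ => 1)); [move=> x; rewrite big_nil|exact: dfun_cst].
case E: (Q i).
  by apply: (@dfun_ext _ _ _ _ (fun x => F i x * \prod_(i <- r | Q i) F i x));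
   [move=> x; rewrite big_cons E|exact: dfun_mul].
by apply: dfun_ext IH => x; rewrite big_cons E.
Qed.
End Reals.

Section Reals2.
Context {T : Type} {eT : Enc R T}.
Implicit Types s t : T -> R.
Lemma dfun_inv s : dfun s -> dfun (fun x => (s x)^-1).
Proof.
move=> hs; apply: (@dfun_unique _ _ _ _ (fun x y => (s x = 0 /\ y = 0) \/ s x * y = 1)).
  have hs1 : dfun (fun p : T * R => s p.1) by apply: dfun_comp hs _; exact: (dfun_pmap pmap_fst).
  have h2 : dfun (fun p : T * R => p.2) by exact: (dfun_pmap pmap_snd).
  apply: dP_or; first by apply: dP_and; apply: dP_eq => //; exact: dfun_cst.
  by apply: dP_eq; [exact: dfun_mul|exact: dfun_cst].
move=> x y; have [->|h] := eqVneq (s x) 0.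
  by rewrite invr0 mul0r; split=> [<-|[[]//|/eqP]]; [left|rewrite eq_sym oner_eq0].
split=> [<-|[[h0]|h1]]; first by right; rewrite mulfV.
  by rewrite h0 eqxx in h.
by rewrite -[RHS]mul1r -[X in X * y](mulVf h) -mulrA h1 mulr1.
Qed.
Lemma dfun_norm s : dfun s -> dfun (fun x => `|s x|).
Proof.
move=> hs; apply: dfun_ext (dfun_if (dP_lt hs (dfun_cst 0)) (dfun_opp hs) hs) => x.
by case: asboolP => h; [rewrite ltr0_norm|rewrite ger0_norm // leNgt; apply/negP].
Qed.
Lemma dfun_sqrt s : dfun s -> dfun (fun x => Num.sqrt (s x)).
Proof.
move=> hs; apply: (@dfun_unique _ _ _ _ (fun x y =>
  (s x < 0 /\ y = 0) \/ (0 <= y /\ y * y = s x))).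
  have hs1 : dfun (fun p : T * R => s p.1) by apply: dfun_comp hs _; exact: (dfun_pmap pmap_fst).
  have h2 : dfun (fun p : T * R => p.2) by exact: (dfun_pmap pmap_snd).
  apply: dP_or; apply: dP_and; [apply: dP_lt|apply: dP_eq|apply: dP_le|apply: dP_eq] => //;
    try exact: dfun_cst; exact: dfun_mul.
move=> x y; split=> [<-|[[h ->]|[h <-]]].
- have [h|h] := ltP (s x) 0; [left|right]; last by rewrite sqrtr_ge0 -expr2 sqr_sqrtr.
  by rewrite ler0_sqrtr // ltW.
- by rewrite ler0_sqrtr // ltW.
- by rewrite -expr2 sqrtr_sqr ger0_norm.
Qed.
Lemma dfun_coord n (t : T -> 'rV[R]_n) i : dfun t -> dfun (fun x => t x 0 i).
Proof.
apply: (@dfun_comp _ _ _ _ _ _ (fun v : 'rV[R]_n => v 0 i)).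
by apply: dfun_pmap; exists (fun _ => PVar R i) => v; apply/rowP => j; rewrite !mxE.
Qed.
Lemma dfun_row n (t : T -> 'rV[R]_n) : (forall i, dfun (fun x => t x 0 i)) -> dfun t.
Proof.
move=> h; apply: (@dP_ext _ _ (fun p : T * 'rV[R]_n => forall i, t p.1 0 i = p.2 0 i)).
  by move=> p; split=> [/rowP|->].
apply: dP_big_all => i; apply: (@dP_pmap _ _ _ _ (fun p : T * R => t p.1 0 i = p.2)
  (fun p : T * 'rV[R]_n => (p.1, p.2 0 i)) (h i)).
apply: pmap_pair; first exact: pmap_fst.
exists (fun _ => PVar R (rshift (esz T) i)) => v; apply/rowP => j.
by rewrite !mxE /= row_mxEr.
Qed.
End Reals2.

Section Rows.
Context {T : Type} {eT : Enc R T}.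
Variable n : nat.
Implicit Types s t : T -> 'rV[R]_n.
Lemma dfun_addv s t : dfun s -> dfun t -> dfun (fun x => s x + t x).
Proof.
move=> hs ht; apply: dfun_row => i; apply: (@dfun_ext _ _ _ _ (fun x => s x 0 i + t x 0 i)).
  by move=> x; rewrite mxE.
by apply: dfun_add; exact: dfun_coord.
Qed.
Lemma dfun_oppv s : dfun s -> dfun (fun x => - s x).
Proof.
move=> hs; apply: dfun_row => i; apply: (@dfun_ext _ _ _ _ (fun x => - s x 0 i)).
  by move=> x; rewrite mxE.
by apply: dfun_opp; exact: dfun_coord.
Qed.
Lemma dfun_scale (c : T -> R) s : dfun c -> dfun s -> dfun (fun x => c x *: s x).
Proof.
move=> hc hs; apply: dfun_row => i; apply: (@dfun_ext _ _ _ _ (fun x => c x * s x 0 i)).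
  by move=> x; rewrite mxE.
by apply: dfun_mul => //; exact: dfun_coord.
Qed.
Lemma dfun_row_mx k s (t : T -> 'rV[R]_k) :
  dfun s -> dfun t -> dfun (fun x => row_mx (s x) (t x)).
Proof.
move=> hs ht; apply: dfun_row => i; rewrite -(splitK i); case: (fintype.split i) => j /=.
  by apply: dfun_ext (dfun_coord j hs) => x; rewrite row_mxEl.
by apply: dfun_ext (dfun_coord j ht) => x; rewrite row_mxEr.
Qed.
Lemma dP_normlt s (c : T -> R) : dfun s -> dfun c -> dP (fun x => `|s x| < c x).
Proof.
(* The norm is the maximum norm. The conjunct [0 < c x] does not follow from the others when [n] is
   0. *)
move=> hs hc; apply: (@dP_ext _ _ (fun x => 0 < c x /\ forall i, `|s x 0 i| < c x)).
  move=> x; split=> [[c0 h]|h].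
    rewrite -[`|_|]/(mx_norm _) mx_normrE; apply/bigmax_ltP; split=> //= -[i j] _.
    by rewrite /= (ord1 i).
  have c0 : 0 < c x by exact: le_lt_trans h.
  split=> // i; apply: le_lt_trans h.
  rewrite -[leRHS]/(mx_norm _) mx_normrE.
  exact: (@le_bigmax _ _ _ _ (fun i : 'I_1 * 'I_n => `|s x i.1 i.2|) (0, i)).
apply: dP_and; first by apply: dP_lt => //; exact: dfun_cst.
by apply: dP_big_all => i; apply: dP_lt => //; apply: dfun_norm; exact: dfun_coord.
Qed.
End Rows.

End Definability.

(** Definability is proved along the syntax of the goal. A predicate or function outside the listed
    operations is recognized through a definability hypothesis of the context, which is why such
    facts are put there before [dtac] is called. *)
Ltac dstep :=
  first
  [ assumption
  | match goal with
    | |- dP (fun _ => _ /\ _) => apply: dP_and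
    | |- dP (fun _ => _ \/ _) => apply: dP_or
    | |- dP (fun _ => ~ _) => apply: dP_not
    | |- dP (fun _ => _ <-> _) => apply: dP_iff
    | |- dP (fun x => @?A x -> @?B x) => apply: (@dP_imp _ _ _ A B)
    | |- dP (fun x => exists y : 'I_ _, _) => apply: dP_big_ex => ?
    | |- dP (fun x => forall y : 'I_ _, _) => apply: dP_big_all => ?
    | |- dP (fun x => exists y : ?U, _) => apply: dP_ex; cbv beta
    | |- dP (fun x => forall y : ?U, _) => apply: dP_all; cbv beta
    | |- dP (fun x => is_true (Order.lt (Num.norm _) _)) => apply: dP_normlt
    | |- dP (fun x => is_true (_ < _)) => apply: dP_lt
    | |- dP (fun x => is_true (_ <= _)) => apply: dP_le
    | |- dP (fun x => _ = _) => apply: dP_eq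
    | |- dfun (fun x => x) => exact: dfun_id
    | |- dfun (fun x => ?c) => exact: dfun_cst
    | |- dfun (@fst _ _) => apply: dfun_fst; exact: dfun_id
    | |- dfun (@snd _ _) => apply: dfun_snd; exact: dfun_id
    | |- dfun (fun x => fst _) => apply: dfun_fst
    | |- dfun (fun x => snd _) => apply: dfun_snd
    | |- dfun (fun x => (_, _)) => apply: dfun_pair
    | |- dfun (fun x => _ + _) => first [apply: dfun_add | apply: dfun_addv]
    | |- dfun (fun x => - _) => first [apply: dfun_opp | apply: dfun_oppv]
    | |- dfun (fun x => _ * _) => apply: dfun_mul
    | |- dfun (fun x => _ *: _) => apply: dfun_scale
    | |- dfun (fun x => _ ^+ _) => apply: dfun_exp
    | |- dfun (fun x => _ ^-1) => apply: dfun_inv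
    | |- dfun (fun x => Num.sqrt _) => apply: dfun_sqrt
    | |- dfun (fun x => `| _ |) => apply: dfun_norm
    | |- dfun (fun x => row_mx _ _) => apply: dfun_row_mx
    | |- dfun (fun x => bigop _ _ _) => first [apply: dfun_sum => ? | apply: dfun_prod => ?]
    | |- dfun (fun x => fun_of_matrix _ _ _) => apply: dfun_coord
    | H : dP (fun p => ?P (fst p) (snd p)) |- dP (fun x => ?P _ _) => apply: (dP_fun2 H)
    | H : dfun (fun p => ?P (fst p) (snd p)) |- dfun (fun x => ?P (@?a x) (@?b x)) =>
        apply: (@dfun_comp _ _ _ _ _ _ _ _ (fun x => (a x, b x)) H)
    | H : dP ?P |- dP (fun x => ?P _) => apply: (dP_fun H)
    | H : dfun ?f |- dfun (fun x => ?f _) => apply: (dfun_comp H)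
    | |- dP (fun x => ?c) => exact: dP_cst
    end ].
Ltac dtac := cbv beta; repeat (dstep; cbv beta).

(** * Gradients and smooth functions *)

Section Calculus.
Variable R : realType.

Lemma norm_coord m (v : 'rV[R]_m) i : `|v 0 i| <= `|v|.
Proof.
rewrite -[leRHS]/(mx_norm _) mx_normrE.
exact: (@le_bigmax _ _ _ _ (fun i : 'I_1 * 'I_m => `|v i.1 i.2|) (0, i)).
Qed.

Lemma norm_le m (v : 'rV[R]_m) c : 0 <= c -> (forall i, `|v 0 i| <= c) -> `|v| <= c.
Proof.
move=> c0 h; rewrite -[`|_|]/(mx_norm _) mx_normrE; apply/bigmax_leP; split=> //= -[i j] _.
by rewrite /= (ord1 i).
Qed.

Lemma norm_lt m (v : 'rV[R]_m) c : 0 < c -> (forall i, `|v 0 i| < c) -> `|v| < c.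
Proof.
move=> c0 h; rewrite -[`|_|]/(mx_norm _) mx_normrE; apply/bigmax_ltP; split=> //= -[i j] _.
by rewrite /= (ord1 i).
Qed.

Definition dot m (u v : 'rV[R]_m) : R := \sum_i u 0 i * v 0 i.

Lemma dot_le m (u v : 'rV[R]_m) : `|dot u v| <= m%:R * `|u| * `|v|.
Proof.
apply: (le_trans (ler_norm_sum _ _ _)).
apply: (@le_trans _ _ (\sum_(i < m) `|u| * `|v|)).
  by apply: ler_sum => i _; rewrite normrM ler_pM ?norm_coord.
by rewrite sumr_const card_ord -mulrA mulr_natl.
Qed.

Lemma dotC m (u v : 'rV[R]_m) : dot u v = dot v u.
Proof. by apply: eq_bigr => i _; rewrite mulrC. Qed.
Lemma dotDl m (u v w : 'rV[R]_m) : dot (u + v) w = dot u w + dot v w.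
Proof. by rewrite -big_split; apply: eq_bigr => i _; rewrite mxE mulrDl. Qed.
Lemma dotDr m (u v w : 'rV[R]_m) : dot w (u + v) = dot w u + dot w v.
Proof. by rewrite dotC dotDl !(dotC w). Qed.
Lemma dotZl m c (u v : 'rV[R]_m) : dot (c *: u) v = c * dot u v.
Proof. by rewrite mulr_sumr; apply: eq_bigr => i _; rewrite mxE mulrA. Qed.
Lemma dotZr m c (u v : 'rV[R]_m) : dot u (c *: v) = c * dot u v.
Proof. by rewrite dotC dotZl dotC. Qed.
Lemma dotNl m (u v : 'rV[R]_m) : dot (- u) v = - dot u v.
Proof. by rewrite -scaleN1r dotZl mulN1r. Qed.
Lemma dotNr m (u v : 'rV[R]_m) : dot u (- v) = - dot u v.
Proof. by rewrite dotC dotNl dotC. Qed.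
Lemma dotBl m (u v w : 'rV[R]_m) : dot (u - v) w = dot u w - dot v w.
Proof. by rewrite dotDl dotNl. Qed.
Lemma dotBr m (u v w : 'rV[R]_m) : dot w (u - v) = dot w u - dot w v.
Proof. by rewrite dotDr dotNr. Qed.
Lemma dot0l m (v : 'rV[R]_m) : dot 0 v = 0.
Proof. by rewrite -(scale0r 0) dotZl mul0r. Qed.
Lemma dot_suml m (I : Type) (r : seq I) (P : pred I) (F : I -> 'rV[R]_m) v :
  dot (\sum_(i <- r | P i) F i) v = \sum_(i <- r | P i) dot (F i) v.
Proof.
by elim/big_rec2: _ => [|i x y _ <-]; rewrite ?dot0l // dotDl.
Qed.
Lemma dot_delta m (v : 'rV[R]_m) i : dot v (delta_mx 0 i) = v 0 i.
Proof.
rewrite /dot (bigD1 i) //= mxE !eqxx mulr1 big1 ?addr0 // => j ji.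
by rewrite mxE (negbTE ji) andbF mulr0.
Qed.
Lemma norm_delta m (i : 'I_m) : `|delta_mx 0 i : 'rV[R]_m| <= 1.
Proof. by apply: norm_le => // j; rewrite mxE; case: (_ && _); rewrite ?normr0 ?normr1. Qed.

Definition hasgrad m (f : 'rV[R]_m -> R) (x g : 'rV[R]_m) :=
  forall e, 0 < e -> exists2 d, 0 < d &
    forall h, `|h| < d -> `|f (x + h) - f x - dot g h| <= e * `|h|.

Lemma hasgrad_lip m (f : 'rV[R]_m -> R) x g : hasgrad f x g ->
  exists2 d, 0 < d &
    forall h, `|h| < d -> `|f (x + h) - f x| <= (m%:R * `|g| + 1) * `|h|.
Proof.
move=> /(_ 1 ltr01)[d d0 hd]; exists d => // h /hd; rewrite mul1r => h1.
rewrite -[X in `|X|](subrK (dot g h)); apply: le_trans (ler_normD _ _) _.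
by rewrite addrC mulrDl mul1r lerD // dot_le.
Qed.

Lemma hasgrad_cont m (f : 'rV[R]_m -> R) x g : hasgrad f x g ->
  forall e, 0 < e -> exists2 d, 0 < d & forall h, `|h| < d -> `|f (x + h) - f x| < e.
Proof.
move=> /hasgrad_lip[d d0 hd] e e0; set C := (_ + 1) in hd.
have C0 : 0 < C by rewrite ltr_wpDl // mulr_ge0.
exists (Num.min d (e / C)) => [|h]; first by rewrite lt_min d0 divr_gt0.
rewrite lt_min => /andP[/hd h1 h2]; apply: le_lt_trans h1 _.
by rewrite mulrC -ltr_pdivlMr.
Qed.

Lemma hasgrad_ext m (f f' : 'rV[R]_m -> R) x g : hasgrad f x g ->
  (exists2 d, 0 < d & forall h, `|h| < d -> f (x + h) = f' (x + h)) -> hasgrad f' x g.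
Proof.
move=> hf [d1 d10 h1] e /hf[d2 d20 h2].
exists (Num.min d1 d2) => [|h]; first by rewrite lt_min d10.
rewrite lt_min => /andP[h3 h4]; rewrite -h1 // -[X in f' X]addr0 -h1 ?normr0 // addr0.
exact: h2.
Qed.

Lemma hasgrad_cst m (c : R) (x : 'rV[R]_m) : hasgrad (fun _ => c) x 0.
Proof.
move=> e e0; exists 1 => // h _; rewrite subrr dot0l subr0 normr0.
by rewrite mulr_ge0 // ltW.
Qed.

Lemma hasgrad_coord m (x : 'rV[R]_m) i : hasgrad (fun v => v 0 i) x (delta_mx 0 i).
Proof.
move=> e e0; exists 1 => // h _; rewrite dotC dot_delta mxE.
by rewrite [_ + h _ _]addrC addrK subrr normr0 mulr_ge0 // ltW.
Qed.

Lemma hasgrad_add m (f1 f2 : 'rV[R]_m -> R) x g1 g2 :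
  hasgrad f1 x g1 -> hasgrad f2 x g2 -> hasgrad (fun v => f1 v + f2 v) x (g1 + g2).
Proof.
move=> h1 h2 e e0; have e20 : 0 < e / 2 by rewrite divr_gt0.
have [d1 d10 k1] := h1 _ e20; have [d2 d20 k2] := h2 _ e20.
exists (Num.min d1 d2) => [|h]; first by rewrite lt_min d10.
rewrite lt_min => /andP[/k1 h3 /k2 h4].
have -> : f1 (x + h) + f2 (x + h) - (f1 x + f2 x) - dot (g1 + g2) h =
  (f1 (x + h) - f1 x - dot g1 h) + (f2 (x + h) - f2 x - dot g2 h).
  by rewrite dotDl; ring.
by rewrite [e]splitr mulrDl; apply: le_trans (ler_normD _ _) _; exact: lerD.
Qed.

Lemma hasgrad_comp m p (F : 'rV[R]_p -> R) (u : 'rV[R]_m -> 'rV[R]_p) x g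
    (G : 'I_p -> 'rV[R]_m) :
  (forall j, hasgrad (fun v => u v 0 j) x (G j)) -> hasgrad F (u x) g ->
  hasgrad (fun v => F (u v)) x (\sum_j g 0 j *: G j).
Proof.
move=> hu hF e e0.
have [d hd d0] : exists2 d, forall j h, `|h| < d ->
    `|u (x + h) 0 j - u x 0 j| <= (m%:R * `|G j| + 1) * `|h| & 0 < d.
  have /choice[dj hdj] : forall j, exists d, 0 < d /\ forall h, `|h| < d ->
      `|u (x + h) 0 j - u x 0 j| <= (m%:R * `|G j| + 1) * `|h|.
    by move=> j; have [d d0 hd] := hasgrad_lip (hu j); exists d.
  exists (\big[Num.min/1]_j dj j) => [j h|].
    by move=> /bigmin_gtP[_ /(_ j isT)]; apply: (hdj j).2.
  by apply/bigmin_gtP; split=> // j _; exact: (hdj j).1.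
set C := \sum_j (m%:R * `|G j| + 1) + 1.
have C0 : 0 < C.
  by rewrite ltr_wpDl // sumr_ge0 // => j _; rewrite addr_ge0 // mulr_ge0.
have hC h : `|h| < d -> `|u (x + h) - u x| <= C * `|h|.
  move=> hh; apply: norm_le; first by rewrite mulr_ge0 // ltW.
  move=> j; rewrite !mxE; apply: le_trans (hd j h hh) _.
  rewrite ler_wpM2r // /C (bigD1 j) //=.
  set s := \sum_(i | _) _; have s0 : 0 <= s.
    by apply: sumr_ge0 => i _; rewrite addr_ge0 // mulr_ge0.
  by lra.
set e1 := e / 2 / C.
have e10 : 0 < e1 by rewrite !divr_gt0.
have [dF dF0 kF] := hF _ e10.
set e2 := e / 2 / (p%:R * `|g| + 1).
have P0 : 0 < p%:R * `|g| + 1 by rewrite ltr_wpDl // mulr_ge0.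
have e20 : 0 < e2 by rewrite !divr_gt0.
have [d2 hd2 d20] : exists2 d, forall j h, `|h| < d ->
    `|u (x + h) 0 j - u x 0 j - dot (G j) h| <= e2 * `|h| & 0 < d.
  have /choice[dj hdj] : forall j, exists d, 0 < d /\ forall h, `|h| < d ->
      `|u (x + h) 0 j - u x 0 j - dot (G j) h| <= e2 * `|h|.
    by move=> j; have [d' d0' hd'] := hu j _ e20; exists d'.
  exists (\big[Num.min/1]_j dj j) => [j h|].
    by move=> /bigmin_gtP[_ /(_ j isT)]; apply: (hdj j).2.
  by apply/bigmin_gtP; split=> // j _; exact: (hdj j).1.
exists (Num.min (Num.min d d2) (dF / C)).
  by rewrite !lt_min d0 d20 divr_gt0.
move=> h; rewrite !lt_min => /andP[/andP[h1 h2] h3].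
set k := u (x + h) - u x.
have hk : `|k| < dF by apply: le_lt_trans (hC h h1) _; rewrite mulrC -ltr_pdivlMr.
have Ek : u x + k = u (x + h) by rewrite /k addrC subrK.
have := kF _ hk; rewrite Ek => hF1.
have -> : F (u (x + h)) - F (u x) - dot (\sum_j g 0 j *: G j) h =
   (F (u (x + h)) - F (u x) - dot g k) +
   dot g (\row_j (u (x + h) 0 j - u x 0 j - dot (G j) h)).
  rewrite dot_suml.
  have -> : dot g (\row_j (u (x + h) 0 j - u x 0 j - dot (G j) h)) =
     dot g k - \sum_j dot (g 0 j *: G j) h.
    rewrite -sumrB; apply: eq_bigr => j _; rewrite !mxE dotZl; ring.
  ring.
apply: le_trans (ler_normD _ _) _; rewrite [e]splitr mulrDl; apply: lerD.
  apply: le_trans hF1 _; apply: le_trans (ler_wpM2l (ltW e10) (hC h h1)) _.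
  by rewrite mulrA /e1 divfK // gt_eqF.
apply: le_trans (dot_le _ _) _.
apply: (@le_trans _ _ ((p%:R * `|g| + 1) * (e2 * `|h|))).
  apply: ler_pM; rewrite ?lerDl ?mulr_ge0 //.
  apply: norm_le; first by rewrite mulr_ge0 // ltW.
  by move=> j; rewrite mxE; exact: hd2.
by rewrite mulrA [_ * e2]mulrC /e2 divfK // gt_eqF.
Qed.

Lemma hasgrad_mul m (f1 f2 : 'rV[R]_m -> R) x g1 g2 :
  hasgrad f1 x g1 -> hasgrad f2 x g2 ->
  hasgrad (fun v => f1 v * f2 v) x (f2 x *: g1 + f1 x *: g2).
Proof.
move=> h1 h2.
pose u v : 'rV[R]_2 := \row_j (if j == 0 then f1 v else f2 v).
pose G (j : 'I_2) := if j == 0 then g1 else g2.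
pose g : 'rV[R]_2 := \row_j (if j == 0 then f2 x else f1 x).
have := @hasgrad_comp m 2 (fun v => v 0 0 * v 0 1) u x g G.
rewrite big_ord_recl big_ord1 /G /g !mxE /= => H.
apply: hasgrad_ext (H _ _) _.
- move=> j; have [->|jn] := eqVneq j 0.
    by apply: hasgrad_ext h1 _; exists 1 => // h _; rewrite mxE.
  by apply: hasgrad_ext h2 _; exists 1 => // h _; rewrite mxE (negbTE jn).
- move=> e e0; exists e => // h he.
  have E1 : lift ord0 ord0 = 1 :> 'I_2 by apply: val_inj.
  rewrite /dot big_ord_recl big_ord1 E1 !mxE /=.
  set h0 := h 0 0; set h1' := h 0 1.
  have -> : (f1 x + h0) * (f2 x + h1') - f1 x * f2 x - (f2 x * h0 + f1 x * h1') = h0 * h1'.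
    by ring.
  rewrite normrM; apply: ler_pM; rewrite ?norm_coord //.
  by apply: le_trans (norm_coord _ _) (ltW he).
- by exists 1 => // h _; rewrite !mxE.
Qed.

Lemma hasgrad_real m (s : R -> R) s' (f : 'rV[R]_m -> R) x g : hasgrad f x g ->
  (forall e, 0 < e -> exists2 d, 0 < d & forall h, `|h| < d ->
     `|s (f x + h) - s (f x) - s' * h| <= e * `|h|) ->
  hasgrad (fun v => s (f v)) x (s' *: g).
Proof.
move=> h1 h2.
pose u v : 'rV[R]_1 := \row_j f v.
have := @hasgrad_comp m 1 (fun v => s (v 0 0)) u x (\row_j s') (fun _ => g).
rewrite big_ord1 mxE => H.
apply: hasgrad_ext (H _ _) _.
- by move=> j; apply: hasgrad_ext h1 _; exists 1 => // h _; rewrite mxE.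
- move=> e e0; have [d d0 hd] := h2 _ e0; exists d => // h hh.
  rewrite /dot big_ord1 !mxE.
  have hh' : `|h 0 0| < d by apply: le_lt_trans (norm_coord _ _) hh.
  by apply: le_trans (hd _ hh') _; rewrite ler_wpM2l ?norm_coord // ltW.
- by exists 1 => // h _; rewrite !mxE.
Qed.

Lemma hasgrad_inv m (f : 'rV[R]_m -> R) x g : f x != 0 ->
  hasgrad f x g -> hasgrad (fun v => (f v)^-1) x (- (f x) ^- 2 *: g).
Proof.
move=> f0 hf; apply: (@hasgrad_real m (fun s => s^-1) (- (f x) ^- 2)) => //.
set a := f x; move=> e e0.
have a0 : 0 < `|a| by rewrite normr_gt0.
exists (Num.min (`|a| / 2) (e * `|a| ^+ 3 / 2)).
  by rewrite lt_min !divr_gt0 // mulr_gt0 // exprn_gt0.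
move=> h; rewrite lt_min => /andP[h1 h2].
have h3 : `|a| / 2 <= `|a + h|.
  have : `|a| - `|h| <= `|a + h| by exact: lerB_normD.
  lra.
have ah0 : a + h != 0 by rewrite -normr_gt0; apply: lt_le_trans h3; rewrite divr_gt0.
have -> : (a + h)^-1 - a^-1 - - a ^- 2 * h = h * h / (a ^+ 2 * (a + h)).
  by field; rewrite f0 ah0.
rewrite normrM normfV normrM [`|a ^+ 2 * _|]normrM normrX.
rewrite ler_pdivrMr; last by rewrite mulr_gt0 ?exprn_gt0 // normr_gt0.
rewrite mulrAC ler_wpM2r //.
apply: (@le_trans _ _ (e * (`|a| ^+ 2 * (`|a| / 2)))).
  by move: h2; rewrite exprS; lra.
by rewrite ler_pM2l // ler_wpM2l // exprn_ge0.
Qed.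

Lemma hasgrad_sqrt m (f : 'rV[R]_m -> R) x g : 0 < f x ->
  hasgrad f x g -> hasgrad (fun v => Num.sqrt (f v)) x ((2 * Num.sqrt (f x))^-1 *: g).
Proof.
move=> f0 hf; apply: (@hasgrad_real m (fun s => Num.sqrt s) ((2 * Num.sqrt (f x))^-1)) => //.
set a := f x; move=> e e0.
set b := Num.sqrt a; have b0 : 0 < b by rewrite sqrtr_gt0.
exists (Num.min a (e * (2 * b ^+ 3))).
  by rewrite lt_min f0 mulr_gt0 // mulr_gt0 // exprn_gt0.
move=> h; rewrite lt_min => /andP[h1 h2].
have ah : 0 < a + h by move: h1; rewrite ltr_norml => /andP[]; lra.
set c := Num.sqrt (a + h); have c0 : 0 < c by rewrite sqrtr_gt0.
have E : h = c ^+ 2 - b ^+ 2 by rewrite !sqr_sqrtr ?ltW //; ring.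
have -> : c - b - (2 * b)^-1 * h = - (h * h / (2 * b * (c + b) ^+ 2)).
  have cb0 : 0 < c + b by rewrite addr_gt0.
  by rewrite E; field; rewrite ?gt_eqF.
have D0 : 0 < 2 * b * (c + b) ^+ 2 by rewrite mulr_gt0 ?exprn_gt0 ?addr_gt0 // mulr_gt0.
rewrite normrN normrM normfV normrM (gtr0_norm D0).
rewrite ler_pdivrMr // mulrAC ler_wpM2r //.
apply: le_trans (ltW h2) _; rewrite ler_pM2l //.
rewrite exprS mulrA ler_pM2l ?mulr_gt0 //.
by rewrite ler_sqr ?nnegrE ?ltW ?addr_gt0 // ltrDr.
Qed.

Lemma hasgrad_unique m (f : 'rV[R]_m -> R) x g1 g2 :
  hasgrad f x g1 -> hasgrad f x g2 -> g1 = g2.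
Proof.
move=> h1 h2; apply/rowP => i; apply/eqP; rewrite -subr_eq0 -normr_le0.
apply/ler_addgt0Pr => e e0; rewrite add0r.
have e20 : 0 < e / 2 by rewrite divr_gt0.
have [d1 d10 k1] := h1 _ e20; have [d2 d20 k2] := h2 _ e20.
set t := Num.min d1 d2 / 2.
have t0 : 0 < t by rewrite divr_gt0 // lt_min d10.
set h := t *: (delta_mx 0 i : 'rV[R]_m).
have ht : `|h| <= t.
  by rewrite normrZ gtr0_norm // -[leRHS]mulr1 ler_wpM2l ?norm_delta // ltW.
have hm : `|h| < Num.min d1 d2.
  by apply: le_lt_trans ht _; rewrite /t gtr_pMr ?invf_lt1 ?ltr1n // lt_min d10.
move: (hm); rewrite lt_min => /andP[/k1 H1 /k2 H2].
have : `|dot (g1 - g2) h| <= e * t.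
  have -> : dot (g1 - g2) h = (f (x + h) - f x - dot g2 h) - (f (x + h) - f x - dot g1 h).
    by rewrite dotBl; ring.
  apply: le_trans (ler_normB _ _) _; apply: le_trans (lerD H2 H1) _.
  by rewrite -mulrDl -splitr ler_wpM2l // ltW.
rewrite dotZr dot_delta !mxE normrM gtr0_norm // mulrC ler_pM2r //.
Qed.

End Calculus.

(** * Smoothness by iterated gradients, and implicit functions *)

Section Smooth.
Variable R : realType.

(** Continuity is not recorded, since a gradient at the next order entails it. Closure properties
    and the regularity of implicit functions thus become plain inductions on [k]. *)
Fixpoint Dk m (k : nat) (U : set 'rV[R]_m) (f : 'rV[R]_m -> R) : Prop :=
  match k with
  | 0%N => True
  | k'.+1 => exists G : 'rV[R]_m -> 'rV[R]_m,
      (forall x, U x -> hasgrad f x (G x)) /\ forall i, Dk k' U (fun x => G x 0 i)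
  end.

Definition smooth m (U : set 'rV[R]_m) (f : 'rV[R]_m -> R) := forall k, Dk k U f.

Definition popen m (U : set 'rV[R]_m) :=
  forall x, U x -> exists2 d : R, 0 < d & forall h, `|h| < d -> U (x + h).

Lemma open_popen m (U : set 'rV[R]_m) : open U <-> popen U.
Proof.
rewrite openE; split=> hU x /hU.
  move=> /nbhs_ballP[d /= d0 hd]; exists d => // h hh; apply: hd.
  by rewrite -ball_normE /= opprD addNKr normrN.
move=> [d d0 hd]; apply/nbhs_ballP; exists d => //= y.
rewrite -ball_normE /= => hy; rewrite -[y](subrK x) addrC; apply: hd.
by rewrite distrC.
Qed.

Lemma Dk_S m k (U : set 'rV[R]_m) f : Dk k.+1 U f -> Dk k U f.
Proof.
elim: k f => [|k IH] f //= [G [h1 h2]]; exists G; split=> // i.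
exact: IH (h2 i).
Qed.

Lemma Dk_ext m k (U : set 'rV[R]_m) f g : popen U -> (forall x, U x -> f x = g x) ->
  Dk k U f -> Dk k U g.
Proof.
case: k => [//|k] oU fg [G [h1 h2]]; exists G; split=> // x Ux.
apply: hasgrad_ext (h1 x Ux) _; have [d d0 hd] := oU x Ux.
by exists d => // h /hd /fg.
Qed.

Lemma Dk_sub m k (U V : set 'rV[R]_m) f : V `<=` U -> Dk k U f -> Dk k V f.
Proof.
move=> VU; elim: k f => [//|k IH] f [G [h1 h2]]; exists G; split=> [x /VU /h1//|i].
exact: IH (h2 i).
Qed.

(** The gradients found locally agree on overlaps by [hasgrad_unique], so they form one function, to
    which the induction hypothesis applies. *)
Lemma Dk_local m k (U : set 'rV[R]_m) f : popen U ->
  (forall x, U x -> exists V, [/\ popen V, V x & Dk k V f]) -> Dk k U f.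
Proof.
move=> oU; elim: k f => [//|k IH] f hU.
have /choice[G hG] : forall x, exists g, U x -> hasgrad f x g.
  move=> x; have [/hU[V [oV Vx [GV [h1 h2]]]]|nU] := pselect (U x); last by exists 0.
  by exists (GV x) => _; exact: h1.
exists G; split=> // i; apply: IH => x Ux.
have [V [oV Vx [GV [h1 h2]]]] := hU x Ux.
have oW : popen (U `&` V).
  move=> y [/oU[d1 d10 hd1] /oV[d2 d20 hd2]]; exists (Num.min d1 d2).
    by rewrite lt_min d10.
  by move=> h; rewrite lt_min => /andP[/hd1 ? /hd2].
exists (U `&` V); split => //.
apply: (Dk_ext oW _ (Dk_sub _ (h2 i))) => [y [Uy Vy]|y []//].
by rewrite (hasgrad_unique (hG y Uy) (h1 y Vy)).
Qed.

Lemma Dk_fext m k (U : set 'rV[R]_m) f g : (forall x, g x = f x) -> Dk k U g -> Dk k U f.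
Proof. by move=> /funext ->. Qed.

Ltac funrw tac := eapply Dk_fext; [let x := fresh in intro x; symmetry; tac; reflexivity|cbv beta].

Lemma Dk_cst m k (U : set 'rV[R]_m) c : Dk k U (fun _ => c).
Proof.
elim: k c => [//|k IH] c; exists (fun _ => 0); split=> [x _|i]; first exact: hasgrad_cst.
by rewrite mxE; exact: IH.
Qed.

Lemma Dk_coord m k (U : set 'rV[R]_m) i : Dk k U (fun x => x 0 i).
Proof.
case: k => [//|k]; exists (fun _ => delta_mx 0 i); split=> [x _|j].
  exact: hasgrad_coord.
exact: Dk_cst.
Qed.

Lemma Dk_add m k (U : set 'rV[R]_m) f g :
  Dk k U f -> Dk k U g -> Dk k U (fun x => f x + g x).
Proof.
elim: k f g => [//|k IH] f g [F [h1 h2]] [G [h3 h4]].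
exists (fun x => F x + G x); split=> [x Ux|i]; first by apply: hasgrad_add; auto.
by funrw ltac:(rewrite mxE); exact: IH (h2 i) (h4 i).
Qed.

Lemma Dk_mul m k (U : set 'rV[R]_m) f g :
  Dk k U f -> Dk k U g -> Dk k U (fun x => f x * g x).
Proof.
elim: k f g => [//|k IH] f g Df Dg.
have Dkf := Dk_S Df; have Dkg := Dk_S Dg; move: Df Dg => [F [h1 h2]] [G [h3 h4]].
exists (fun x => g x *: F x + f x *: G x); split=> [x Ux|i].
  by apply: hasgrad_mul; auto.
by funrw ltac:(rewrite !mxE); apply: Dk_add; [exact: IH Dkg (h2 i)|exact: IH Dkf (h4 i)].
Qed.

Lemma Dk_opp m k (U : set 'rV[R]_m) f : Dk k U f -> Dk k U (fun x => - f x).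
Proof.
by move=> h; funrw ltac:(rewrite -mulN1r); apply: Dk_mul => //; exact: Dk_cst.
Qed.

Lemma Dk_sum m k (U : set 'rV[R]_m) (I : Type) (r : seq I) (P : pred I) F :
  (forall i, Dk k U (F i)) -> Dk k U (fun x => \sum_(i <- r | P i) F i x).
Proof.
move=> hF; elim: r => [|i r IH]; first by funrw ltac:(rewrite big_nil); exact: Dk_cst.
funrw ltac:(rewrite big_cons); case: (P i) => //; exact: Dk_add.
Qed.

Lemma Dk_prod m k (U : set 'rV[R]_m) (I : Type) (r : seq I) (P : pred I) F :
  (forall i, Dk k U (F i)) -> Dk k U (fun x => \prod_(i <- r | P i) F i x).
Proof.
move=> hF; elim: r => [|i r IH]; first by funrw ltac:(rewrite big_nil); exact: Dk_cst.
funrw ltac:(rewrite big_cons); case: (P i) => //; exact: Dk_mul.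
Qed.

Lemma Dk_exp m k (U : set 'rV[R]_m) f n : Dk k U f -> Dk k U (fun x => f x ^+ n).
Proof.
move=> h; elim: n => [|n IH]; first by funrw ltac:(rewrite expr0); exact: Dk_cst.
by funrw ltac:(rewrite exprS); exact: Dk_mul.
Qed.

Lemma Dk_inv m k (U : set 'rV[R]_m) f : (forall x, U x -> f x != 0) ->
  Dk k U f -> Dk k U (fun x => (f x)^-1).
Proof.
move=> f0; elim: k => [//|k IH] Df; have {IH}Di := IH (Dk_S Df).
move: Df => [F [h1 h2]]; exists (fun x => - (f x) ^- 2 *: F x); split=> [x Ux|i].
  by apply: hasgrad_inv; auto.
funrw ltac:(rewrite mxE -exprVn); apply: Dk_mul; last exact: h2.
by apply: Dk_opp; exact: Dk_exp.
Qed.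

Lemma Dk_sqrt m k (U : set 'rV[R]_m) f : (forall x, U x -> 0 < f x) ->
  Dk k U f -> Dk k U (fun x => Num.sqrt (f x)).
Proof.
move=> f0; elim: k => [//|k IH] Df; have {IH}Di := IH (Dk_S Df).
move: Df => [F [h1 h2]]; exists (fun x => (2 * Num.sqrt (f x))^-1 *: F x); split=> [x Ux|i].
  by apply: hasgrad_sqrt; auto.
funrw ltac:(rewrite mxE); apply: Dk_mul; last exact: h2.
apply: Dk_inv.
  by move=> x /f0 fx; rewrite mulf_neq0 // gt_eqF // sqrtr_gt0.
by apply: Dk_mul => //; exact: Dk_cst.
Qed.

Lemma Dk_comp m p k (U : set 'rV[R]_m) (V : set 'rV[R]_p) F (u : 'rV[R]_m -> 'rV[R]_p) :
  (forall x, U x -> V (u x)) -> (forall j, Dk k U (fun x => u x 0 j)) -> Dk k V F ->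
  Dk k U (fun x => F (u x)).
Proof.
move=> UV; elim: k F => [//|k IH] F hu [G [h1 h2]].
have /choice[gu hgu] : forall j, exists g, (forall x, U x -> hasgrad (fun x => u x 0 j) x (g x))
    /\ forall i, Dk k U (fun x => g x 0 i).
  by move=> j; exact: hu.
exists (fun x => \sum_j G (u x) 0 j *: gu j x); split=> [x Ux|i].
  by apply: hasgrad_comp => [j|]; [exact: (hgu j).1|exact/h1/UV].
funrw ltac:(rewrite summxE); apply: Dk_sum => j.
funrw ltac:(rewrite mxE); apply: Dk_mul; last exact: (hgu j).2.
apply: (IH (fun y => G y 0 j)); last exact: h2.
by move=> j'; apply: Dk_S; exact: hu.
Qed.

Lemma Dk_det m k (U : set 'rV[R]_m) n (A : 'rV[R]_m -> 'M[R]_n) :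
  (forall i j, Dk k U (fun x => A x i j)) -> Dk k U (fun x => \det (A x)).
Proof.
move=> hA; apply: Dk_sum => s; apply: Dk_mul; first exact: Dk_cst.
exact: Dk_prod.
Qed.

Lemma Dk_invmx m k (U : set 'rV[R]_m) n (A : 'rV[R]_m -> 'M[R]_n) :
  (forall x, U x -> A x \in unitmx) -> popen U ->
  (forall i j, Dk k U (fun x => A x i j)) -> forall i j, Dk k U (fun x => invmx (A x) i j).
Proof.
move=> uA oU hA i j.
apply: (@Dk_ext _ _ _ (fun x => (\det (A x))^-1 * cofactor (A x) j i)) => //.
  by move=> x /uA ux; rewrite /invmx ux !mxE.
apply: Dk_mul.
  apply: Dk_inv; last exact: Dk_det.
  by move=> x /uA; rewrite unitmxE unitfE.
apply: Dk_mul; first exact: Dk_cst.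
by apply: Dk_det => i' j'; funrw ltac:(rewrite !mxE); exact: hA.
Qed.

(* A continuous solution of a smooth equation with invertible partial
   differential is smooth: its gradient is given by the implicit function
   formula, and this formula lets the regularity bootstrap. *)
Lemma implicit_hasgrad m p (u : 'rV[R]_m -> 'rV[R]_p) (F : 'I_p -> 'rV[R]_(p + m) -> R) x
    (g : 'I_p -> 'rV[R]_(p + m)) :
  (forall e, 0 < e -> exists2 d, 0 < d & forall h, `|h| < d -> `|u (x + h) - u x| < e) ->
  (exists2 d, 0 < d & forall j h, `|h| < d -> F j (row_mx (u (x + h)) (x + h)) = 0) ->
  (forall j, hasgrad (F j) (row_mx (u x) x) (g j)) ->
  let A := \matrix_(j, k) g j 0 (lshift m k) in
  let B := \matrix_(j, i) g j 0 (rshift p i) in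
  A \in unitmx ->
  forall k, hasgrad (fun x => u x 0 k) x (row k (- (invmx A *m B))).
Proof.
move=> cu [d0 d00 hF0] hF A B uA.
pose C := \sum_(j < p) \sum_(k < p) `|invmx A j k| + 1.
have C0 : 0 < C by rewrite ltr_wpDl // !sumr_ge0 // => j _; rewrite sumr_ge0.
pose K := 2 * (\sum_(k < p) m%:R * `|row k (- (invmx A *m B))| + 1).
have K0 : 0 < K by rewrite mulr_gt0 // ltr_wpDl // sumr_ge0 // => k _; rewrite mulr_ge0.
have K1 : 1 <= K.
  rewrite /K; set s := \sum_(k < p) _.
  have : 0 <= s by apply: sumr_ge0 => k _; rewrite mulr_ge0.
  by lra.
have main e : 0 < e -> exists2 d, 0 < d & forall h, `|h| < d -> forall k,
   `|u (x + h) 0 k - u x 0 k - dot (row k (- (invmx A *m B))) h| <=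
     e * Num.max `|u (x + h) - u x| `|h|.
  move=> e0; have e1 : 0 < e / C by rewrite divr_gt0.
  have /choice[dj hdj] : forall j, exists d, 0 < d /\ forall h, `|h| < d ->
      `|F j (row_mx (u x) x + h) - F j (row_mx (u x) x) - dot (g j) h| <= e / C * `|h|.
    by move=> j; have [d dd hd] := hF j _ e1; exists d.
  set d1 := \big[Num.min/1]_j dj j.
  have d10 : 0 < d1 by apply/bigmin_gtP; split=> // j _; exact: (hdj j).1.
  have [d2 d20 hd2] := cu _ d10.
  exists (Num.min (Num.min d0 d1) d2) => [|h]; first by rewrite !lt_min d00 d10.
  rewrite !lt_min => /andP[/andP[h0 h1] /hd2 h2] k.
  set D := u (x + h) - u x in h2 *; set M := Num.max _ _.
  have normrow : `|row_mx D h| <= M.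
    apply: norm_le => [|i]; first by rewrite le_max normr_ge0.
    rewrite -(splitK i); case: (fintype.split i) => j /=.
      by rewrite row_mxEl le_max norm_coord.
    by rewrite row_mxEr le_max norm_coord orbT.
  have E j : `|dot (g j) (row_mx D h)| <= e / C * M.
    have hj : `|row_mx D h| < dj j.
      apply: le_lt_trans normrow _; rewrite gt_max.
      by move/bigmin_gtP: h1 h2 => [_ /(_ j isT) ->] /bigmin_gtP[_ /(_ j isT) ->].
    have := (hdj j).2 _ hj; rewrite add_row_mx.
    have -> : u x + D = u (x + h) by rewrite /D addrC subrK.
    rewrite hF0 //; have := hF0 j 0; rewrite normr0 addr0 => -> //.
    rewrite subrr sub0r normrN => H; apply: le_trans H _.
    by rewrite ler_wpM2l // ltW.
  have -> : u (x + h) 0 k - u x 0 k - dot (row k (- (invmx A *m B))) h =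
      \sum_j invmx A k j * dot (g j) (row_mx D h).
    have dE j : dot (g j) (row_mx D h) = (A *m D^T) j 0 + (B *m h^T) j 0.
      rewrite /dot big_split_ord /= !mxE; congr (_ + _); apply: eq_bigr => i _.
        by rewrite row_mxEl !mxE.
      by rewrite row_mxEr !mxE.
    under eq_bigr do rewrite dE mulrDr; rewrite big_split /=.
    have -> : \sum_j invmx A k j * (A *m D^T) j 0 = D 0 k.
      have := congr1 (fun M : 'cV[R]_p => M k 0) (mulKmx uA D^T).
      by rewrite /= mxE => ->; rewrite mxE.
    rewrite !mxE; congr (_ + _).
    have -> : \sum_j invmx A k j * (B *m h^T) j 0 = (invmx A *m B *m h^T) k 0.
      by rewrite -mulmxA [RHS]mxE.
    rewrite mxE -sumrN; apply: eq_bigr => i _.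
    by rewrite !mxE mulNr opprK.
  apply: le_trans (ler_norm_sum _ _ _) _.
  apply: (@le_trans _ _ (\sum_j `|invmx A k j| * (e / C * M))).
    by apply: ler_sum => j _; rewrite normrM ler_wpM2l.
  have M0 : 0 <= M by rewrite le_max normr_ge0.
  rewrite -mulr_suml; apply: (@le_trans _ _ (C * (e / C * M))); last first.
    by rewrite mulrA [C * _]mulrC divfK ?lt0r_neq0.
  apply: ler_wpM2r; first by rewrite mulr_ge0 // divr_ge0 // ltW.
  rewrite /C [X in _ <= X + _](bigD1 k) //=; set s := \sum_(i < p | i != k) _.
  have s0 : 0 <= s by apply: sumr_ge0 => j _; apply: sumr_ge0.
  by set t := \sum_j _; lra.
(* With error one half, the increment of [u] on the right of [main] is absorbed on the left. So [u]
   is Lipschitz at [x], and the maximum in [main] becomes a multiple of [|h|]. *)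
have [d1 d10 hd1] := main 2^-1 ltac:(by rewrite invr_gt0).
have hK h : `|h| < d1 -> `|u (x + h) - u x| <= K * `|h|.
  move=> /hd1 H; have [Dh|Dh] := leP `|u (x + h) - u x| `|h|.
    by apply: le_trans Dh _; rewrite ler_peMl.
  have H2 : `|u (x + h) - u x| <= K / 2 * `|h| + 2^-1 * `|u (x + h) - u x|.
    apply: norm_le => [|k]; first by apply: addr_ge0; rewrite mulr_ge0 ?divr_ge0 ?invr_ge0 // ltW.
    move: (H k); rewrite max_l ?(ltW Dh) // !mxE => Hk.
    have Hd := dot_le (row k (- (invmx A *m B))) h.
    rewrite -[X in `|X|](subrK (dot (row k (- (invmx A *m B))) h)).
    apply: le_trans (ler_normD _ _) _; rewrite [X in X <= _]addrC; apply: lerD; last exact: Hk.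
    apply: le_trans Hd _; rewrite ler_wpM2r // /K mulrAC divff // mul1r (bigD1 k) //=.
    set s := \sum_(i < p | i != k) _; have : 0 <= s.
      by apply: sumr_ge0 => j _; rewrite mulr_ge0.
    by lra.
  move: H2; set a := `|u (x + h) - u x|; set b := K * `|h|.
  have -> : K / 2 * `|h| = b / 2 by rewrite /b; ring.
  by lra.
move=> k e e0; have [d2 d20 hd2] := main (e / K) ltac:(by rewrite divr_gt0).
exists (Num.min d1 d2) => [|h]; first by rewrite lt_min d10.
rewrite lt_min => /andP[/hK h1 /hd2 h2]; apply: le_trans (h2 k) _.
rewrite -[leRHS]mulr1 -[X in _ <= _ * X](divff (lt0r_neq0 K0)).
have -> : e * `|h| * (K / K) = e / K * (K * `|h|) by ring.
apply: ler_wpM2l; first by rewrite divr_ge0 // ltW.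
rewrite ge_max h1 /=.
by rewrite ler_peMl.
Qed.

Lemma implicit_smooth m p (U : set 'rV[R]_m) (V : set 'rV[R]_(p + m))
    (u : 'rV[R]_m -> 'rV[R]_p) (F : 'I_p -> 'rV[R]_(p + m) -> R)
    (g : 'I_p -> 'rV[R]_(p + m) -> 'rV[R]_(p + m)) :
  popen U ->
  (forall x, U x -> forall e, 0 < e ->
     exists2 d, 0 < d & forall h, `|h| < d -> `|u (x + h) - u x| < e) ->
  (forall x, U x -> V (row_mx (u x) x)) ->
  (forall x j, U x -> F j (row_mx (u x) x) = 0) ->
  (forall j y, V y -> hasgrad (F j) y (g j y)) ->
  (forall j i, smooth V (fun y => g j y 0 i)) ->
  (forall x, U x -> \matrix_(j, k) g j (row_mx (u x) x) 0 (lshift m k) \in unitmx) ->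
  forall j, smooth U (fun x => u x 0 j).
Proof.
move=> oU cu UV hF hg sg uA j k; elim: k j => [//|k IH] j.
pose A x := \matrix_(j, k) g j (row_mx (u x) x) 0 (lshift m k).
pose B x := \matrix_(j, i) g j (row_mx (u x) x) 0 (rshift p i).
exists (fun x => row j (- (invmx (A x) *m B x))); split=> [x Ux|i].
  apply: (implicit_hasgrad (F := F)) => [|||]; [exact: cu| | |exact: uA].
    by have [d d0 hd] := oU x Ux; exists d => // j' h /hd /hF.
  by move=> j'; apply: hg; exact: UV.
have Dg i' j' : Dk k U (fun x => g j' (row_mx (u x) x) 0 i').
  apply: (@Dk_comp _ _ _ U V (fun y => g j' y 0 i') (fun x => row_mx (u x) x)) => //.
    move=> l; rewrite -(splitK l); case: (fintype.split l) => l' /=.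
      by funrw ltac:(rewrite row_mxEl); exact: IH.
    by funrw ltac:(rewrite row_mxEr); exact: Dk_coord.
  exact: sg.
funrw ltac:(rewrite !mxE); apply: Dk_opp; apply: Dk_sum => l; apply: Dk_mul.
  by apply: Dk_invmx => // i1 j1; funrw ltac:(rewrite mxE); exact: Dg.
by funrw ltac:(rewrite mxE); exact: Dg.
Qed.

(** [smooth] provides a gradient for each order separately. They coincide by uniqueness, so a single
    one has derivatives of all orders. *)
Lemma smoothP m (U : set 'rV[R]_m) f : popen U -> smooth U f ->
  exists2 G : 'rV[R]_m -> 'rV[R]_m, (forall x, U x -> hasgrad f x (G x)) &
    forall i, smooth U (fun x => G x 0 i).
Proof.
move=> oU sf; have [G [h1 _]] := sf 1%N; exists G => // i k.
have [G' [h1' h2']] := sf k.+1; apply: (Dk_ext oU _ (h2' i)) => x Ux.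
by rewrite (hasgrad_unique (h1 x Ux) (h1' x Ux)).
Qed.

Lemma popenI m (U V : set 'rV[R]_m) : popen U -> popen V -> popen (U `&` V).
Proof.
move=> oU oV y [/oU[d1 d10 hd1] /oV[d2 d20 hd2]]; exists (Num.min d1 d2).
  by rewrite lt_min d10.
by move=> h; rewrite lt_min => /andP[/hd1 ? /hd2].
Qed.

End Smooth.

(** * Iterated gradients compared with iterated partial derivatives *)

Section Bridge.
Variable R : realType.

Lemma continuousP_shift m (V : normedModType R) (f : 'rV[R]_m -> V) x : {for x, continuous f} <->
  forall e : R, 0 < e -> exists2 d : R, 0 < d & forall h, `|h| < d -> `|f (x + h) - f x| < e.
Proof.
split=> [cf e e0|H].
  have /(cvgrPdist_lt (FF := nbhs_filter x))/(_ e e0)/nbhs_ballP[d /= d0 hd] := cf.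
  exists d => // h hh; rewrite distrC; apply: (hd (x + h)).
  by rewrite -ball_normE /= opprD addNKr normrN.
apply/(cvgrPdist_lt (FF := nbhs_filter x)) => e e0; have [d d0 hd] := H e e0.
apply/nbhs_ballP; exists d => //= y; rewrite -ball_normE /= => hy.
have E : y = x + (y - x) by rewrite addrC subrK.
by rewrite distrC E; apply: hd; rewrite distrC.
Qed.

Lemma hasgrad_is_derive m (f : 'rV[R]_m -> R) x g i :
  hasgrad f x g -> is_derive x (ebasis R i) f (g 0 i).
Proof.
move=> hf.
have H : h^-1 *: (f (h *: ebasis R i + x) - f x) @[h --> 0^'] --> g 0 i.
  apply/cvgrPdist_le => e e0; have [d d0 hd] := hf _ e0.
  exists d => //= h; rewrite /ball_ /= sub0r normrN => hd' h0.
  have h0' : 0 < `|h| by rewrite normr_gt0.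
  have hb : `|h *: ebasis R i| <= `|h|.
    by rewrite normrZ -[leRHS]mulr1 ler_wpM2l // norm_delta.
  have := hd _ (le_lt_trans hb hd'); rewrite dotZr dot_delta [x + _]addrC => H.
  rewrite distrC -(ler_pM2l h0') -normrM.
  have -> : h * (h^-1 *: (f (h *: ebasis R i + x) - f x) - g 0 i) =
     f (h *: ebasis R i + x) - f x - h * g 0 i.
    by rewrite mulrBr [h^-1 *: _]/GRing.scale /= mulVKf.
  by apply: le_trans H _; rewrite mulrC ler_wpM2r // ltW.
split; first by apply/cvg_ex; exists (g 0 i).
exact/cvg_lim.
Qed.

Lemma smooth_Ck m n (U : set 'rV[R]_m) (G : 'rV[R]_m -> 'rV[R]_n) : popen U ->
  (forall j, smooth U (fun x => G x 0 j)) -> smooth_on U G.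
Proof.
move=> oU sG k; elim: k G sG => [|k IH] G sG;
  have cG : {in U, continuous G}.
- move=> x; rewrite inE => Ux; apply/continuousP_shift => e e0.
  have /choice[d hd] : forall j, exists d, 0 < d /\ forall h, `|h| < d -> `|G (x + h) 0 j - G x 0 j| < e.
    move=> j; have [g hg _] := smoothP oU (sG j).
    by have [d d0 hd] := hasgrad_cont (hg x Ux) e0; exists d.
  exists (\big[Num.min/1]_j d j) => [|h /bigmin_gtP[_ hh]].
    by apply/bigmin_gtP; split=> // j _; exact: (hd j).1.
  by apply: norm_lt => // j; rewrite !mxE; apply: (hd j).2; exact: hh.
- exact: cG.
- exact: (IH G sG).1 || (case: k IH => [|k] IH; [exact: IH|exact: (IH G sG).1]).
split=> // i.
have /choice[g hg] : forall j, exists g, (forall x, U x -> hasgrad (fun x => G x 0 j) x (g x))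
    /\ forall i, smooth U (fun x => g x 0 i).
  by move=> j; have [g h1 h2] := smoothP oU (sG j); exists g.
have dG x : U x -> derivable G x (ebasis R i).
  move=> Ux; apply/derivable_mxP => i0 j; rewrite (ord1 i0).
  by have [] := hasgrad_is_derive i ((hg j).1 x Ux).
split=> //; apply: IH => j l.
apply: (Dk_ext oU _ ((hg j).2 i l)) => x Ux.
by rewrite derive_mx ?mxE; [have [_ ->] := hasgrad_is_derive i ((hg j).1 x Ux)|exact: dG].
Qed.

Lemma mvt_line m (f : 'rV[R]_m -> R) z i t :
  (forall s, `|s| <= `|t| -> derivable f (z + s *: ebasis R i) (ebasis R i)) ->
  exists2 c, `|c| <= `|t| &
    f (z + t *: ebasis R i) - f z = 'D_(ebasis R i) f (z + c *: ebasis R i) * t.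
Proof.
set e := ebasis R i => df; pose phi s := f (z + s *: e).
have dphi (s : R) : `|s| <= `|t| -> is_derive s (1 : R) phi ('D_e f (z + s *: e)).
  move=> /df hs.
  have E : (fun h : R => h^-1 *: (phi (h *: (1 : R) + s) - phi s)) =
           (fun h : R => h^-1 *: (f (h *: e + (z + s *: e)) - f (z + s *: e))).
    apply/funext => h; rewrite /phi [h *: 1]mulr1 scalerDl; congr (_ *: (f _ - _)).
    by rewrite addrCA.
  by split; [move: hs; rewrite /derivable /derive -E|rewrite /derive E].
have cphi (a b : R) : (forall s, s \in `[a, b] -> `|s| <= `|t|) -> {within `[a, b], continuous phi}.
  move=> hab; apply: derivable_within_continuous => s /hab /dphi h.
  exact: ex_derive.
have [t0|t0] := leP 0 t.
  have hs s : s \in `[0, t] -> `|s| <= `|t|.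
    by rewrite in_itv /= => /andP[s0 st]; rewrite !ger0_norm // (le_trans s0).
  have [|c /hs hc] := MVT_segment (f := phi) (df := fun s => 'D_e f (z + s *: e)) t0 _ (cphi _ _ hs).
    by move=> s /subset_itv_oo_cc /hs; exact: dphi.
  by rewrite subr0 /phi scale0r addr0 => H; exists c.
have hs s : s \in `[t, 0] -> `|s| <= `|t|.
  by rewrite in_itv /= => /andP[s0 st]; rewrite !ler0_norm ?lerN2 // ltW.
have [|c /hs hc] := MVT_segment (f := phi) (df := fun s => 'D_e f (z + s *: e)) (ltW t0) _ (cphi _ _ hs).
  by move=> s /subset_itv_oo_cc /hs; exact: dphi.
rewrite sub0r /phi scale0r addr0 => H; exists c => //.
by rewrite -opprB H mulrN opprK.
Qed.

Lemma C1_hasgrad m (U : set 'rV[R]_m) (f : 'rV[R]_m -> R) x : popen U -> U x ->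
  (forall i y, U y -> derivable f y (ebasis R i)) ->
  (forall i, {for x, continuous ('D_(ebasis R i) f)}) ->
  hasgrad f x (\row_i 'D_(ebasis R i) f x).
Proof.
move=> oU Ux df cf e e0; have [d0 d00 hd0] := oU x Ux.
have e1 : 0 < e / (m%:R + 1) by rewrite divr_gt0 // ltr_wpDl.
have /choice[d hd] : forall i, exists d, 0 < d /\ forall h, `|h| < d ->
    `|'D_(ebasis R i) f (x + h) - 'D_(ebasis R i) f x| < e / (m%:R + 1).
  by move=> i; have /continuousP_shift /(_ _ e1)[d dd hd] := cf i; exists d.
exists (Num.min d0 (\big[Num.min/1]_i d i)).
  by rewrite lt_min d00; apply/bigmin_gtP; split=> // i _; exact: (hd i).1.
move=> h; rewrite lt_min => /andP[h0 /bigmin_gtP[_ h1]].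
(* [z i] keeps the first [i] coordinates of [h]. Each step from [z i] to [z i.+1] changes one
   coordinate, where the mean value theorem applies. *)
pose z (i : nat) : 'rV[R]_m := \row_l (if (l < i)%N then h 0 l else 0).
have zS (i : 'I_m) : z i.+1 = z i + h 0 i *: ebasis R i.
  apply/rowP => l; rewrite !mxE eqxx /= ltnS leq_eqVlt.
  case: (eqVneq l i) => [->|li]; first by rewrite eqxx ltnn add0r mulr1.
  by rewrite -(inj_eq val_inj) in li; rewrite (negbTE li) mulr0 addr0.
have zn (i : 'I_m) s : `|s| <= `|h 0 i| -> `|z i + s *: ebasis R i| <= `|h|.
  move=> hs; apply: norm_le => // l; rewrite !mxE eqxx /=.
  case: (eqVneq l i) => [->|li]; last first.
    by rewrite mulr0 addr0; case: ifP; rewrite ?normr0 // norm_coord.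
  by rewrite ltnn add0r mulr1 (le_trans hs) // norm_coord.
have step (i : 'I_m) : `|f (x + z i.+1) - f (x + z i) - 'D_(ebasis R i) f x * h 0 i|
    <= e / (m%:R + 1) * `|h|.
  have [s hs|c hc E] := @mvt_line _ f (x + z i) i (h 0 i).
    by rewrite -addrA; apply: df; apply: hd0; apply: le_lt_trans (zn i s hs) h0.
  rewrite zS addrA E -mulrBl normrM ler_pM // ?norm_coord // ltW // -addrA.
  by apply: (hd i).2; apply: le_lt_trans (zn i c hc) (h1 i isT).
have tel : f (x + h) - f x = \sum_(i < m) (f (x + z i.+1) - f (x + z i)).
  rewrite -(big_mkord xpredT (fun i => f (x + z i.+1) - f (x + z i))).
  rewrite (telescope_sumr (fun i => f (x + z i))) //; congr (f _ - f _).
    by congr (_ + _); apply/rowP => l; rewrite mxE ltn_ord.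
  by rewrite -[LHS]addr0; congr (_ + _); apply/rowP => l; rewrite !mxE.
rewrite tel /dot.
under [\sum_i (_ : 'rV_m) _ _ * _]eq_bigr do rewrite mxE.
rewrite -sumrB; apply: le_trans (ler_norm_sum _ _ _) _.
apply: (@le_trans _ _ (\sum_(i < m) e / (m%:R + 1) * `|h|)); first exact: ler_sum.
rewrite sumr_const card_ord -[X in X <= _]mulr_natl mulrA ler_wpM2r // mulrCA ler_piMr ?(ltW e0) //.
by rewrite ler_pdivrMr ?ltr_wpDl // mul1r lerDl.
Qed.

Lemma Ck_Dk m n k (U : set 'rV[R]_m) (G : 'rV[R]_m -> 'rV[R]_n) j : popen U ->
  Ck_on k U G -> Dk k U (fun x => G x 0 j).
Proof.
move=> oU; elim: k G => [//|k IH] G [cG hG].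
have dG i x : U x -> derivable G x (ebasis R i) by exact: (hG i).1.
have DE i x : U x -> 'D_(ebasis R i) G x 0 j = 'D_(ebasis R i) (fun x => G x 0 j) x.
  by move=> Ux; rewrite derive_mx ?mxE //; exact: dG.
exists (fun x => \row_i 'D_(ebasis R i) (fun x => G x 0 j) x); split=> [x Ux|i].
  apply: (C1_hasgrad oU Ux) => [i y Uy|i].
    by have /derivable_mxP := dG i y Uy; exact.
  apply/continuousP_shift => e e0.
  have cD : {for x, continuous ('D_(ebasis R i) G)}.
    have [_] := hG i; case: (k) => [|k'] /=; [|move=> []]; move=> H *; apply: H; exact/mem_set.
  have /continuousP_shift/(_ e e0)[d d0 hd] := cD; have [d1 d10 hd1] := oU x Ux.
  exists (Num.min d d1) => [|h]; first by rewrite lt_min d0.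
  rewrite lt_min => /andP[/hd h1 /hd1 h2]; rewrite -!DE //.
  by apply: le_lt_trans h1; apply: le_trans (norm_coord _ j); rewrite !mxE.
apply: (Dk_ext oU _ (IH _ (hG i).2)) => x Ux.
by rewrite mxE DE.
Qed.

End Bridge.

(** * Lojasiewicz inequality and finiteness theorem *)

Section Lojasiewicz.
Variable R : realType.

Lemma poly_ub (q : {poly R}) : exists (N : nat) (t0 : R),
  1 <= t0 /\ forall t, t0 <= t -> `|q.[t]| <= t ^+ N.
Proof.
elim/poly_ind: q => [|q c [N [t0 [h1 h2]]]].
  by exists 0%N, 1; split=> // t _; rewrite horner0 normr0 expr0.
exists N.+2, (t0 + 1 + `|c|); split=> [|t ht].
  by have := normr_ge0 c; lra.
have c0 := normr_ge0 c.
have t1 : 1 <= t by lra.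
have tN1 : 1 <= t ^+ N.+1 by apply: exprn_ege1.
rewrite hornerMXaddC; apply: le_trans (ler_normD _ _) _.
have H : `|q.[t] * t| <= t ^+ N.+1.
  rewrite normrM (ger0_norm (le_trans ler01 t1)) exprSr ler_wpM2r ?(le_trans ler01 t1) //.
  by apply: h2; lra.
apply: (@le_trans _ _ (t ^+ N.+1 * (1 + `|c|))); last first.
  by rewrite [leRHS]exprSr; apply: ler_wpM2l; [apply: exprn_ge0; lra|lra].
rewrite mulrDr mulr1; apply: lerD => //.
by rewrite ler_peMl.
Qed.

Lemma poly_lb (q : {poly R}) : q != 0 -> exists (s a t0 : R),
  [/\ 0 < a, 1 <= t0, `|s| = 1 & forall t, t0 <= t -> a <= s * q.[t]].
Proof.
move=> q0; pose s := Num.sg (lead_coef q).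
have l0 : lead_coef q != 0 by rewrite lead_coef_eq0.
have s1 : `|s| = 1 by rewrite normr_sg l0.
have lp : 0 < lead_coef (s *: q).
  by rewrite lead_coefZ -normrEsg normr_gt0.
have [t0 ht0] := polyrcf.poly_pinfty_gt_lc lp.
exists s, (lead_coef (s *: q)), (Num.max 1 t0); split=> // [|t].
  by rewrite le_max lexx.
by rewrite ge_max => /andP[_ /ht0]; rewrite hornerZ.
Qed.

(* In [P : {poly {poly R}}] the outer variable is [y] and the inner one is [t]. *)
Definition eval2 (P : {poly {poly R}}) t y : R := P.[y%:P].[t].

Lemma eval2_ub P : exists (N : nat) (t0 : R),
  1 <= t0 /\ forall t y, t0 <= t -> 0 < y <= 1 -> `|eval2 P t y| <= t ^+ N.
Proof.
elim/poly_ind: P => [|P c [N [t0 [h1 h2]]]].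
  by exists 0%N, 1; split=> // t y _ _; rewrite /eval2 !horner0 normr0 expr0.
have [M [t1 [h3 h4]]] := poly_ub c.
exists (maxn N M).+1, (t0 + t1); split=> [|t y ht /andP[y0 y1]]; first by lra.
have t2 : 2 <= t by lra.
rewrite /eval2 hornerMXaddC !(hornerD, hornerM, hornerC) exprS.
apply: le_trans (ler_normD _ _) _.
have b1 : `|P.[y%:P].[t] * y| <= t ^+ maxn N M.
  rewrite normrM (gtr0_norm y0); apply: le_trans (ler_piMr _ y1) _ => //.
  apply: le_trans (h2 t y _ _) _; rewrite ?y0 ?y1 //; first by lra.
  by apply: ler_weXn2l; [lra|exact: leq_maxl].
have b2 : `|c.[t]| <= t ^+ maxn N M.
  apply: le_trans (h4 t _) _; first by lra.
  by apply: ler_weXn2l; [lra|exact: leq_maxr].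
apply: le_trans (lerD b1 b2) _.
have p0 : 0 <= t ^+ maxn N M by rewrite exprn_ge0; lra.
by have := ler_wpM2r p0 t2; lra.
Qed.

(** For small [y] the sign is that of the lowest coefficient in [y] which is a nonzero polynomial
    [c]. For large [t] the absolute value of [c] is at least some [a > 0], while the remaining terms
    are at most [t ^+ M * y]; this is less than [a] when [y < t ^- M.+1] and [t >= a^-1]. *)
Lemma eval2_sg P : exists (N : nat) (t0 : R) (b : bool),
  1 <= t0 /\ forall t y, t0 <= t -> 0 < y < t ^- N -> (0 < eval2 P t y) = b.
Proof.
elim/poly_ind: P => [|P c [N [t0 [b [h1 h2]]]]].
  by exists 0%N, 1, false; split=> // t y _ _; rewrite /eval2 !horner0 ltxx.
have [->|c0] := eqVneq c 0.
  exists N, t0, b; split=> // t y ht hy.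
  rewrite -(h2 t y ht hy) /eval2 addr0 hornerMX hornerM hornerC pmulr_lgt0 //.
  by case/andP: hy.
have [s [a [t1 [a0 h3 s1 h4]]]] := poly_lb c0.
have [M [t2 [h5 h6]]] := eval2_ub P.
exists M.+1, (Num.max (Num.max t1 t2) a^-1), (0 < s); split=> [|t y].
  by rewrite !le_max h3.
rewrite !ge_max => /andP[/andP[ht1 ht2] hta] /andP[y0 hy].
have t1' : 1 <= t by exact: le_trans h3 ht1.
have t0' : 0 < t by exact: lt_le_trans ltr01 t1'.
have y1 : y <= 1.
  apply: le_trans (ltW hy) _; rewrite invf_le1 ?exprn_gt0 //.
  exact: exprn_ege1.
rewrite /eval2 hornerMXaddC !(hornerD, hornerM, hornerC).
have Hc := h4 t ht1.
have HP : `|P.[y%:P].[t] * y| < a.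
  rewrite normrM (gtr0_norm y0).
  apply: (@le_lt_trans _ _ (t ^+ M * y)).
    by rewrite ler_wpM2r ?(ltW y0) //; apply: h6 => //; rewrite y0.
  rewrite mulrC -ltr_pdivlMr ?exprn_gt0 //; apply: lt_le_trans hy _.
  rewrite exprS invfM; apply: ler_wpM2r; first by rewrite invr_ge0 exprn_ge0 ?(ltW t0').
  by rewrite -[leRHS]invrK lef_pV2 ?posrE ?invr_gt0.
move: HP; rewrite ltr_norml => /andP[HP1 HP2].
have : s = 1 \/ s = -1.
  move: s1; case: (ltrgt0P s) => [s0 E|s0 E|_ /esym/eqP]; last by rewrite oner_eq0.
    by left.
  by right; rewrite -E opprK.
case=> ?; subst s; rewrite ?ltr01 ?ltr0N1 in Hc *.
  by apply/idP; lra.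
by apply/negbTE; rewrite -leNgt; lra.
Qed.

Fixpoint poly2_of (p : pexpr R (1 + 1)) : {poly {poly R}} :=
  match p with
  | PConst c => c%:P%:P
  | PVar i => if fintype.split i is inl _ then 'X%:P else 'X
  | PAdd p q => poly2_of p + poly2_of q
  | PMul p q => poly2_of p * poly2_of q
  end.

Lemma poly2_ofE p (t y : R) :
  peval p (row_mx (\row_(j < 1) t) (\row_(j < 1) y)) = eval2 (poly2_of p) t y.
Proof.
rewrite /eval2; elim: p => [c|i|p IHp q IHq|p IHp q IHq] /=.
- by rewrite !hornerC.
- rewrite -{1}(splitK i); case: (fintype.split i) => j /=.
    by rewrite row_mxEl mxE hornerC hornerX.
  by rewrite row_mxEr mxE hornerX hornerC.
- by rewrite !hornerD IHp IHq.
- by rewrite !hornerM IHp IHq.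
Qed.

(** In a thin enough cusp at infinity every polynomial has a constant sign, and a Boolean
    combination involves finitely many polynomials, so one exponent serves for all of them. *)
Lemma dP_germ (A : R -> R -> Prop) : dP (fun p : R * R => A p.1 p.2) ->
  exists (N : nat) (t0 : R), 1 <= t0 /\
    forall t y y', t0 <= t -> 0 < y < t ^- N -> 0 < y' < t ^- N -> (A t y <-> A t y').
Proof.
pose r t y : 'rV[R]_(1 + 1) := row_mx (\row_(j < 1) t) (\row_(j < 1) y).
move=> hA; have main : forall B : set 'rV[R]_(1 + 1), semialgebraic B ->
  exists (N : nat) (t0 : R), 1 <= t0 /\
    forall t y y', t0 <= t -> 0 < y < t ^- N -> 0 < y' < t ^- N ->
      (B (r t y) <-> B (r t y')).
  move=> B; elim=> [p|C D _ [N [t0 [h1 h2]]] _ [M [t1 [h3 h4]]]|C _ [N [t0 [h1 h2]]]].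
  - have [N [t0 [b [h1 h2]]]] := eval2_sg (poly2_of p).
    exists N, t0; split=> // t y y' ht hy hy' /=.
    by rewrite !poly2_ofE !h2.
  - exists (maxn N M), (Num.max t0 t1); split=> [|t y y']; first by rewrite le_max h1.
    rewrite ge_max => /andP[ht0 ht1] /andP[y0 hy] /andP[y0' hy'].
    have t1' : 1 <= t by exact: le_trans h1 ht0.
    have tp : 0 < t by exact: lt_le_trans ltr01 t1'.
    have le1 : t ^- maxn N M <= t ^- N.
      by rewrite lef_pV2 ?posrE ?exprn_gt0 // ler_weXn2l // leq_maxl.
    have le2 : t ^- maxn N M <= t ^- M.
      by rewrite lef_pV2 ?posrE ?exprn_gt0 // ler_weXn2l // leq_maxr.
    have E1 := h2 t y y' ht0; have E2 := h4 t y y' ht1.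
    rewrite y0 y0' /= !(lt_le_trans hy) ?(lt_le_trans hy') // in E1 E2.
    by rewrite /setU /=; have := E1 isT isT; have := E2 isT isT; tauto.
  - exists N, t0; split=> // t y y' ht hy hy'.
    by have := h2 t y y' ht hy hy'; rewrite /setC /=; tauto.
have [N [t0 [h1 h2]]] := main _ hA; exists N, t0; split=> // t y y' ht hy hy'.
have := h2 t y y' ht hy hy'; rewrite /= !row_mxKl !row_mxKr !mxE.
exact.
Qed.

(** The lower bound 2 allows constants to be absorbed by additional powers of [T]. *)
Definition exhaustion m (S : 'rV[R]_m -> Prop) (T : 'rV[R]_m -> R) :=
  [/\ dP S, dfun T, forall x, S x -> 2 <= T x &
      forall t, compact [set x | S x /\ T x <= t]].

Lemma exhaustion_gt0 m (S : 'rV[R]_m -> Prop) T x : exhaustion S T -> S x -> 0 < T x.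
Proof. by move=> [_ _ h _] /h; lra. Qed.

Lemma exhaustion_V m (S : 'rV[R]_m -> Prop) T x k : exhaustion S T -> S x -> 0 < T x ^- k.
Proof. by move=> h Sx; rewrite invr_gt0 exprn_gt0 // (exhaustion_gt0 h). Qed.

(* Lojasiewicz's inequality in abstract form. *)
Lemma lojasiewicz m (S : 'rV[R]_m -> Prop) (T : 'rV[R]_m -> R) (P : 'rV[R]_m -> R -> Prop) :
  exhaustion S T -> dP (fun p : 'rV[R]_m * R => P p.1 p.2) ->
  (forall x y y', S x -> 0 < y' <= y -> P x y -> P x y') ->
  (forall x, S x -> exists2 r, 0 < r & forall h, `|h| < r -> S (x + h) -> P (x + h) r) ->
  exists N, forall M x, (N <= M)%N -> S x -> P x (T x ^- M).
Proof.
move=> eST dPP down loc; have [dS dT T2 cT] := eST.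
(* Treating all [x] of a sublevel set at once leaves a definable relation between two real
   numbers. *)
pose A t y := 0 < y /\ forall x, S x -> T x <= t -> P x y.
have dA : dP (fun p : R * R => A p.1 p.2) by rewrite /A; dtac.
have [N [t0 [t01 hN]]] := dP_germ dA.
(* Compactness of the sublevel set makes the local radii uniform, still without control of their
   dependence on [t]. *)
have exA t : exists2 y, 0 < y & forall y', 0 < y' <= y -> A t y'.
  have K := (compact_near_coveringP _).1 (cT t).
  have := K R (0^'+) (fun y x => S x -> T x <= t -> P x y) _ _.
  case=> [x [Sx Tx]|y /= y0 hy].
    have [r r0 hr] := loc x Sx.
    exists (ball x r, [set y | 0 < y /\ y < r]).
      split; first by apply: nbhsx_ballx.
      near=> y; split=> //.
    move=> [x' y] /= [bx [y0 yr]] Sx' Tx'.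
    apply: (down _ r) => //; first by rewrite y0 ltW.
    rewrite -[x'](subrK x) addrC; apply: hr; last by rewrite addrC subrK.
    by move: bx; rewrite -ball_normE /= distrC.
  exists (y / 2); first by rewrite divr_gt0.
  move=> y' /andP[y'0 y'y]; split=> // x Sx Tx.
  have yy : y' < y by apply: le_lt_trans y'y _; rewrite ltr_pdivrMr // ltr_pMr // ltr1n.
  apply: (hy y' _ _ x) => //=.
  by rewrite sub0r normrN gtr0_norm.
(* In the cusp the truth of [A t y] does not depend on [y], so it passes from some tiny [y'] to
   [t ^- N.+1]. *)
have AN t : t0 <= t -> 2 <= t -> A t (t ^- N.+1).
  move=> ht t2; have [y y0 hy] := exA t.
  have t1 : 1 < t by lra.
  have tp : 0 < t by lra.
  have z0 : 0 < t ^- N.+1 by rewrite invr_gt0 exprn_gt0.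
  have zN : t ^- N.+1 < t ^- N.
    by rewrite ltf_pV2 ?posrE ?exprn_gt0 // ltr_eXn2l.
  set y' := Num.min y (t ^- N.+1).
  have y'0 : 0 < y' by rewrite lt_min y0.
  apply/(hN t _ y' ht); rewrite ?z0 ?y'0 ?zN //=.
    by rewrite gt_min zN orbT.
  by apply: hy; rewrite y'0 ge_min lexx.
(* The level [T x ^+ k.+1] is used in place of [T x]: as [T x >= 2], it is at least [t0] at every
   point of [S]. This is the origin of the exponent [k.+1 * N.+1]. *)
have [k hk] : exists k : nat, t0 <= 2 ^+ k.
  exists (Num.bound t0); apply: le_trans (ltW (archi_boundP _)) _; first by lra.
  by rewrite -natrX ler_nat ltnW // ltn_expl.
exists (k.+1 * N.+1)%N => M x hM Sx.
have Tx := T2 x Sx; have T1 : 1 <= T x by lra.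
have T0 : 0 < T x by lra.
have h2 : 2 <= T x ^+ k.+1.
  by rewrite exprS; apply: le_trans Tx _; rewrite ler_peMr ?(ltW T0) // exprn_ege1.
have h0 : t0 <= T x ^+ k.+1.
  apply: le_trans hk _; apply: (@le_trans _ _ (T x ^+ k)).
    by apply: lerXn2r; rewrite ?nnegrE ?(ltW T0).
  by apply: ler_weXn2l.
have [_ /(_ x Sx)] := AN _ h0 h2.
have hT : T x <= T x ^+ k.+1 by rewrite exprS ler_peMr ?(ltW T0) // exprn_ege1.
move=> /(_ hT); rewrite -exprM; apply: down => //.
rewrite invr_gt0 exprn_gt0 // lef_pV2 ?posrE ?exprn_gt0 //.
by apply: ler_weXn2l.
Unshelve. all: by end_near. Qed.

Lemma lojasiewicz_ub m (S : 'rV[R]_m -> Prop) (T f : 'rV[R]_m -> R) :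
  exhaustion S T -> dfun f ->
  (forall x, S x -> exists2 r, 0 < r & forall h, `|h| < r -> S (x + h) -> `|f (x + h)| <= r^-1) ->
  exists N, forall M x, (N <= M)%N -> S x -> `|f x| <= T x ^+ M.
Proof.
move=> eST df loc.
have [|x y y' Sx /andP[y0 yy]|x /loc//|N hN] := @lojasiewicz _ S T (fun x y => `|f x| <= y^-1) eST.
- dtac.
- by move=> h; apply: le_trans h _; rewrite lef_pV2 ?posrE // (lt_le_trans y0).
- by exists N => M x NM Sx; have := hN M x NM Sx; rewrite invrK.
Qed.

Lemma lojasiewicz_lb m (S : 'rV[R]_m -> Prop) (T f : 'rV[R]_m -> R) :
  exhaustion S T -> dfun f ->
  (forall x, S x -> exists2 r, 0 < r & forall h, `|h| < r -> S (x + h) -> r <= f (x + h)) ->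
  exists N, forall M x, (N <= M)%N -> S x -> T x ^- M <= f x.
Proof.
move=> eST df loc.
have [|x y y' Sx /andP[y0 yy]|x /loc//|N hN] := @lojasiewicz _ S T (fun x y => y <= f x) eST.
- dtac.
- exact: le_trans.
- by exists N => M x; exact: hN.
Qed.

End Lojasiewicz.

(** * Relatively open semialgebraic sets as finite unions of basic open sets *)

Section Finiteness.
Variable R : realType.

Lemma sa_signs n (A : set 'rV[R]_n) : semialgebraic A ->
  exists (k : nat) (p : 'I_k -> pexpr R n), forall x y,
    (forall i, Num.sg (peval (p i) x) = Num.sg (peval (p i) y)) -> (A x <-> A y).
Proof.
elim=> [p|B C _ [k [p hp]] _ [l [q hq]]|B _ [k [p hp]]].
- exists 1%N, (fun _ => p) => x y /(_ 0) h /=.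
  by rewrite -[0 < peval p x]sgr_gt0 -[0 < peval p y]sgr_gt0 h.
- exists (k + l)%N, (fun i => match fintype.split i with inl j => p j | inr j => q j end).
  move=> x y h.
  have E1 : B x <-> B y.
    by apply: hp => i; have := h (lshift l i); rewrite -[lshift l i]/(unsplit (inl i)) unsplitK.
  have E2 : C x <-> C y.
    by apply: hq => i; have := h (rshift k i); rewrite -[rshift k i]/(unsplit (inr i)) unsplitK.
  by rewrite /setU /=; tauto.
- by exists k, p => x y /hp; rewrite /setC /=; tauto.
Qed.

Definition pcont m (f : 'rV[R]_m -> R) (x : 'rV[R]_m) :=
  forall e, 0 < e -> exists2 d, 0 < d & forall h, `|h| < d -> `|f (x + h) - f x| < e.

Lemma smooth_pcont m (U : set 'rV[R]_m) f x : smooth U f -> U x -> pcont f x.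
Proof. by move=> /(_ 1%N)[G [hG _]] /hG /hasgrad_cont. Qed.

Lemma smooth_peval m (U : set 'rV[R]_m) (p : pexpr R m) : smooth U (peval p).
Proof.
elim: p => [c|i|p hp q hq|p hp q hq] k /=.
- exact: Dk_cst.
- exact: Dk_coord.
- exact: Dk_add.
- exact: Dk_mul.
Qed.

Lemma dfun_peval m (p : pexpr R m) : dfun (peval p).
Proof.
elim: p => [c|i|p hp q hq|p hp q hq] /=; first exact: dfun_cst.
- by apply: dfun_coord; exact: dfun_id.
- exact: dfun_add.
- exact: dfun_mul.
Qed.

Lemma popen_gt0 m (U : set 'rV[R]_m) f : popen U -> (forall x, U x -> pcont f x) ->
  popen (fun x => U x /\ 0 < f x).
Proof.
move=> oU cf x [Ux fx]; have [d d0 hd] := oU x Ux.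
have [d1 d10 hd1] := cf x Ux _ fx.
exists (Num.min d d1) => [|h]; first by rewrite lt_min d0.
rewrite lt_min => /andP[/hd Uh /hd1]; rewrite ltr_norml => /andP[H _]; split=> //.
by rewrite ltrBrDr addNr in H.
Qed.

Lemma popenT m : popen (setT : set 'rV[R]_m).
Proof. by move=> x _; exists 1. Qed.

Lemma closed_ge0 m (f : 'rV[R]_m -> R) : (forall x, pcont f x) -> closed [set x | 0 <= f x].
Proof.
move=> cf; rewrite -openC; apply/open_popen => x /= /negP; rewrite -ltNge => fx.
have fx0 : 0 < - f x by rewrite oppr_gt0.
have [d d0 hd] := cf x _ fx0; exists d => // h /hd; rewrite ltr_norml => /andP[_ H].
by apply/negP; rewrite -ltNge; move: H; lra.
Qed.

Inductive polyfun m (T : 'rV[R]_m -> R) : ('rV[R]_m -> R) -> Prop :=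
  | polyfun_peval p : polyfun T (peval p)
  | polyfun_T : polyfun T T
  | polyfun_add f g : polyfun T f -> polyfun T g -> polyfun T (fun x => f x + g x)
  | polyfun_mul f g : polyfun T f -> polyfun T g -> polyfun T (fun x => f x * g x).

Lemma polyfun_dfun m (T f : 'rV[R]_m -> R) : dfun T -> polyfun T f -> dfun f.
Proof.
by move=> dT; elim=> [p||g h _ dg _ dh|g h _ dg _ dh] //;
  [exact: dfun_peval|exact: dfun_add|exact: dfun_mul].
Qed.

Lemma polyfun_smooth m U (T f : 'rV[R]_m -> R) : smooth U T -> polyfun T f -> smooth U f.
Proof.
by move=> sT; elim=> [p||g h _ dg _ dh|g h _ dg _ dh] //; [exact: smooth_peval| |] => k;
  [exact: Dk_add|exact: Dk_mul].
Qed.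

Section PF.
Variables (m : nat) (T : 'rV[R]_m -> R).
Lemma polyfun_cst c : polyfun T (fun _ => c).
Proof. exact: (polyfun_peval T (PConst m c)). Qed.
Lemma polyfun_opp f : polyfun T f -> polyfun T (fun x => - f x).
Proof.
move=> h; rewrite (_ : (fun x => _) = (fun x => (-1) * f x)); last first.
  by apply/funext => x; rewrite mulN1r.
by apply: polyfun_mul => //; exact: polyfun_cst.
Qed.
Lemma polyfun_exp f k : polyfun T f -> polyfun T (fun x => f x ^+ k).
Proof.
move=> h; elim: k => [|k IH].
  by rewrite (_ : (fun x => _) = (fun x => 1)); [exact: polyfun_cst|apply/funext => x; rewrite expr0].
rewrite (_ : (fun x => _) = (fun x => f x * f x ^+ k)); first exact: polyfun_mul.
by apply/funext => x; rewrite exprS.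
Qed.
Lemma polyfun_prod (I : Type) (r : seq I) (F : I -> 'rV[R]_m -> R) :
  (forall i, polyfun T (F i)) -> polyfun T (fun x => \prod_(i <- r) F i x).
Proof.
move=> hF; elim: r => [|i r IH].
  by rewrite (_ : (fun x => _) = (fun x => 1)); [exact: polyfun_cst|apply/funext => x; rewrite big_nil].
rewrite (_ : (fun x => _) = (fun x => F i x * \prod_(j <- r) F j x)); first exact: polyfun_mul.
by apply/funext => x; rewrite big_cons.
Qed.
Lemma polyfun_sum (I : Type) (r : seq I) (F : I -> 'rV[R]_m -> R) :
  (forall i, polyfun T (F i)) -> polyfun T (fun x => \sum_(i <- r) F i x).
Proof.
move=> hF; elim: r => [|i r IH].
  by rewrite (_ : (fun x => _) = (fun x => 0)); [exact: polyfun_cst|apply/funext => x; rewrite big_nil].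
rewrite (_ : (fun x => _) = (fun x => F i x + \sum_(j <- r) F j x)); first exact: polyfun_add.
by apply/funext => x; rewrite big_cons.
Qed.
End PF.

Definition relopen m (S W : 'rV[R]_m -> Prop) := forall x, S x -> W x ->
  exists2 r : R, 0 < r & forall h, `|h| < r -> S (x + h) -> W (x + h).

(** The points of [S] in [W] form a union of cells given by signs of finitely many polynomials.
    Write [G] for the product of the strict inequalities of a cell and [H] for the sum of squares of
    its equations. Where the strict inequalities hold, a point of [S] off [W] has [H > 0], and
    Lojasiewicz's inequality gives [H >= (T + G^-1) ^- N]. Imposing the opposite inequality thickens
    the cell to a basic open set which, within [S], still lies in [W]. *)
Lemma finiteness m (S W : 'rV[R]_m -> Prop) (T : 'rV[R]_m -> R) :
  exhaustion S T -> dP W -> relopen S W ->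
  exists (I J : finType) (q : I -> J -> 'rV[R]_m -> R),
    (forall i j, polyfun T (q i j)) /\
    forall x, S x -> (W x <-> exists i, forall j, 0 < q i j x).
Proof.
move=> eST dW oW; have [dS dT T2 cT] := eST.
have [k [p hp]] := sa_signs (dP_and dS dW).
(* [Some true], [Some false] and [None] encode positive, negative and zero values of a
   polynomial. *)
pose g (s : {ffun 'I_k -> option bool}) i : 'rV[R]_m -> R := match s i with
  | Some true => peval (p i) | Some false => fun x => - peval (p i) x | None => fun _ => 1 end.
pose hz (s : {ffun 'I_k -> option bool}) i : 'rV[R]_m -> R := match s i with
  | None => fun x => peval (p i) x ^+ 2 | _ => fun _ => 0 end.
pose G s x := \prod_i g s i x.
pose H s x := \sum_i hz s i x.
have pg s i T' : polyfun T' (g s i).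
  rewrite /g; case: (s i) => [[]|]; [exact: polyfun_peval| |exact: polyfun_cst].
  by apply: polyfun_opp; exact: polyfun_peval.
have ph s i T' : polyfun T' (hz s i).
  rewrite /hz; case: (s i) => [[]|]; [exact: polyfun_cst|exact: polyfun_cst|].
  by apply: (polyfun_exp 2); exact: polyfun_peval.
have pG s T' : polyfun T' (G s) by exact: polyfun_prod.
have pH s T' : polyfun T' (H s) by exact: polyfun_sum.
have polc (f : 'rV[R]_m -> R) x : polyfun (fun _ => 0) f -> pcont f x.
  move=> hf; apply: (@smooth_pcont _ setT) => //.
  by apply: polyfun_smooth hf => l; exact: Dk_cst.
have hz0 s i x : 0 <= hz s i x.
  by rewrite /hz; case: (s i) => [[]|] //; rewrite sqr_ge0.
have H0 s x : 0 <= H s x by apply: sumr_ge0 => i _.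
have G0 s x : (forall i, 0 < g s i x) -> 0 < G s x by move=> h; apply: prodr_gt0.
have cell s x y : (forall i, 0 < g s i x) -> H s x = 0 -> (forall i, 0 < g s i y) ->
    H s y = 0 -> (S x /\ W x <-> S y /\ W y).
  move=> gx Hx gy Hy; apply: hp => i.
  have hx0 : hz s i x = 0.
    by move: Hx => /eqP; rewrite /H psumr_eq0 // => /allP /(_ i (mem_index_enum _)) /eqP.
  have hy0 : hz s i y = 0.
    by move: Hy => /eqP; rewrite /H psumr_eq0 // => /allP /(_ i (mem_index_enum _)) /eqP.
  move: (gx i) (gy i) hx0 hy0; rewrite /g /hz; case: (s i) => [[]|].
  - by move=> h1 h2 _ _; rewrite !gtr0_sg.
  - by rewrite !oppr_gt0 => h1 h2 _ _; rewrite !ltr0_sg.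
  - by move=> _ _ /eqP; rewrite sqrf_eq0 => /eqP -> /eqP; rewrite sqrf_eq0 => /eqP ->.
pose good s := exists x, [/\ S x, W x, forall i, 0 < g s i x & H s x = 0].
have key s : exists N, good s -> forall x, S x -> (forall i, 0 < g s i x) -> ~ W x ->
    (T x + (G s x)^-1) ^- N <= H s x.
  have [[x0 [Sx0 Wx0 gx0 Hx0]]|ng] := pselect (good s); last by exists 0%N.
  pose S' x := S x /\ forall i, 0 < g s i x.
  (* The maximum of [T] and [(G s x)^-1]; the latter keeps sublevel sets away from the zeros of the
     strict inequalities, so that they are compact. *)
  pose T' x := if `[< T x < (G s x)^-1 >] then (G s x)^-1 else T x.
  have dG : dfun (G s) by apply: polyfun_dfun (pG s (fun _ => 0)); exact: dfun_cst.
  have dg i : dfun (g s i) by apply: polyfun_dfun (pg s i (fun _ => 0)); exact: dfun_cst.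
  have dH : dfun (H s) by apply: polyfun_dfun (pH s (fun _ => 0)); exact: dfun_cst.
  have dT' : dfun T'.
    by apply: dfun_if; [apply: dP_lt => //; exact: dfun_inv|exact: dfun_inv|].
  have TT' x : T x <= T' x.
    by rewrite /T'; case: asboolP => // /ltW.
  have GT' x : (G s x)^-1 <= T' x.
    by rewrite /T'; case: asboolP => // /negP; rewrite -leNgt.
  have T'le x t : T x <= t -> (G s x)^-1 <= t -> T' x <= t.
    by rewrite /T'; case: asboolP.
  have eST' : exhaustion S' T'.
    split=> //.
    - by apply: dP_and => //; apply: dP_big_all => i; apply: dP_lt => //; exact: dfun_cst.
    - by move=> x [/T2 h _]; exact: le_trans h (TT' x).
    move=> t.
    have -> : [set x | S' x /\ T' x <= t] = [set x | S x /\ T x <= t] `&`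
        ([set x | 0 <= t * G s x - 1] `&` \bigcap_(i in [set: 'I_k]) [set x | 0 <= g s i x]).
      apply/seteqP; split=> x /=.
        move=> [[Sx gx] Tx]; have Gx := G0 s x gx.
        split; first by split=> //; exact: le_trans (TT' x) Tx.
        split; last by move=> i _ /=; exact: ltW.
        have := le_trans (GT' x) Tx.
        by rewrite -(ler_pM2r Gx) mulVf ?gt_eqF // subr_ge0.
      move=> [[Sx Tx] [tG gx]].
      have t0 : 0 < t by apply: lt_le_trans Tx; have := T2 x Sx; lra.
      have Gx : 0 < G s x.
        rewrite subr_ge0 in tG; rewrite -(pmulr_rgt0 _ t0).
        exact: lt_le_trans ltr01 tG.
      split; first split=> // i.
        rewrite lt_neqAle gx // andbT eq_sym; apply/eqP => g0.
        by move: Gx; rewrite /G (bigD1 i) //= g0 mul0r ltxx.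
      apply: T'le => //.
      by rewrite -(ler_pM2r Gx) mulVf ?gt_eqF // -subr_ge0.
    apply: compact_closedI; first exact: cT.
    apply: closedI.
      apply: closed_ge0 => x; apply: polc.
      apply: polyfun_add; last exact: polyfun_cst.
      by apply: polyfun_mul => //; exact: polyfun_cst.
    by apply: closed_bigI => i _; apply: closed_ge0 => x; exact: polc.
  have [|x y y' _ /andP[_ yy] h /h|x [Sx gx]|N hN] := @lojasiewicz _ _ S' T' (fun x y => ~ W x -> y <= H s x) eST'.
  - by dtac.
  - exact: le_trans.
  - have [Wx|nWx] := pselect (W x).
      have [r r0 hr] := oW x Sx Wx; exists r => // h hh [Sh _] nW.
      by case: nW; exact: hr.
    have Hx : 0 < H s x.
      rewrite lt_neqAle H0 andbT eq_sym; apply/eqP => Hx; apply: nWx.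
      exact: ((cell s x x0 gx Hx gx0 Hx0).2 (conj Sx0 Wx0)).2.
    have Hx2 : 0 < H s x / 2 by rewrite divr_gt0.
    have [d d0 hd] := polc (H s) x (pH s _) _ Hx2.
    exists (Num.min d (H s x / 2)) => [|h]; first by rewrite lt_min d0.
    rewrite lt_min => /andP[/hd hh _] _ _; rewrite ge_min; apply/orP; right.
    by move: hh; rewrite ltr_norml => /andP[]; lra.
  exists N => _ x Sx gx nW.
  apply: le_trans (hN N x (leqnn _) (conj Sx gx) nW).
  have Gx := G0 s x gx; have Tx := T2 x Sx.
  have T0 : 0 < T x by lra.
  have T'0 : 0 < T' x by exact: lt_le_trans (TT' x).
  rewrite lef_pV2 ?posrE ?exprn_gt0 ?addr_gt0 ?invr_gt0 //.
  apply: lerXn2r; rewrite ?nnegrE ?(ltW T'0) ?addr_ge0 ?invr_ge0 ?(ltW T0) ?(ltW Gx) //.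
  by apply: T'le; [rewrite lerDl invr_ge0 ltW|rewrite lerDr ltW].
have /choice[N hN] := key.
(* The extra index [None] carries [H < (T + G^-1) ^- N] cleared of denominators. For a cell without
   points of [S] in [W] it carries the constant -1, so that the cell contributes nothing. *)
pose q s (j : option 'I_k) : 'rV[R]_m -> R := match j with
  | Some i => g s i
  | None => if `[< good s >] then fun x => G s x ^+ N s - H s x * (T x * G s x + 1) ^+ N s
            else fun _ => -1 end.
exists {ffun 'I_k -> option bool}, (option 'I_k), q; split.
  move=> s [i|] /=; first exact: pg.
  case: asboolP => _; last exact: polyfun_cst.
  apply: polyfun_add; first exact: polyfun_exp.
  apply: polyfun_opp; apply: polyfun_mul => //; apply: polyfun_exp.
  apply: polyfun_add; last exact: polyfun_cst.
  by apply: polyfun_mul => //; exact: polyfun_T.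
move=> x Sx; split=> [Wx|[s hs]].
  pose s : {ffun 'I_k -> option bool} := [ffun i =>
    if 0 < peval (p i) x then Some true else if peval (p i) x < 0 then Some false else None].
  have gx i : 0 < g s i x.
    rewrite /g ffunE; case: ifP => // _; case: ifP => [|_]; last exact: ltr01.
    by rewrite oppr_gt0.
  have Hx : H s x = 0.
    apply: big1 => i _; rewrite /hz ffunE; case: ltrgt0P => // ->.
    by rewrite expr0n.
  have gs : good s by exists x.
  exists s => -[i|] /=; first exact: gx.
  case: asboolP => // _; rewrite Hx mul0r subr0 exprn_gt0 //; exact: G0.
have gx i : 0 < g s i x := hs (Some i).
have Gx := G0 s x gx; have Tx := T2 x Sx; have T0 : 0 < T x by lra.
have := hs None; rewrite /q; case: asboolP => [gs h|_]; last by rewrite ltr0N1.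
apply: contrapT => nW; have := hN s gs x Sx gx nW; apply/negP; rewrite -ltNge.
have D0 : 0 < T x * G s x + 1 by rewrite addr_gt0 // mulr_gt0.
have -> : T x + (G s x)^-1 = (T x * G s x + 1) / G s x.
  by rewrite mulrDl mulfK ?gt_eqF // mul1r.
rewrite -exprVn invf_div expr_div_n ltr_pdivlMr ?exprn_gt0 //.
by rewrite -subr_gt0.
Qed.

End Finiteness.

(** * Nash functions and exhaustions *)

Ltac sstep :=
  first
  [ assumption
  | match goal with
    | |- Dk _ _ (fun x => ?c) => exact: Dk_cst
    | |- Dk _ _ (fun x => _ + _) => apply: Dk_add
    | |- Dk _ _ (fun x => - _) => apply: Dk_opp
    | |- Dk _ _ (fun x => _ * _) => apply: Dk_mul
    | |- Dk _ _ (fun x => _ ^+ _) => apply: Dk_exp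
    | |- Dk _ _ (fun x => _ ^-1) => apply: Dk_inv
    | |- Dk _ _ (fun x => Num.sqrt _) => apply: Dk_sqrt
    | |- Dk _ _ (fun x => bigop _ _ _) => first [apply: Dk_sum => ? | apply: Dk_prod => ?]
    | |- Dk _ _ (fun x => fun_of_matrix x _ _) => apply: Dk_coord
    | H : smooth ?U ?f |- Dk _ ?U ?f => exact: H
    | H : smooth ?U ?f |- Dk _ ?U (fun x => ?f x) => exact: H
    | H : forall i, smooth ?U _ |- Dk _ ?U _ => exact: H
    | H : forall i j, smooth ?U _ |- Dk _ ?U _ => exact: H
    end ].
Ltac stac := cbv beta; repeat (sstep; cbv beta).

(** * Nash functions defined by simple roots *)

Section Roots.
Variable R : realType.

Definition pt m (z : R) (x : 'rV[R]_m) : 'rV[R]_(1 + m) := row_mx (\row_j z) x.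

Lemma pt_add m z t (x h : 'rV[R]_m) : pt z x + pt t h = pt (z + t) (x + h).
Proof. by rewrite /pt add_row_mx; congr row_mx; apply/rowP => j; rewrite !mxE. Qed.

Lemma norm_pt m z (x : 'rV[R]_m) c : 0 <= c -> `|z| <= c -> `|x| <= c -> `|pt z x| <= c.
Proof.
move=> c0 hz hx; apply: norm_le => // i; rewrite /pt -(splitK i).
case: (fintype.split i) => j /=; first by rewrite row_mxEl mxE.
by rewrite row_mxEr (le_trans (norm_coord _ _)).
Qed.

(** By the lower bound with [c], [Psi] is negative below the root and positive above it. These signs
    persist when [x] moves a little, so the root is continuous. The same bound makes the derivative
    in [z] positive at the root, and the implicit function theorem applies. *)
Lemma root_smooth m (U : set 'rV[R]_m) (O : set 'rV[R]_(1 + m)) (Psi : 'rV[R]_(1 + m) -> R)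
    (zeta : 'rV[R]_m -> R) :
  popen U -> popen O -> smooth O Psi ->
  (forall x, U x -> O (pt (zeta x) x) /\ Psi (pt (zeta x) x) = 0) ->
  (forall x, U x -> exists2 c, 0 < c & forall z, O (pt z x) ->
     c * (z - zeta x) ^+ 2 <= Psi (pt z x) * (z - zeta x)) ->
  smooth U zeta.
Proof.
move=> oU oO sP hz hc.
have [G hG sG] := smoothP oO sP.
have cP y : O y -> pcont Psi y by move=> Oy; exact: hasgrad_cont (hG y Oy).
have cz x : U x -> forall e, 0 < e -> exists2 d, 0 < d & forall h, `|h| < d ->
    `|zeta (x + h) - zeta x| < e.
  move=> Ux e e0; have [Oz Pz] := hz x Ux; have [c c0 hcx] := hc x Ux.
  have [d d0 hd] := oO _ Oz; have [dU dU0 hdU] := oU x Ux.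
  set t := Num.min d e / 2.
  have de0 : 0 < Num.min d e by rewrite lt_min d0.
  have t0 : 0 < t by rewrite divr_gt0.
  have tde : t < Num.min d e by rewrite /t ltr_pdivrMr // ltr_pMr // ltr1n.
  have /andP[td te] : (t < d) && (t < e) by rewrite -lt_min.
  have Op s : `|s| <= t -> O (pt (zeta x + s) x).
    move=> st; rewrite -[x in pt _ x]addr0 -pt_add; apply: hd.
    apply: le_lt_trans td; apply: norm_pt; rewrite ?normr0 //; exact: ltW.
  have O1 : O (pt (zeta x + t) x) by apply: Op; rewrite gtr0_norm.
  have O2 : O (pt (zeta x - t) x) by apply: Op; rewrite normrN gtr0_norm.
  have P1 : 0 < Psi (pt (zeta x + t) x).
    have := hcx _ O1; rewrite addrC addKr => H.
    rewrite -(pmulr_lgt0 _ t0); apply: lt_le_trans H.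
    by rewrite mulr_gt0 // exprn_gt0.
  have P2 : Psi (pt (zeta x - t) x) < 0.
    have := hcx _ O2; rewrite addrC addKr sqrrN mulrN => H.
    rewrite -oppr_gt0 -(pmulr_lgt0 _ t0) mulNr; apply: lt_le_trans H.
    by rewrite mulr_gt0 // exprn_gt0.
  have P2' : 0 < - Psi (pt (zeta x - t) x) by rewrite oppr_gt0.
  have [d1 d10 h1] := oO _ O1; have [d2 d20 h2] := oO _ O2.
  have [d3 d30 h3] := cP _ O1 _ P1; have [d4 d40 h4] := cP _ O2 _ P2'.
  exists (Num.min dU (Num.min (Num.min d1 d2) (Num.min d3 d4))) => [|h].
    by rewrite !lt_min dU0 d10 d20 d30.
  rewrite !lt_min => /andP[hh /andP[/andP[hh1 hh2] /andP[hh3 hh4]]].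
  have Uh := hdU h hh; have [Ozh Pzh] := hz _ Uh; have [c' c'0 hcxh] := hc _ Uh.
  have np : `|pt 0 h| <= `|h| by apply: norm_pt; rewrite ?normr0.
  have E s : pt (zeta x + s) x + pt 0 h = pt (zeta x + s) (x + h) by rewrite pt_add addr0.
  have := h1 _ (le_lt_trans np hh1); have := h2 _ (le_lt_trans np hh2).
  have := h3 _ (le_lt_trans np hh3); have := h4 _ (le_lt_trans np hh4).
  rewrite !E !ltr_norml => /andP[_ K4] /andP[K3 _] K2 K1.
  have Q1 : 0 < Psi (pt (zeta x + t) (x + h)) by move: K3; lra.
  have Q2 : Psi (pt (zeta x - t) (x + h)) < 0 by move: K4; lra.
  have L1 := hcxh _ K1; have L2 := hcxh _ K2.
  apply/andP; split.
    apply: contraTT (L2) => H; rewrite -ltNge.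
    have w0 : 0 <= zeta x - t - zeta (x + h) by move: H te; rewrite -leNgt; lra.
    have w1 : 0 < zeta x - t - zeta (x + h) by move: H te; rewrite -leNgt; lra.
    apply: (@lt_le_trans _ _ 0); first by rewrite nmulr_rlt0.
    by rewrite mulr_ge0 ?sqr_ge0 // ltW.
  apply: contraTT (L1) => H; rewrite -ltNge.
  have w1 : zeta x + t - zeta (x + h) < 0 by move: H te; rewrite -leNgt; lra.
  apply: (@lt_le_trans _ _ 0); first by rewrite pmulr_rlt0.
  by rewrite mulr_ge0 ?sqr_ge0 // ltW.
have := @implicit_smooth R m 1 U O (fun x => \row_j zeta x) (fun _ => Psi) (fun _ => G) oU.
move=> H; have {}H := H _ _ _ _ _ _ 0.
move=> k; apply: Dk_fext (H _ _ _ _ _ _ k).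
- by move=> x; rewrite mxE.
- move=> x Ux e e0; have [d d0 hd] := cz x Ux e e0; exists d => // h /hd hh.
  by apply: norm_lt => // j; rewrite !mxE.
- by move=> x /hz[].
- by move=> x _ /hz[].
- by move=> _; exact: hG.
- by move=> _; exact: sG.
move=> x Ux; rewrite unitmxE unitfE det_mx11 mxE.
have [Oz Pz] := hz x Ux; have [c c0 hcx] := hc x Ux.
have c20 : 0 < c / 2 by rewrite divr_gt0.
have [d d0 hd] := hG _ Oz _ c20; have [d1 d10 hd1] := oO _ Oz.
set t := Num.min d d1 / 2.
have dd0 : 0 < Num.min d d1 by rewrite lt_min d0.
have t0 : 0 < t by rewrite divr_gt0.
have tde : t < Num.min d d1 by rewrite /t ltr_pdivrMr // ltr_pMr // ltr1n.
have /andP[td te] : (t < d) && (t < d1) by rewrite -lt_min.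
have nt : `|pt t (0 : 'rV[R]_m)| <= t by apply: norm_pt; rewrite ?normr0 ?gtr0_norm // ltW.
have := hd _ (le_lt_trans nt td); have := hd1 _ (le_lt_trans nt te).
rewrite pt_add addr0 Pz subr0 => Ozt.
have := hcx _ Ozt; rewrite addrC addKr => L.
have -> : dot (G (pt (zeta x) x)) (pt t 0) = G (pt (zeta x) x) 0 (lshift m 0) * t.
  rewrite /dot big_split_ord /= big_ord1 big1 ?addr0.
    by rewrite /pt row_mxEl mxE.
  by move=> i _; rewrite /pt row_mxEr mxE mulr0.
rewrite ler_norml => /andP[_ K].
have {}L : c * t <= Psi (pt (zeta x + t) x).
  by rewrite -(ler_pM2r t0); apply: le_trans L; rewrite -mulrA -expr2.
have K2 : Psi (pt (zeta x + t) x) - G (pt (zeta x) x) 0 (lshift m 0) * t <= c / 2 * t.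
  by apply: le_trans K _; rewrite ler_pM2l.
have : 0 < G (pt (zeta x) x) 0 (lshift m 0) * t.
  have : 0 < c * t by rewrite mulr_gt0.
  by lra.
by rewrite pmulr_lgt0 // => /lt0r_neq0.
Qed.

Definition nash m (U : set 'rV[R]_m) (f : 'rV[R]_m -> R) := smooth U f /\ dfun f.

Lemma dfun_pt T (eT : Enc R T) m (z : T -> R) (x : T -> 'rV[R]_m) :
  dfun z -> dfun x -> dfun (fun p => pt (z p) (x p)).
Proof.
move=> dz dx; apply: dfun_row_mx => //; apply: dfun_row => i.
by apply: dfun_ext dz => p; rewrite mxE.
Qed.

Lemma nash_root m (U : set 'rV[R]_m) (O : set 'rV[R]_(1 + m)) (Psi : 'rV[R]_(1 + m) -> R) :
  popen U -> dP U -> popen O -> dP O -> nash O Psi ->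
  (forall x, U x -> exists z, [/\ O (pt z x), Psi (pt z x) = 0 &
     exists2 c, 0 < c & forall z', O (pt z' x) -> c * (z' - z) ^+ 2 <= Psi (pt z' x) * (z' - z)]) ->
  exists2 zeta, nash U zeta & forall x, U x -> O (pt (zeta x) x) /\ Psi (pt (zeta x) x) = 0.
Proof.
move=> oU dU oO dO [sP dPs] hex.
(* The default value 0 off [U] keeps [zeta] definable on the whole space. *)
have /choice[zeta hz] : forall x, exists z, (U x -> [/\ O (pt z x), Psi (pt z x) = 0 &
     exists2 c, 0 < c & forall z', O (pt z' x) -> c * (z' - z) ^+ 2 <= Psi (pt z' x) * (z' - z)])
     /\ (~ U x -> z = 0).
  move=> x; have [Ux|nU] := pselect (U x); last by exists 0.
  by have [z hz] := hex x Ux; exists z.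
have hz1 x : U x -> O (pt (zeta x) x) /\ Psi (pt (zeta x) x) = 0.
  by move=> Ux; have [/(_ Ux)[]] := hz x.
exists zeta => //; split.
  apply: (root_smooth oU oO sP hz1) => x Ux.
  by have [/(_ Ux)[_ _]] := hz x.
apply: (@dfun_unique _ _ _ _ _ (fun x z => (U x /\ O (pt z x) /\ Psi (pt z x) = 0)
   \/ (~ U x /\ z = 0))).
  have dpt : dfun (fun p : 'rV[R]_m * R => pt p.2 p.1) by apply: dfun_pt; dtac.
  have dU1 : dP (fun p : 'rV[R]_m * R => U p.1) by apply: (dP_fun dU); dtac.
  have dO1 := dP_fun dO dpt; have dP1 := dfun_comp dPs dpt.
  by dtac.
move=> x z; split=> [<-|[[Ux [Oz Pz]]|[nU ->]]].
- have [Ux|nU] := pselect (U x); [left|right]; last by split=> //; exact: (hz x).2.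
  by split=> //; exact: hz1.
- have [/(_ Ux)[_ _ [c c0 hc]] _] := hz x.
  have := hc z Oz; rewrite Pz mul0r => H.
  have : (z - zeta x) ^+ 2 <= 0 by rewrite -(pmulr_rle0 _ c0).
  by rewrite real_exprn_even_le0 ?num_real //= subr_eq0 => /eqP ->.
- exact: (hz x).2.
Qed.

End Roots.

(** * Nash functions vanishing towards the complement of an open set *)

Section Exhaustion.
Variable R : realType.

Lemma within_continuousP (V W : normedModType R) (S : set V) (f : V -> W) :
  {within S, continuous f} <-> forall x, S x -> forall e : R, 0 < e ->
    exists2 d : R, 0 < d & forall h, `|h| < d -> S (x + h) -> `|f (x + h) - f x| < e.
Proof.
split=> [/subspace_continuousP cf x Sx e e0|H].
  have /(cvgrPdist_lt (FF := within_filter _ (nbhs_filter x)))/(_ e e0) := cf x Sx.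
  rewrite near_withinE => /nbhs_ballP[d /= d0 hd].
  exists d => // h hh Sh; rewrite distrC; apply: (hd (x + h)) => //.
  by rewrite -ball_normE /= opprD addNKr normrN.
apply/subspace_continuousP => x Sx.
apply/(cvgrPdist_lt (FF := within_filter _ (nbhs_filter x))) => e e0.
have [d d0 hd] := H x Sx e e0; rewrite near_withinE.
apply/nbhs_ballP; exists d => //= y; rewrite -ball_normE /= => hy Sy.
have E : y = x + (y - x) by rewrite addrC subrK.
by rewrite distrC E; apply: hd; rewrite -?E // distrC.
Qed.

Lemma ivt_lip (f : R -> R) a b L : a < b -> f a < 0 -> 0 < f b ->
  (forall x y, a <= x <= b -> a <= y <= b -> `|f x - f y| <= L * `|x - y|) ->
  exists2 z, a < z < b & f z = 0.
Proof.
move=> ab fa fb hL.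
have cf : {within `[a, b], continuous f}.
  apply/within_continuousP => x /= xab e e0.
  have L0 : 0 < `|L| + 1 by rewrite ltr_wpDl.
  exists (e / (`|L| + 1)) => [|h]; first by rewrite divr_gt0.
  rewrite ltr_pdivlMr // => hh xh.
  apply: le_lt_trans (hL _ _ _ _) _; rewrite ?(itvP xab) ?(itvP xh) //.
  rewrite addrAC subrr add0r; apply: le_lt_trans hh; rewrite mulrC ler_wpM2l //.
  by have := ler_norm L; lra.
have [|z] := IVT (v := 0) (ltW ab) cf.
  by rewrite ge_min (ltW fa) /= le_max (ltW fb) orbT.
rewrite in_itv /= => /andP[az zb] fz; exists z => //.
rewrite !lt_neqAle az zb !andbT; apply/andP; split; apply/eqP => E.
  by move: fa; rewrite E fz ltxx.
by move: fb; rewrite -E fz ltxx.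
Qed.

Lemma dot_ge m (x : 'rV[R]_m) : `|x| ^+ 2 <= dot x x.
Proof.
have d0 : 0 <= dot x x by apply: sumr_ge0 => i _; rewrite -expr2 sqr_ge0.
rewrite -[leRHS]sqr_sqrtr //; apply: lerXn2r; rewrite ?nnegrE ?sqrtr_ge0 //.
apply: norm_le; first exact: sqrtr_ge0.
move=> i; rewrite -sqrtr_sqr ler_sqrt // /dot (bigD1 i) //= expr2 lerDl.
by apply: sumr_ge0 => j _; rewrite -expr2 sqr_ge0.
Qed.

Lemma dot_ge0 m (x : 'rV[R]_m) : 0 <= dot x x.
Proof. by apply: le_trans (dot_ge x); exact: sqr_ge0. Qed.

Lemma smooth_dot m (U : set 'rV[R]_m) : smooth U (fun x => dot x x).
Proof. by move=> k; rewrite /dot; stac. Qed.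

Lemma dfun_dot T (eT : Enc R T) m (u v : T -> 'rV[R]_m) :
  dfun u -> dfun v -> dfun (fun x => dot (u x) (v x)).
Proof. by move=> du dv; rewrite /dot; dtac. Qed.

Lemma popen_lt m (U : set 'rV[R]_m) f c : popen U -> (forall x, U x -> pcont f x) ->
  popen (fun x => U x /\ f x < c).
Proof.
move=> oU cf; have cf' x : U x -> pcont (fun x => c - f x) x.
  move=> /cf cfx e /cfx[d d0 hd]; exists d => // h /hd.
  by rewrite (_ : c - f (x + h) - (c - f x) = - (f (x + h) - f x)) ?normrN //; ring.
have := popen_gt0 oU cf'; rewrite (_ : (fun x => _) = (fun x => U x /\ f x < c)) //.
by apply/funext => x; rewrite subr_gt0.
Qed.

Lemma compact_bounded_closed m (A : set 'rV[R]_m) (M : R) :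
  (forall x, A x -> `|x| <= M) -> popen (~` A) -> compact A.
Proof.
move=> bA oA; apply: bounded_closed_compact; last first.
  by rewrite -openC; exact/open_popen.
exists M; split; first exact: num_real.
by move=> K MK x /bA h; exact: le_trans h (ltW MK).
Qed.

Lemma exhaustion_all m : exhaustion (fun _ : 'rV[R]_m => True) (fun x => 2 + dot x x).
Proof.
have dT : dfun (fun x : 'rV[R]_m => 2 + dot x x).
  by apply: dfun_add; [exact: dfun_cst|apply: dfun_dot; exact: dfun_id].
have sT : smooth setT (fun x : 'rV[R]_m => 2 + dot x x).
  by have sd := @smooth_dot m setT; move=> k; stac.
split=> //; first exact: dP_cst.
  by move=> x _; rewrite lerDl dot_ge0.
move=> t; apply: (@compact_bounded_closed _ _ (1 + `|t|)).
  move=> x /= [_ hx]; have := dot_ge x => h.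
  have t0 := normr_ge0 t; have tt := ler_norm t; have x0 := normr_ge0 x.
  rewrite leNgt; apply/negP => H.
  have : (1 + `|t|) * 1 <= `|x| ^+ 2.
    by rewrite expr2; apply: ler_pM => //; lra.
  by lra.
have := popen_gt0 (f := fun x => 2 + dot x x - t) (@popenT R m).
have cT x : pcont (fun x : 'rV[R]_m => 2 + dot x x - t) x.
  apply: (@smooth_pcont _ _ setT); last by [].
  by have sd := @smooth_dot m setT; move=> k; stac.
move=> /(_ (fun x _ => cT x)) H x nx.
have [|d d0 hd] := H x.
  split=> //; rewrite subr_gt0 ltNge; apply/negP => h; exact: nx.
by exists d => // h /hd [_]; rewrite subr_gt0 ltNge => /negP hh [_].
Qed.

(* A smooth majorant of the positive part, tending to it as [s] tends to 0. *)
Definition sp (g s : R) := (g + Num.sqrt (g ^+ 2 + s ^+ 2)) / 2.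

Lemma sp_ge0 g s : 0 <= sp g s.
Proof.
rewrite /sp divr_ge0 // -lerBlDl sub0r; apply: le_trans (ler_norm _) _.
rewrite normrN -sqrtr_sqr ler_sqrt ?lerDl ?sqr_ge0 //.
by rewrite addr_ge0 ?sqr_ge0.
Qed.

Lemma sp_lip g s s' : `|sp g s - sp g s'| <= `|s - s'| / 2.
Proof.
rewrite /sp -mulrBl opprD addrACA subrr add0r normrM [`|2^-1|]gtr0_norm ?invr_gt0 //.
rewrite ler_pM2r ?invr_gt0 //.
wlog : s s' / Num.sqrt (g ^+ 2 + s' ^+ 2) <= Num.sqrt (g ^+ 2 + s ^+ 2).
  move=> H; have [h|h] := leP (Num.sqrt (g ^+ 2 + s' ^+ 2)) (Num.sqrt (g ^+ 2 + s ^+ 2)).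
    exact: H.
  by rewrite distrC [leRHS]distrC; apply: H; exact: ltW.
set a := Num.sqrt _; set b := Num.sqrt _ => ab.
rewrite ger0_norm ?subr_ge0 // lerBlDl.
rewrite -[leRHS]ger0_norm ?addr_ge0 ?sqrtr_ge0 // -sqrtr_sqr ler_wsqrtr //.
have a0 : 0 <= a by exact: sqrtr_ge0.
have a2 : a ^+ 2 = g ^+ 2 + s' ^+ 2 by rewrite sqr_sqrtr // addr_ge0 ?sqr_ge0.
rewrite sqrrD a2 real_normK ?num_real //.
have sa : `|s'| <= a by rewrite -sqrtr_sqr ler_wsqrtr // lerDr sqr_ge0.
have : s' * (s - s') <= a * `|s - s'|.
  by apply: le_trans (ler_norm _) _; rewrite normrM ler_wpM2r.
by nra.
Qed.

Lemma sp0 g : sp g 0 = Num.max g 0.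
Proof.
rewrite /sp expr0n addr0 sqrtr_sqr; have [g0|g0] := leP 0 g.
  by rewrite ger0_norm //; lra.
by rewrite ltr0_norm // subrr mul0r.
Qed.

Lemma sp_le1 g s : `|g| <= 2^-1 -> `|s| <= 1 -> sp g s <= 1.
Proof.
move=> hg hs; rewrite /sp ler_pdivrMr // mul1r.
have : Num.sqrt (g ^+ 2 + s ^+ 2) <= 3 / 2.
  rewrite -[leRHS]ger0_norm ?divr_ge0 // -sqrtr_sqr ler_wsqrtr //.
  move: hg hs; rewrite !ler_norml => /andP[h1 h2] /andP[h3 h4].
  by nra.
by move: hg; rewrite ler_norml => /andP[h1 h2]; lra.
Qed.

Lemma prod_lip (I : Type) (r : seq I) (a b : I -> R) :
  (forall i, 0 <= a i <= 1) -> (forall i, 0 <= b i <= 1) ->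
  `|\prod_(i <- r) a i - \prod_(i <- r) b i| <= \sum_(i <- r) `|a i - b i|.
Proof.
move=> ha hb; elim: r => [|i r IH]; first by rewrite !big_nil subrr normr0.
rewrite !big_cons.
set A := \prod_(j <- r) a j in IH *; set B := \prod_(j <- r) b j in IH *.
have -> : a i * A - b i * B = (a i - b i) * A + b i * (A - B) by ring.
apply: le_trans (ler_normD _ _) _; rewrite !normrM; apply: lerD.
  apply: ler_piMr => //; rewrite ger0_norm /A; first by rewrite prodr_ile1.
  by apply: prodr_ge0 => j _; case/andP: (ha j).
apply: le_trans IH; apply: ler_piMl => //.
by case/andP: (hb i) => h1 h2; rewrite ger0_norm.
Qed.

(* The witness at [x] is the root [s] of [A * s = \sum_i \prod_j sp (q i j x) s],
   where the constant [A] is large enough to make the difference increase in [s]. *)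
Lemma nash_vanishing m (U : set 'rV[R]_m) (I J : finType) (q : I -> J -> 'rV[R]_m -> R) :
  popen U -> dP U -> (forall i j, nash setT (q i j)) ->
  (forall x, U x <-> exists i, forall j, 0 < q i j x) ->
  exists delta, [/\ nash U delta, forall x, U x -> 0 < delta x &
     forall x e, 0 < e -> ~ U x ->
       exists2 d, 0 < d & forall h, `|h| < d -> U (x + h) -> delta (x + h) < e].
Proof.
move=> oU dU nq hU.
(* Rescaling to absolute value at most one half gives [sp (qh i j x) s <= 1] for [|s| <= 1], as
   needed for the Lipschitz bound [prod_lip]. *)
pose qh i j x := q i j x / (1 + q i j x ^+ 2).
have den0 i j x : 0 < 1 + q i j x ^+ 2 by rewrite ltr_wpDr ?sqr_ge0.
have nqh i j : nash setT (qh i j).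
  have [s d] := nq i j; split; last by rewrite /qh; dtac.
  by move=> k; rewrite /qh; stac => x _; exact: lt0r_neq0.
have qhp i j x : (0 < qh i j x) = (0 < q i j x) by rewrite /qh pmulr_lgt0 // invr_gt0.
have qhb i j x : `|qh i j x| <= 2^-1.
  rewrite ler_norml /qh lerNl -mulNr !ler_pdivrMr //.
  set y := q i j x; have h1 := sqr_ge0 (y - 1); have h2 := sqr_ge0 (y + 1).
  by apply/andP; split; nra.
pose H x s := \sum_i \prod_j sp (qh i j x) s.
(* [k] is a Lipschitz constant of [H x] and the cardinal of [I] bounds [H x 1]. Hence
   [A * s - H x s] is positive at 1 and has slopes at least [A - k >= 1]. *)
pose k : R := #|I|%:R * #|J|%:R; pose A := k + #|I|%:R + 1.
have I0 : 0 <= #|I|%:R :> R by [].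
have k0 : 0 <= k by rewrite mulr_ge0.
have b01 i j x s : `|s| <= 1 -> 0 <= sp (qh i j x) s <= 1.
  by move=> hs; rewrite sp_ge0 sp_le1.
have Hlip x s s' : `|s| <= 1 -> `|s'| <= 1 -> `|H x s - H x s'| <= k * `|s - s'|.
  move=> hs hs'; rewrite /H -sumrB; apply: le_trans (ler_norm_sum _ _ _) _.
  have -> : k * `|s - s'| = \sum_(i : I) \sum_(j : J) `|s - s'|.
    by rewrite !sumr_const /k -mulrA !mulr_natl.
  apply: ler_sum => i _; apply: le_trans (prod_lip _ _ _) _; try by move=> j; exact: b01.
  apply: ler_sum => j _; apply: le_trans (sp_lip _ _ _) _.
  by have := normr_ge0 (s - s'); lra.
have H1 x : H x 1 <= #|I|%:R.
  rewrite /H; apply: (@le_trans _ _ (\sum_(i : I) 1)); last by rewrite sumr_const.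
  apply: ler_sum => i _; rewrite prodr_ile1 // => j _; apply: b01.
  by rewrite normr1.
have H0 x : U x -> 0 < H x 0.
  move=> /hU[i hi]; rewrite /H (bigD1 i) //= ltr_wpDr //.
    by apply: sumr_ge0 => i' _; apply: prodr_ge0 => j _; exact: sp_ge0.
  by apply: prodr_gt0 => j _; rewrite sp0 lt_max qhp hi.
pose O : set 'rV[R]_(1 + m) := [set y | 0 < y 0 (lshift m 0) < 1].
pose Psi (y : 'rV[R]_(1 + m)) := A * y 0 (lshift m 0) - H (rsubmx y) (y 0 (lshift m 0)).
have zpt z (x : 'rV[R]_m) : (pt z x) 0 (lshift m 0) = z by rewrite /pt row_mxEl mxE.
have PsiE z x : Psi (pt z x) = A * z - H x z by rewrite /Psi zpt /pt row_mxKr.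
have dcoord : dfun (fun y : 'rV[R]_(1 + m) => y 0 (lshift m 0)) by dtac.
have oO : popen O.
  have ct y : pcont (fun y : 'rV[R]_(1 + m) => y 0 (lshift m 0)) y.
    by apply: (hasgrad_cont (hasgrad_coord _ _)).
  have P1 := popen_gt0 (@popenT R (1 + m)) (fun x _ => ct x).
  have P2 := popen_lt (c := 1) P1 (fun x _ => ct x).
  move=> y /andP[y0 y1]; have [|d d0 hd] := P2 y; first by split=> //; split.
  by exists d => // h /hd [[_ h1] h2]; apply/andP.
have dO : dP O.
  apply: (@dP_ext _ _ _ (fun y : 'rV[R]_(1 + m) => 0 < y 0 (lshift m 0) /\ y 0 (lshift m 0) < 1)).
    by move=> y; rewrite /O /=; split=> [[-> ->]|/andP].
  by dtac.
have drsub : dfun (fun y : 'rV[R]_(1 + m) => rsubmx y).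
  apply: dfun_row => i; have d : dfun (fun y : 'rV[R]_(1 + m) => y 0 (rshift 1 i)) by dtac.
  by apply: dfun_ext d => y; rewrite mxE.
have nPsi : nash O Psi.
  split; last first.
    rewrite /Psi /H /sp; apply: dfun_sub; first by dtac.
    apply: dfun_sum => i; apply: dfun_prod => j.
    have d1 : dfun (fun y : 'rV[R]_(1 + m) => qh i j (rsubmx y)).
      by apply: dfun_comp drsub; exact: (nqh i j).2.
    by dtac.
  have sq i j : smooth O (fun y : 'rV[R]_(1 + m) => qh i j (rsubmx y)).
    move=> l; apply: (@Dk_comp _ _ _ _ _ setT (qh i j)) => //; last exact: (nqh i j).1.
    by move=> i'; apply: Dk_fext (Dk_coord _ _ (rshift 1 i')) => y; rewrite mxE.
  move=> l; rewrite /Psi /H /sp; stac => //.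
  move=> y /andP[y0 _]; rewrite ltr_wpDl ?sqr_ge0 //.
  by rewrite exprn_gt0.
have [|delta nd hd] := nash_root oU dU oO dO nPsi.
  move=> x Ux.
  have lip01 z z' : 0 <= z <= 1 -> 0 <= z' <= 1 ->
      `|H x z - H x z'| <= k * `|z - z'|.
    by move=> /andP[z0 z1] /andP[z0' z1']; apply: Hlip; rewrite ger0_norm.
  have [||z y z01 y01|z /andP[z0 z1] Pz] := @ivt_lip (fun z => A * z - H x z) 0 1 (A + k) ltr01.
  - by rewrite mulr0 sub0r oppr_lt0; exact: H0.
  - by rewrite mulr1 subr_gt0; apply: le_lt_trans (H1 x) _; rewrite /A; lra.
  - have L := lip01 z y z01 y01.
    have -> : A * z - H x z - (A * y - H x y) = A * (z - y) - (H x z - H x y) by ring.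
    apply: le_trans (ler_normB _ _) _; rewrite [leRHS](mulrDl A k); apply: lerD => //.
    by rewrite normrM ger0_norm // /A; lra.
  exists z; split; rewrite ?PsiE ?Pz //; first by rewrite /O /= zpt z0 z1.
  exists 1 => // y; rewrite /O /= zpt PsiE => /andP[y0 y1].
  have /ler_normlP[L1 L2] := lip01 y z ltac:(by rewrite !ltW) ltac:(by rewrite !ltW).
  have -> : A * y - H x y = A * (y - z) - (H x y - H x z) by rewrite -[LHS]subr0 -Pz; ring.
  have A1 : A - k >= 1 by rewrite /A; lra.
  have : (H x y - H x z) * (y - z) <= k * (y - z) ^+ 2.
    rewrite -real_normK ?num_real // expr2 mulrA; apply: le_trans (ler_norm _) _.
    by rewrite normrM ler_wpM2r // ler_norml lerNl L1 L2.
  by have := sqr_ge0 (y - z); nra.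
have d01 x : U x -> 0 < delta x < 1.
  by move=> /hd[]; rewrite /O /= zpt.
exists delta; split=> // [x /d01/andP[]//|x e e0 nUx].
(* Slopes being at least 1, the root is at most [H x' 0]. This becomes small near a point off [U],
   since there each product has a factor coming from some [q i j x <= 0]. *)
have hle x' : U x' -> delta x' <= H x' 0.
  move=> Ux'; have /andP[p0 p1] := d01 x' Ux'; have [_] := hd x' Ux'.
  rewrite PsiE => /eqP; rewrite subr_eq0 => /eqP E.
  have := Hlip x' (delta x') 0 _ _; rewrite normr0 subr0 gtr0_norm // => /(_ (ltW p1) ler01).
  rewrite ler_norml => /andP[_]; rewrite -E => L.
  have : delta x' * 1 <= delta x' * (A - k) by rewrite ler_pM2l // /A; lra.
  by lra.
have /choice[j hj] : forall i, exists j, q i j x <= 0.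
  move=> i; apply: contrapT => hn; apply: nUx; apply/hU; exists i => j.
  by rewrite ltNge; apply/negP => h; apply: hn; exists j.
pose e1 := e / (#|I|%:R + 1).
have e10 : 0 < e1 by rewrite divr_gt0 // ltr_wpDl.
have /choice[d hd'] : forall i, exists d, 0 < d /\ forall h, `|h| < d -> qh i (j i) (x + h) < e1.
  move=> i; have [d d0 hdd] := smooth_pcont (nqh i (j i)).1 (Logic.I : setT x) e10.
  exists d; split=> // h /hdd; have : qh i (j i) x <= 0.
    by rewrite leNgt qhp -leNgt.
  by rewrite ltr_norml => h1 /andP[_ h2]; lra.
exists (\big[Num.min/1]_i d i) => [|h /bigmin_gtP[_ hh] Uh].
  by apply/bigmin_gtP; split=> // i _; exact: (hd' i).1.
apply: le_lt_trans (hle _ Uh) _.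
apply: (@le_lt_trans _ _ (\sum_(i : I) e1)).
  apply: ler_sum => i _; rewrite (bigD1 (j i)) //=.
  apply: (@le_trans _ _ (sp (qh i (j i) (x + h)) 0)).
    apply: ler_piMr; first exact: sp_ge0.
    by apply: prodr_ile1 => j' _; apply: b01; rewrite normr0.
  rewrite sp0 ge_max (ltW e10) andbT; apply: ltW; apply: (hd' i).2; exact: hh.
rewrite sumr_const -mulr_natl /e1 mulrCA gtr_pMr // ltr_pdivrMr ?ltr_wpDl // mul1r.
by rewrite ltrDl.
Qed.

End Exhaustion.

Section LocallyCompact.
Variable R : realType.

(** A locally compact set is closed in an open set [U]. The inverse of a positive Nash function on
    [U] that vanishes towards the complement, added to [2 + dot x x], keeps the sublevel sets
    bounded and away from that complement; their intersections with [S] are compact. *)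
Lemma locally_compact_exhaustion m (S : set 'rV[R]_m) :
  semialgebraic S -> locally_compact_set S ->
  exists U T, [/\ popen U /\ dP U, S `<=` U, nash U T, forall x, U x -> 2 <= T x &
    exhaustion S T].
Proof.
move=> sS lcS; have dS : dP S by exact: sS.
pose clS (y : 'rV[R]_m) := forall e : R, 0 < e -> exists z, S z /\ `|y - z| < e.
(* The points around which [S] is closed: an open definable set, which contains [S] by local
   compactness. *)
pose U (x : 'rV[R]_m) := exists r : R, 0 < r /\ forall y, `|x - y| < r -> clS y -> S y.
have dU : dP U by rewrite /U /clS; dtac.
have oU : popen U.
  move=> x [r [r0 hr]]; exists (r / 2) => [|h hh]; first by rewrite divr_gt0.
  exists (r / 2); split=> [|y hy]; first by rewrite divr_gt0.
  apply: hr; rewrite -(subrKA (x + h)) opprD addNKr.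
  by apply: le_lt_trans (ler_normD _ _) _; rewrite normrN [r]splitr ltrD.
have SU : S `<=` U.
  move=> x Sx; have [K [cK KS [e e0 hK]]] := lcS x Sx.
  exists e; split=> // y hy cy; apply: KS.
  have : closed K by apply: compact_closed => //; exact: norm_hausdorff.
  apply => B /nbhs_ballP[d /= d0 hd].
  have xy : 0 < e - `|x - y| by rewrite subr_gt0.
  have [z [Sz yz]] := cy (Num.min d (e - `|x - y|)) ltac:(by rewrite lt_min d0).
  move: yz; rewrite lt_min => /andP[yz1 yz2].
  exists z; split; last by apply: hd; rewrite -ball_normE.
  apply: hK; split=> //; rewrite -ball_normE /= -(subrKA y).
  by apply: le_lt_trans (ler_normD _ _) _; rewrite -ltrBrDl.
(* The whole space, exhausted by [2 + dot x x], plays the part of [S] here; the strict inequalities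
   describing [U] are the input of [nash_vanishing]. *)
have [I [J [q [hq hqU]]]] := finiteness (exhaustion_all R m) dU (fun x _ Ux =>
  let: ex_intro2 d d0 hd := oU x Ux in ex_intro2 _ _ d d0 (fun h hh _ => hd h hh)).
have sT0 : smooth setT (fun x : 'rV[R]_m => 2 + dot x x).
  by have sd := @smooth_dot R m setT; move=> k; stac.
have dT0 : dfun (fun x : 'rV[R]_m => 2 + dot x x).
  by apply: dfun_add; [exact: dfun_cst|apply: dfun_dot; exact: dfun_id].
have [||delta [[sd dd] dpos dvan]] := nash_vanishing oU dU (q := q).
- by move=> i j; split; [exact: polyfun_smooth sT0 (hq i j)|exact: polyfun_dfun dT0 (hq i j)].
- by move=> x; exact: hqU.
pose T x := 2 + dot x x + (delta x)^-1.
have sT : smooth U T.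
  have sd2 := @smooth_dot R m U; move=> k; rewrite /T; stac => x Ux.
  by apply: lt0r_neq0; exact: dpos.
have T2 x : U x -> 2 + dot x x <= T x by move=> Ux; rewrite lerDl invr_ge0 ltW // dpos.
exists U, T; split=> //.
- by split=> //; rewrite /T; dtac; apply: dfun_dot; exact: dfun_id.
- by move=> x /T2; apply: le_trans; rewrite lerDl dot_ge0.
split=> //.
- by rewrite /T; dtac; apply: dfun_dot; exact: dfun_id.
- by move=> x /SU /T2; apply: le_trans; rewrite lerDl dot_ge0.
move=> t; apply: (@compact_bounded_closed _ _ _ (1 + `|t|)).
  move=> x /= [/SU Ux hx]; have h := dot_ge x; have hT := T2 x Ux.
  have t0 := normr_ge0 t; have tt := ler_norm t; have x0 := normr_ge0 x.
  rewrite leNgt; apply/negP => H.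
  have : (1 + `|t|) * 1 <= `|x| ^+ 2.
    by rewrite expr2; apply: ler_pM => //; lra.
  by lra.
move=> x nK; have [t0|t0] := leP t 0.
  exists 1 => // h _ [/= /SU Uh Th]; have := T2 _ Uh; have := dot_ge0 (x + h); lra.
have [Ux|nU] := pselect (U x); last first.
  have [d d0 hd] := dvan x t^-1 ltac:(by rewrite invr_gt0) nU.
  exists d => // h hh [/= /SU Uh Th]; have := hd h hh Uh; have dp := dpos _ Uh.
  apply/negP; rewrite -leNgt -[leRHS]invrK lef_pV2 ?posrE ?invr_gt0 //.
  by apply: le_trans Th; rewrite /T; have := dot_ge0 (x + h); lra.
have [Sx|nS] := pselect (S x).
  have xt : 0 < T x - t by rewrite subr_gt0 ltNge; apply/negP => h; apply: nK.
  have [d d0 hd] := smooth_pcont sT Ux xt; exists d => // h /hd hh [/= _ Th].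
  by move: hh; rewrite ltr_norml => /andP[]; lra.
have [r [r0 hr]] := Ux.
have nc : ~ clS x by move=> cx; apply: nS; apply: hr => //; rewrite subrr normr0.
have /existsNP[e /not_implyP[e0 he]] := nc.
exists e => // h hh [/= Sh _]; apply: he; exists (x + h); split=> //.
by rewrite opprD addNKr normrN.
Qed.

End LocallyCompact.

(** * Nash approximation of roots *)

Section Barrier.
Variable R : realType.

Section OneVariable.
Variables (p : {poly R}) (s a b eta tau kap K : R).
Hypotheses (ab : a < b) (eta0 : 0 < eta) (kap0 : 0 < kap) (tau0 : 0 < tau) (s1 : `|s| = 1).
Hypothesis pmid : forall z, a + tau <= z <= b - tau -> - eta <= s * p^`().[z].
Hypothesis pK : forall z, a <= z <= b -> `|p^`().[z]| <= K.
Hypothesis tauK : tau * (b - a) * K <= kap.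

(** The linear term compensates slopes of [s * p] down to [- eta]. The poles send the values to
    minus infinity at [a] and plus infinity at [b], which forces a root, and their steepness
    outweighs the derivative of [p] in the end strips of width [tau], where its sign is unknown. *)
Definition barrier (z : R) := s * p.[z] + 2 * eta * z + kap * ((b - z)^-1 - (z - a)^-1).

Lemma poly_lip x y : a <= x <= b -> a <= y <= b -> `|p.[x] - p.[y]| <= K * `|x - y|.
Proof.
wlog : x y / x < y.
  move=> H; have [h|h|->] := ltgtP x y; first exact: H.
    by move=> h1 h2; rewrite distrC [`|x - y|]distrC; apply: H.
  by rewrite !subrr normr0 mulr0.
move=> xy /andP[ax xb] /andP[ay yb].
have [c hc E] := polyrcf.poly_mvt p xy.
rewrite distrC E normrM [`|x - y|]distrC ler_wpM2r // pK //.
by move: hc; rewrite in_itv /= => /andP[h1 h2]; rewrite !ltW ?(le_lt_trans ax) ?(lt_le_trans h2).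
Qed.

Lemma barrier_mono x z : a < x -> x < z -> z < b -> eta * (z - x) <= barrier z - barrier x.
Proof.
have e0 := eta0; have c0 := tau0.
move=> ax xz zb; have [c hc E] := polyrcf.poly_mvt p xz.
move: hc; rewrite in_itv /= => /andP[xc cz].
have zx : 0 < z - x by rewrite subr_gt0.
have bz : 0 < b - z by rewrite subr_gt0.
have bx : 0 < b - x by lra.
have za : 0 < z - a by lra.
have xa : 0 < x - a by lra.
have -> : barrier z - barrier x =
   (s * p^`().[c] + 2 * eta + kap / ((b - z) * (b - x)) + kap / ((z - a) * (x - a))) * (z - x).
  rewrite /barrier.
  have -> : s * p.[z] + 2 * eta * z + kap * ((b - z)^-1 - (z - a)^-1) -
    (s * p.[x] + 2 * eta * x + kap * ((b - x)^-1 - (x - a)^-1)) =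
    s * (p.[z] - p.[x]) + 2 * eta * (z - x) + kap * ((b - z)^-1 - (b - x)^-1)
      + kap * ((x - a)^-1 - (z - a)^-1) by ring.
  rewrite E; field.
  by rewrite !lt0r_neq0.
rewrite ler_pM2r //.
have q1 : 0 <= kap / ((b - z) * (b - x)) by rewrite divr_ge0 ?mulr_ge0 ?ltW.
have q2 : 0 <= kap / ((z - a) * (x - a)) by rewrite divr_ge0 ?mulr_ge0 ?ltW.
have pc : - K <= s * p^`().[c].
  have : `|s * p^`().[c]| <= K by rewrite normrM s1 mul1r pK // !ltW //; lra.
  by rewrite ler_norml => /andP[].
have ba0 : 0 < b - a by lra.
have K0 : 0 <= K by apply: le_trans (normr_ge0 p^`().[a]) (pK _); rewrite lexx ltW.
have [c1|c1] := leP (a + tau) c; last first.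
  suff : K <= kap / ((z - a) * (x - a)).
    by move: q1 q2 pc; set q := kap / _; set q' := kap / _; set w := s * _; lra.
  by rewrite ler_pdivlMr ?mulr_gt0 //; apply: le_trans tauK; rewrite mulrC ler_wpM2r // mulrC;
    apply: ler_pM; lra.
have [c2|c2] := leP c (b - tau); last first.
  suff : K <= kap / ((b - z) * (b - x)).
    by move: q1 q2 pc; set q := kap / _; set q' := kap / _; set w := s * _; lra.
  by rewrite ler_pdivlMr ?mulr_gt0 //; apply: le_trans tauK; rewrite mulrC ler_wpM2r //;
    apply: ler_pM; lra.
have := @pmid c ltac:(by rewrite c1).
by move: q1 q2; set q := kap / _; set q' := kap / _; set w := s * _; lra.
Qed.

Lemma barrier_root : exists2 z, a < z < b & barrier z = 0.
Proof.
(* The barrier function multiplied by [(b - z) * (z - a)]: a polynomial of opposite signs at the two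
   ends. *)
pose Q := (s *: p + (2 * eta) *: 'X) * ((b%:P - 'X) * ('X - a%:P)) +
   kap *: (('X - a%:P) - (b%:P - 'X)).
have QE z : Q.[z] = (s * p.[z] + 2 * eta * z) * ((b - z) * (z - a)) + kap * ((z - a) - (b - z)).
  by rewrite /Q !hornerE.
have Qa : Q.[a] < 0.
  rewrite QE subrr mulr0 mulr0 add0r sub0r mulrN oppr_lt0 mulr_gt0 // subr_gt0 //.
have Qb : 0 < Q.[b].
  by rewrite QE subrr mul0r mulr0 add0r subr0 mulr_gt0 // subr_gt0.
have [|z zab /rootP Qz] := polyrcf.poly_ivtoo (p := Q) (ltW ab).
  by rewrite pmulr_llt0.
have /andP[za zb] : a < z < b by move: zab; rewrite in_itv.
exists z; first by rewrite za.
have h1 : b - z != 0 by rewrite gt_eqF // subr_gt0.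
have h2 : z - a != 0 by rewrite gt_eqF // subr_gt0.
have -> : barrier z = Q.[z] / ((b - z) * (z - a)).
  by rewrite QE /barrier; field; rewrite ?h1 ?h2.
by rewrite Qz mul0r.
Qed.

Variables (e k r x : R).
Hypotheses (k0 : 0 < k) (kk : kap = k ^+ 2) (ke : k < e) (etar : 2 * eta * r + k + k * K <= e).
Hypotheses (ax : a < x) (xb : x < b) (rx : barrier x = 0) (ra : - r <= a) (br : b <= r).

(** Right of its root the barrier function is nonnegative, and up to [b - k] the pole at [b]
    contributes at most [k], because [kap = k ^+ 2]. This bounds [s * p] below by
    [- (2 * eta * r + k)]; on the last strip of width [k] the Lipschitz constant costs at most
    [k * K] more. The gap [e > k] ensures that [b - k] lies right of the root. *)
Lemma barrier_right z : x + e <= z -> z <= b -> - e <= s * p.[z].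
Proof.
have e0 := eta0; have ke' := ke; have etar' := etar; have ax' := ax; have xb' := xb.
have ra' := ra; have br' := br; have k0' := k0; have ab' := ab.
have K0 : 0 <= K by apply: le_trans (normr_ge0 p^`().[a]) (pK _); rewrite lexx ltW.
have main z' : x < z' -> z' <= b - k -> - (2 * eta * r + k) <= s * p.[z'].
  move=> xz zk; have zb : z' < b by lra.
  have := barrier_mono ax xz zb; rewrite rx subr0 /barrier => H.
  have H0 : 0 < eta * (z' - x) by rewrite mulr_gt0 // subr_gt0.
  have h1 : kap * (b - z')^-1 <= k.
    rewrite kk ler_pdivrMr; last by lra.
    by rewrite expr2 ler_pM2l //; lra.
  have h2 : 0 < kap * (z' - a)^-1 by rewrite mulr_gt0 // invr_gt0; lra.
  have h3 : eta * z' <= eta * r by rewrite ler_pM2l //; lra.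
  by lra.
move=> xz zb; have kK : 0 <= k * K by rewrite mulr_ge0 // ltW.
have [zk|zk] := leP z (b - k).
  by have := main z ltac:(lra) zk; lra.
have := main (b - k) ltac:(lra) (lexx _).
have := @poly_lip z (b - k) ltac:(apply/andP; lra) ltac:(apply/andP; lra).
rewrite [`|z - _|]ger0_norm; last by lra.
move=> H; have : `|s * (p.[z] - p.[b - k])| <= K * k.
  rewrite normrM s1 mul1r; apply: le_trans H _; rewrite ler_wpM2l //; lra.
by rewrite ler_norml => /andP[]; lra.
Qed.

Lemma barrier_left z : a <= z -> z <= x - e -> - e <= - s * p.[z].
Proof.
have e0 := eta0; have ke' := ke; have etar' := etar; have ax' := ax; have xb' := xb.
have ra' := ra; have br' := br; have k0' := k0; have ab' := ab.
have K0 : 0 <= K by apply: le_trans (normr_ge0 p^`().[a]) (pK _); rewrite lexx ltW.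
have main z' : z' < x -> a + k <= z' -> - (2 * eta * r + k) <= - s * p.[z'].
  move=> xz zk; have zb : a < z' by lra.
  have := barrier_mono zb xz xb; rewrite rx sub0r /barrier => H.
  have H0 : 0 < eta * (x - z') by rewrite mulr_gt0 // subr_gt0.
  have h1 : kap * (z' - a)^-1 <= k.
    rewrite kk ler_pdivrMr; last by lra.
    by rewrite expr2 ler_pM2l //; lra.
  have h2 : 0 < kap * (b - z')^-1 by rewrite mulr_gt0 // invr_gt0; lra.
  have h3 : eta * (- r) <= eta * z' by rewrite ler_pM2l //; lra.
  by lra.
move=> az zx; have kK : 0 <= k * K by rewrite mulr_ge0 // ltW.
have [zk|zk] := leP (a + k) z.
  by have := main z ltac:(lra) zk; lra.
have := main (a + k) ltac:(lra) (lexx _).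
have := @poly_lip z (a + k) ltac:(apply/andP; lra) ltac:(apply/andP; lra).
rewrite [`|z - _|]ler0_norm; last by lra.
move=> H; have : `|s * (p.[z] - p.[a + k])| <= K * k.
  rewrite normrM s1 mul1r; apply: le_trans H _; rewrite ler_wpM2l //; lra.
by rewrite ler_norml => /andP[]; lra.
Qed.

End OneVariable.

End Barrier.

(** * Nash functions separating the sign changes of a polynomial *)

Section RootSeparation.
Variable R : realType.

Section Setup.
Variables (m : nat) (U : set 'rV[R]_m).
Hypotheses (oU : popen U) (dU : dP U).

Definition lift1 : set 'rV[R]_(1 + m) := [set y | U (rsubmx y)].

Lemma norm_rsub k (y : 'rV[R]_(k + m)) : `|rsubmx y| <= `|y|.
Proof. by apply: norm_le => // i; rewrite mxE norm_coord. Qed.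

Lemma popen_lift1 : popen lift1.
Proof.
move=> y /oU[d d0 hd]; exists d => // h hh; rewrite /lift1 /= linearD; apply: hd.
exact: le_lt_trans (norm_rsub h) hh.
Qed.

Lemma dfun_rsub : dfun (fun y : 'rV[R]_(1 + m) => rsubmx y).
Proof.
apply: dfun_row => i; have d : dfun (fun y : 'rV[R]_(1 + m) => y 0 (rshift 1 i)) by dtac.
by apply: dfun_ext d => y; rewrite mxE.
Qed.

Lemma nash_rsub f : nash U f -> nash lift1 (fun y => f (rsubmx y)).
Proof.
move=> [sf df]; split; last exact: dfun_comp df dfun_rsub.
move=> k; apply: (@Dk_comp _ _ _ _ _ U f) => //.
by move=> i; apply: Dk_fext (Dk_coord _ _ (rshift 1 i)) => y; rewrite mxE.
Qed.

Lemma nash_coord1 : nash lift1 (fun y => y 0 (lshift m 0)).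
Proof. by split; [move=> k; exact: Dk_coord|dtac]. Qed.

Lemma nash_add f g : nash U f -> nash U g -> nash U (fun x => f x + g x).
Proof. by move=> [sf df] [sg dg]; split; [move=> k; stac|dtac]. Qed.
Lemma nash_mul f g : nash U f -> nash U g -> nash U (fun x => f x * g x).
Proof. by move=> [sf df] [sg dg]; split; [move=> k; stac|dtac]. Qed.
Lemma nash_opp f : nash U f -> nash U (fun x => - f x).
Proof. by move=> [sf df]; split; [move=> k; stac|dtac]. Qed.
Lemma nash_exp f n : nash U f -> nash U (fun x => f x ^+ n).
Proof. by move=> [sf df]; split; [move=> k; stac|dtac]. Qed.
Lemma nash_cst c : nash U (fun _ => c).
Proof. by split; [move=> k; stac|dtac]. Qed.
Lemma nash_inv f : (forall x, U x -> f x != 0) -> nash U f -> nash U (fun x => (f x)^-1).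
Proof. by move=> f0 [sf df]; split; [move=> k; stac|dtac]. Qed.
Lemma nash_sum (I : Type) (r : seq I) (F : I -> 'rV[R]_m -> R) :
  (forall i, nash U (F i)) -> nash U (fun x => \sum_(i <- r) F i x).
Proof.
move=> hF; have sF i := (hF i).1; have dF i := (hF i).2.
by split; [move=> k; stac|dtac].
Qed.
Lemma nash_fext f g : (forall x, g x = f x) -> nash U g -> nash U f.
Proof. by move=> /funext ->. Qed.

End Setup.

Definition nash_poly m (U : set 'rV[R]_m) (p : 'rV[R]_m -> {poly R}) :=
  forall i, nash U (fun x => (p x)`_i).

Lemma nash_poly_deriv m (U : set 'rV[R]_m) p : nash_poly U p -> nash_poly U (fun x => (p x)^`()).
Proof.
move=> np i; apply: (nash_fext (g := fun x => i.+1%:R * (p x)`_i.+1)).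
  by move=> x; rewrite coef_deriv mulr_natl.
by apply: nash_mul => //; exact: nash_cst.
Qed.

(** [barrier_mono] supplies the lower bound on slopes, with constant [eta x], that [nash_root] asks
    for. *)
Lemma nash_barrier_root m (U : set 'rV[R]_m) (p : 'rV[R]_m -> {poly R}) D s a b eta kap :
  popen U -> dP U -> nash_poly U p -> (forall x, (size (p x) <= D)%N) -> `|s| = 1 ->
  nash U a -> nash U b -> nash U eta -> nash U kap ->
  (forall x, U x -> [/\ a x < b x, 0 < eta x, 0 < kap x & exists tau K, [/\ 0 < tau,
     (forall z, a x + tau <= z <= b x - tau -> - eta x <= s * (p x)^`().[z]),
     (forall z, a x <= z <= b x -> `|(p x)^`().[z]| <= K) &
     tau * (b x - a x) * K <= kap x]]) ->
  exists zeta, nash U zeta /\ forall x, U x ->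
    a x < zeta x < b x /\ barrier (p x) s (a x) (b x) (eta x) (kap x) (zeta x) = 0.
Proof.
move=> oU dU np sp s1 na nb neta nkap H.
pose L := lift1 U; have oL := popen_lift1 oU.
have dL : dP L by exact: (dP_fun dU (dfun_rsub _)).
pose z0 (y : 'rV[R]_(1 + m)) := y 0 (lshift m 0).
have nz0 : nash L z0 := nash_coord1 U.
have na' := nash_rsub na; have nb' := nash_rsub nb.
have neta' := nash_rsub neta; have nkap' := nash_rsub nkap.
have npp i := nash_rsub (np i).
have n1 : nash L (fun y => z0 y - a (rsubmx y)) by apply: nash_add => //; exact: nash_opp.
have n2 : nash L (fun y => b (rsubmx y) - z0 y) by apply: nash_add => //; exact: nash_opp.
pose O : set 'rV[R]_(1 + m) := fun y => (L y /\ 0 < z0 y - a (rsubmx y)) /\ 0 < b (rsubmx y) - z0 y.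
have oO : popen O.
  have o1 := popen_gt0 oL (fun x Lx => smooth_pcont n1.1 Lx).
  apply: (popen_gt0 o1) => x [Lx _]; exact: smooth_pcont n2.1 Lx.
have dO : dP O.
  have d1 := n1.2; have d2 := n2.2.
  by apply: dP_and; [apply: dP_and => //|]; apply: dP_lt => //; exact: dfun_cst.
have OL : O `<=` L by move=> y [[]].
have nsub f : nash L f -> nash O f.
  by move=> [sf df]; split => // k; exact: Dk_sub OL (sf k).
pose Psi y := barrier (p (rsubmx y)) s (a (rsubmx y)) (b (rsubmx y)) (eta (rsubmx y))
  (kap (rsubmx y)) (z0 y).
have nPsi : nash O Psi.
  have n3 : nash O (fun y => \sum_(i < D) (p (rsubmx y))`_i * z0 y ^+ i).
    apply: nash_sum => i; apply: nash_mul; first exact: nsub (npp i).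
    by apply: nash_exp; exact: nsub.
  apply: (nash_fext (g := fun y => s * (\sum_(i < D) (p (rsubmx y))`_i * z0 y ^+ i) +
     2 * eta (rsubmx y) * z0 y + kap (rsubmx y) * ((b (rsubmx y) - z0 y)^-1
       - (z0 y - a (rsubmx y))^-1))).
    by move=> y; rewrite /Psi /barrier (horner_coef_wide _ (sp _)).
  have c k := nash_cst O k.
  apply: nash_add.
    apply: nash_add; first exact: nash_mul.
    by apply: nash_mul; [apply: nash_mul => //|]; exact: nsub.
  apply: nash_mul; first exact: nsub.
  apply: nash_add; last apply: nash_opp; apply: nash_inv; try exact: nsub.
    by move=> y [_ h]; rewrite gt_eqF.
  by move=> y [[_ h] _]; rewrite gt_eqF.
have Opt z x : O (pt z x) <-> U x /\ a x < z < b x.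
  rewrite /O /L /lift1 /z0 /pt /= row_mxKr row_mxEl mxE !subr_gt0.
  by split=> [[[Ux ->] ->]|[Ux /andP[]]].
have Ppt z x : Psi (pt z x) = barrier (p x) s (a x) (b x) (eta x) (kap x) z.
  by rewrite /Psi /z0 /pt row_mxKr row_mxEl mxE.
have [|zeta nz hz] := nash_root oU dU oO dO nPsi; last first.
  by exists zeta; split=> // x Ux; have [/Opt[_ h1] h2] := hz x Ux; rewrite -Ppt.
move=> x Ux; have [ab e0 k0 [tau [K [t0 h1 h2 h3]]]] := H x Ux.
have mono := barrier_mono ab e0 k0 t0 s1 h1 h2 h3.
have [z /andP[az zb] Bz] := barrier_root (p x) s (eta x) ab k0.
exists z; rewrite Ppt; split=> //; first by apply/Opt; rewrite az zb.
exists (eta x) => // z' /Opt[_ /andP[az' zb']]; rewrite Ppt.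
have [zz|zz|->] := ltgtP z' z.
- have := mono _ _ az' zz zb; rewrite Bz sub0r => h.
  have z0' : 0 < z - z' by rewrite subr_gt0.
  have := ler_wpM2r (ltW z0') h; rewrite expr2; nra.
- have := mono _ _ az zz zb'; rewrite Bz subr0 => h.
  have z0' : 0 < z' - z by rewrite subr_gt0.
  by rewrite expr2 mulrA ler_pM2r.
- by rewrite subrr expr0n !mulr0.
Qed.

Lemma signr_step (n i : nat) : (i <= n)%N -> (-1) ^+ (n.+1 - i) = - (-1) ^+ (n - i) :> R.
Proof. by move=> h; rewrite subSn // exprS mulN1r. Qed.

Lemma mul_bound (t w b k : R) : 0 < t -> 0 <= w -> w <= 2 * (b + 1) -> 0 <= k ->
  t * w * k <= t * (2 * (b + 1) * (k + 1)).
Proof.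
move=> t0 w0 wb k0; rewrite -[leLHS]mulrA ler_pM2l //.
by apply: ler_pM => //; lra.
Qed.

(* The functions [r 1 < ... < r d] play the part of the roots of [p]: up to a
   tolerance [e], the sign of [p] between them is that of a polynomial with
   nonnegative leading coefficient and these roots.  Between two consecutive
   separating functions of the derivative, where [p] is almost monotone, [r i]
   is the root of [p] perturbed by a barrier at both ends. *)
Lemma nash_separation m (U : set 'rV[R]_m) d (p : 'rV[R]_m -> {poly R}) B e :
  popen U -> dP U -> nash_poly U p -> (forall x, (size (p x) <= d.+1)%N) ->
  (forall x, U x -> 0 <= (p x)`_d) ->
  nash U B -> nash U e -> (forall x, U x -> 0 < B x) -> (forall x, U x -> 0 < e x) ->
  exists r : nat -> 'rV[R]_m -> R, (forall i, nash U (r i)) /\ forall x, U x ->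
    [/\ r 0%N x = - B x, r d.+1 x = B x, forall i, (i <= d)%N -> r i x < r i.+1 x &
      forall i z, (i <= d)%N -> r i x + e x <= z <= r i.+1 x - e x ->
        - e x <= (-1) ^+ (d - i) * (p x).[z]].
Proof.
move=> oU dU; elim: d p e => [|d IH] p e np sp lc nB ne B0 e0.
  exists (fun i => if i is 0%N then fun x => - B x else B); split.
    by case=> [|i] //; exact: nash_opp.
  move=> x Ux; split=> //.
    by case=> // _; apply: lt_trans (B0 x Ux); rewrite oppr_lt0 B0.
  case=> // z _ _; rewrite subnn mul1r [p x]size1_polyC // hornerC.
  by apply: le_trans (lc x Ux); rewrite oppr_le0 ltW // e0.
have np' := nash_poly_deriv np.
have nc k := nash_cst U k.
(* A Nash bound of the derivative between [- B x] and [B x]; [1 + c ^+ 2] replaces the absolute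
   value of a coefficient, which is not smooth. *)
pose K x := \sum_(i < d.+1) (1 + (p x)^`()`_i ^+ 2) * B x ^+ i.
have nK : nash U K.
  by apply: nash_sum => i; apply: nash_mul; [apply: nash_add => //; exact: nash_exp|exact: nash_exp].
have sp' x : (size (p x)^`() <= d.+1)%N.
  have [->|h] := eqVneq (p x) 0; first by rewrite deriv0 size_poly0.
  by rewrite -ltnS; apply: leq_trans (lt_size_deriv h) (sp x).
have hK x z : U x -> - B x <= z <= B x -> `|(p x)^`().[z]| <= K x.
  move=> Ux zB; rewrite (horner_coef_wide _ (sp' x)); apply: le_trans (ler_norm_sum _ _ _) _.
  apply: ler_sum => i _; rewrite normrM normrX; apply: ler_pM => //.
    set c := (p x)^`()`_i; have := sqr_ge0 (`|c| - 1); rewrite sqrrB real_normK ?num_real //.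
    have := normr_ge0 c; rewrite mulr1 expr1n; have := sqr_ge0 c; nra.
  by apply: lerXn2r; rewrite ?nnegrE // ?ler_norml // ltW // B0.
have K0 x : U x -> 0 <= K x.
  by move=> Ux; apply: le_trans (hK x 0 Ux _) => //; rewrite oppr_le0 andbb; exact/ltW/B0.
(* [k] and [eta] are made for [2 * eta * B + k + k * K <= e], which the estimates on both sides of
   the root require, and [tau] for [tau * (2 * B) * K <= k ^+ 2]. The tolerance [e'] for the
   derivative is below both [eta] and [tau] and, unlike their minimum, it is Nash. *)
pose k x := e x / (4 * (K x + 1)).
pose eta x := e x / (4 * (B x + 1)).
pose tau x := k x ^+ 2 / (2 * (B x + 1) * (K x + 1)).
pose e' x := eta x * tau x / (eta x + tau x).
have K1 x : U x -> 0 < K x + 1 by move=> /K0; lra.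
have B1 x : U x -> 0 < B x + 1 by move=> /B0; lra.
have k0 x : U x -> 0 < k x by move=> Ux; rewrite divr_gt0 ?mulr_gt0 ?K1 // e0.
have eta0 x : U x -> 0 < eta x by move=> Ux; rewrite divr_gt0 ?mulr_gt0 ?B1 // e0.
have tau0 x : U x -> 0 < tau x.
  by move=> Ux; apply: divr_gt0; [apply: exprn_gt0; exact: k0|rewrite mulr_gt0 ?K1 // mulr_gt0 ?B1].
have et0 x : U x -> 0 < eta x + tau x by move=> Ux; rewrite addr_gt0 ?eta0 ?tau0.
have e'0 x : U x -> 0 < e' x.
  by move=> Ux; apply: divr_gt0; [apply: mulr_gt0; [exact: eta0|exact: tau0]|exact: et0].
have e'eta x : U x -> e' x <= eta x.
  move=> Ux; have ha := eta0 x Ux; have hb := tau0 x Ux; have hab := et0 x Ux.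
  by rewrite /e' ler_pdivrMr //; move: (eta x) (tau x) ha hb => a b; nra.
have e'tau x : U x -> e' x <= tau x.
  move=> Ux; have ha := eta0 x Ux; have hb := tau0 x Ux; have hab := et0 x Ux.
  by rewrite /e' ler_pdivrMr //; move: (eta x) (tau x) ha hb => a b; nra.
have nk : nash U k.
  apply: nash_mul => //; apply: nash_inv.
    by move=> x Ux; rewrite gt_eqF // mulr_gt0 // K1.
  by apply: nash_mul => //; exact: nash_add.
have neta : nash U eta.
  apply: nash_mul => //; apply: nash_inv.
    by move=> x Ux; rewrite gt_eqF // mulr_gt0 // B1.
  by apply: nash_mul => //; exact: nash_add.
have ntau : nash U tau.
  apply: nash_mul; first exact: nash_exp.
  apply: nash_inv; first by move=> x Ux; rewrite gt_eqF // !mulr_gt0 ?K1 ?B1.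
  by apply: nash_mul; [apply: nash_mul => //|]; exact: nash_add.
have ne' : nash U e'.
  apply: nash_mul; first exact: nash_mul.
  by apply: nash_inv; [move=> x Ux; rewrite gt_eqF // et0|exact: nash_add].
have [|r' [nr' hr']] := IH (fun x => (p x)^`()) e' np' sp' _ nB ne' B0 e'0.
  by move=> x Ux; rewrite coef_deriv mulrn_wge0 // lc.
have mono' x i j : U x -> (i <= j)%N -> (j <= d.+1)%N -> r' i x <= r' j x.
  move=> Ux; have [_ _ h _] := hr' x Ux.
  elim: j => [|j IHj]; first by rewrite leqn0 => /eqP ->.
  rewrite leq_eqVlt => /orP[/eqP->//|ij] jd; apply: le_trans (ltW (h j _)) => //.
  by apply: IHj => //; exact: ltnW.
have rB x i : U x -> (i <= d.+1)%N -> - B x <= r' i x <= B x.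
  move=> Ux id; have [h1 h2 _ _] := hr' x Ux.
  by rewrite -h1 -{1}h2 !mono'.
have /choice[zeta hz] : forall i, exists zeta, nash U zeta /\ ((i <= d)%N -> forall x, U x ->
    r' i x < zeta x < r' i.+1 x /\ barrier (p x) ((-1) ^+ (d - i)) (r' i x) (r' i.+1 x) (eta x)
      (k x ^+ 2) (zeta x) = 0).
  move=> i; have [id|id] := leqP i d; last by exists (fun _ => 0).
  have [|zeta [nz hz]] := @nash_barrier_root m U p d.+2 ((-1) ^+ (d - i)) (r' i) (r' i.+1) eta
     (fun x => k x ^+ 2) oU dU np sp (normr_sign _ _) (nr' _) (nr' _) neta (nash_exp 2 nk).
    move=> x Ux; have [_ _ h1 h2] := hr' x Ux; split; [exact: h1|exact: eta0| |].
      by rewrite exprn_gt0 // k0.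
    exists (tau x), (K x); split; first exact: tau0.
    - move=> z /andP[z1 z2]; apply: le_trans (h2 i z id _); first by rewrite lerN2 e'eta.
      by have := e'tau x Ux; move=> h; apply/andP; split; lra.
    - move=> z /andP[z1 z2]; apply: hK => //.
      have /andP[b1 _] := rB x i Ux (leqW id); have /andP[_ b2] := rB x i.+1 Ux id.
      by rewrite (le_trans b1) // (le_trans z2).
    - have /andP[b1 _] := rB x i Ux (leqW id); have /andP[_ b2] := rB x i.+1 Ux id.
      have K1' := K1 x Ux; have B1' := B1 x Ux; have K0' := K0 x Ux; have t0 := tau0 x Ux.
      have D0 : 0 < 2 * (B x + 1) * (K x + 1) by rewrite !mulr_gt0.
      have -> : k x ^+ 2 = tau x * (2 * (B x + 1) * (K x + 1)).
        by rewrite /tau divfK // gt_eqF.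
      apply: mul_bound => //; last by lra.
      by have [_ _ h _] := hr' x Ux; rewrite subr_ge0 ltW // h.
  by exists zeta; split=> // _.
(* The root in interval [j] of the derivative receives the index [j.+1]; the bounds [- B] and [B]
   complete the list at both ends. *)
pose r i := if i is j.+1 then if (j <= d)%N then zeta j else B else fun x => - B x.
exists r; split.
  case=> [|j] /=; first exact: nash_opp.
  by case: ifP => // _; exact: (hz j).1.
move=> x Ux; have [r'0 r'd h1 h2] := hr' x Ux.
have zb j : (j <= d)%N -> r' j x < zeta j x < r' j.+1 x.
  by move=> jd; have [] := (hz j).2 jd x Ux.
have rl i : (i <= d.+1)%N -> r i x <= r' i x.
  case: i => [|j] jd /=; first by rewrite r'0.
  by rewrite ltnS in jd; rewrite jd; have /andP[_ /ltW] := zb j jd.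
have rr i : (i <= d.+1)%N -> r' i x <= r i.+1 x.
  move=> jd /=; rewrite leq_eqVlt ltnS in jd; case/orP: jd => [/eqP->|jd].
    by rewrite ltnn r'd.
  by rewrite jd; have /andP[/ltW] := zb i jd.
have est : 2 * eta x * B x + k x + k x * K x <= e x.
  have E1 : eta x * (4 * (B x + 1)) = e x.
    by rewrite /eta divfK // gt_eqF // mulr_gt0 // B1.
  have E2 : k x * (4 * (K x + 1)) = e x.
    by rewrite /k divfK // gt_eqF // mulr_gt0 // K1.
  have := eta0 x Ux; have := k0 x Ux; have := B0 x Ux; have := K0 x Ux.
  by nra.
have ke : k x < e x.
  have E2 : k x * (4 * (K x + 1)) = e x.
    by rewrite /k divfK // gt_eqF // mulr_gt0 // K1.
  by have := k0 x Ux; have := K0 x Ux; nra.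
have tauK j : (j <= d)%N -> tau x * (r' j.+1 x - r' j x) * K x <= k x ^+ 2.
  move=> jd.
  have /andP[b1 _] := rB x j Ux (leqW jd); have /andP[_ b2] := rB x j.+1 Ux jd.
  have K1' := K1 x Ux; have B1' := B1 x Ux; have K0' := K0 x Ux; have t0 := tau0 x Ux.
  have D0 : 0 < 2 * (B x + 1) * (K x + 1) by rewrite !mulr_gt0.
  have -> : k x ^+ 2 = tau x * (2 * (B x + 1) * (K x + 1)).
    by rewrite /tau divfK // gt_eqF.
  apply: mul_bound => //; last by lra.
  by rewrite subr_ge0 ltW // h1.
have pm j : (j <= d)%N -> forall z, r' j x + tau x <= z <= r' j.+1 x - tau x ->
    - eta x <= (-1) ^+ (d - j) * (p x)^`().[z].
  move=> jd z /andP[z1 z2]; apply: le_trans (h2 j z jd _); first by rewrite lerN2 e'eta.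
  by have := e'tau x Ux; move=> h; apply/andP; split; lra.
have pk j : (j <= d)%N -> forall z, r' j x <= z <= r' j.+1 x -> `|(p x)^`().[z]| <= K x.
  move=> jd z /andP[z1 z2]; apply: hK => //.
  have /andP[b1 _] := rB x j Ux (leqW jd); have /andP[_ b2] := rB x j.+1 Ux jd.
  by rewrite (le_trans b1) // (le_trans z2).
split=> //=; first by rewrite ltnn.
- move=> i id; have /andP[a1 a2] : (r i x <= r' i x) && (r' i x <= r i.+1 x).
    by rewrite rl // rr.
  have B0' := B0 x Ux.
  case: i id a1 a2 => [|j] jd a1 a2.
    by have /andP[+ _] := zb 0%N isT; rewrite r'0.
  rewrite ltnS in jd; apply: lt_le_trans a2; rewrite /= jd.
  by have /andP[] := zb j jd.
move=> i z id /andP[z1 z2].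
(* The point [r' i x] lies between [r i x] and [r i.+1 x]. Below it, [z] is to the right of the root
   [r i x] of one barrier function; above it, [z] is to the left of the root [r i.+1 x] of the
   next. *)
have [zi|zi] := leP z (r' i x).
  case: i id z1 z2 zi => [|j] jd z1 z2 zi.
    by have := e0 x Ux; move: z1; rewrite /= r'0 in zi *; lra.
  rewrite ltnS in jd; rewrite subSS.
  have [/andP[q1 q2] q3] := (hz j).2 jd x Ux.
  move: z1; rewrite /= jd => z1.
  have /andP[b1 _] := rB x j Ux (leqW jd); have /andP[_ b2] := rB x j.+1 Ux jd.
  exact: (barrier_right (h1 j jd) (eta0 x Ux) (exprn_gt0 2 (k0 x Ux)) (tau0 x Ux) (normr_sign _ _)
    (pm j jd) (pk j jd) (tauK j jd) (k0 x Ux) erefl ke est q1 q2 q3 b1 b2 z1 zi).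
have id' : (i <= d)%N.
  move: id; rewrite leq_eqVlt => /orP[/eqP E|]; last by rewrite ltnS.
  by move: z2 zi; rewrite E /= ltnn r'd; have := e0 x Ux; lra.
rewrite signr_step //.
have [/andP[q1 q2] q3] := (hz i).2 id' x Ux.
move: z2; rewrite /= id' => z2.
have /andP[b1 _] := rB x i Ux (leqW id'); have /andP[_ b2] := rB x i.+1 Ux id'.
exact: (barrier_left (h1 i id') (eta0 x Ux) (exprn_gt0 2 (k0 x Ux)) (tau0 x Ux) (normr_sign _ _)
  (pm i id') (pk i id') (tauK i id') (k0 x Ux) erefl ke est q1 q2 q3 b1 b2 (ltW zi) z2).
Qed.

End RootSeparation.

(** * Finitely many Nash functions close to all roots *)

Section RootCover.
Variable R : realType.

Lemma poly_mono_ge (p : {poly R}) a b be : a < b ->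
  (forall z, a <= z <= b -> be <= p^`().[z]) -> be * (b - a) <= p.[b] - p.[a].
Proof.
move=> ab h; have [c] := polyrcf.poly_mvt p ab.
rewrite in_itv /= => /andP[c1 c2] ->; rewrite ler_pM2r ?subr_gt0 //.
by apply: h; rewrite !ltW.
Qed.

(* If no derivative of [p] changes sign near [y], then [p] is not small near
   [y]: going up from the constant derivative of order [d], each step keeps a
   lower bound on half of the interval. *)
Lemma poly_rigid d : exists2 c : R, 0 < c <= 1 & forall (p : {poly R}) y al t e (s : nat -> R),
  (size p <= d.+1)%N -> al <= p`_d -> 0 < al -> 0 < t <= 1 -> e <= c * al * t ^+ d ->
  (forall j, s j = 1 \/ s j = -1) ->
  (forall j z, (j <= d)%N -> `|z - y| <= t -> - e <= s j * (p^`(j)).[z]) ->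
  exists2 sg, sg = 1 \/ sg = -1 &
    forall z, `|z - y| <= c * t -> c * al * t ^+ d <= sg * p.[z].
Proof.
elim: d => [|d [c /andP[c0 c1] IH]].
  exists 1; rewrite ?ltr01 ?lexx // => p y al t e s sp pd al0 _ _ _ _.
  exists 1; first by left.
  by move=> z _; rewrite [p]size1_polyC // hornerC expr0 !mul1r mulr1.
(* Over a length of [c * t / 2] the bound [be] on the derivative yields a growth of
   [be * (c * t) / 2]. Half of it pays for the defect [e], the other half is the new lower bound. *)
exists (c ^+ 2 / 4) => [|p y al t e s sp pd al0 /andP[t0 t1] he hs hp].
  by rewrite divr_gt0 ?exprn_gt0 //= ler_pdivrMr // expr2; nra.
have td0 : 0 < t ^+ d by rewrite exprn_gt0.
have b0 : 0 < c * al * t ^+ d by rewrite !mulr_gt0.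
have be0 : c ^+ 2 / 4 * al * t ^+ d.+1 = c * al * t ^+ d * (c * t) / 4.
  by rewrite [t ^+ d.+1]exprS; ring.
rewrite be0 in he *; set be := c * al * t ^+ d in b0 he *.
have ct0 : 0 < c * t by rewrite mulr_gt0.
have ct1 : c * t <= 1 by nra.
have bct : be * (c * t) <= be by rewrite ler_piMr // ltW.
have [|||||||sg sg1 hsg] := IH p^`() y al t e (fun j => s j.+1).
- have [->|h] := eqVneq p 0; first by rewrite deriv0 size_poly0.
  by rewrite -ltnS; apply: leq_trans (lt_size_deriv h) sp.
- rewrite coef_deriv; apply: (le_trans pd); rewrite mulrS lerDl mulrn_wge0 //.
  by apply: le_trans pd; exact: ltW.
- exact: al0.
- by rewrite t0 t1.
- by have w : 0 < be * (c * t) := mulr_gt0 b0 ct0; rewrite -/be; lra.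
- by move=> j; exact: hs.
- by move=> j z jd zt; have := hp j.+1 z jd zt; rewrite derivSn.
have e4 : c ^+ 2 / 4 * t <= c * t / 2.
  have : c * (c * t) <= 1 * (c * t) by rewrite ler_wpM2r // ltW.
  by rewrite expr2; nra.
have h0 z : `|z - y| <= c * t -> - e <= s 0%N * p.[z].
  move=> zy; apply: (hp 0%N) => //; apply: le_trans zy _.
  by rewrite ler_piMl // ltW.
have inI w : - (c * t) <= w - y -> w - y <= c * t -> `|w - y| <= c * t.
  by move=> h1 h2; rewrite ler_norml h1.
have inc a b : a < b -> - (c * t) <= a - y -> b - y <= c * t ->
    be * (b - a) <= sg * p.[b] - sg * p.[a].
  move=> ab ha hb; rewrite -!hornerZ; apply: poly_mono_ge => // w /andP[w1 w2].
  by rewrite derivZ hornerZ; apply: hsg; apply: inI; lra.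
have [E|E] : s 0%N = sg \/ s 0%N = - sg.
  by case: (hs 0%N) sg1 => -> [->|->]; rewrite ?opprK; auto.
- exists sg => // z hz; have {}hz : `|z - y| <= c * t / 2 by exact: le_trans hz e4.
  move: hz; rewrite ler_norml => /andP[z1 z2].
  have := inc (y - c * t) z ltac:(lra) ltac:(lra) ltac:(lra).
  have := h0 (y - c * t) ltac:(apply: inI; lra); rewrite E => h1 h2.
  have : be * (c * t / 2) <= be * (z - (y - c * t)) by rewrite ler_pM2l //; lra.
  by lra.
- exists (- sg); first by case: sg1 => ->; rewrite ?opprK; auto.
  move=> z hz; have {}hz : `|z - y| <= c * t / 2 by exact: le_trans hz e4.
  move: hz; rewrite ler_norml => /andP[z1 z2].
  have := inc z (y + c * t) ltac:(lra) ltac:(lra) ltac:(lra).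
  have := h0 (y + c * t) ltac:(apply: inI; lra); rewrite E mulNr => h1 h2.
  have : be * (c * t / 2) <= be * (y + c * t - z) by rewrite ler_pM2l //; lra.
  by lra.
Qed.

Lemma find_interval (r : nat -> R) n y : r 0%N <= y -> y <= r n.+1 ->
  exists2 i, (i <= n)%N & r i <= y <= r i.+1.
Proof.
elim: n => [|n IH] h0 h1; first by exists 0%N; rewrite // h0.
have [h|h] := leP y (r n.+1); last by exists n.+1; rewrite // h1 ltW.
by have [i hi hr] := IH h0 h; exists i; rewrite // (leq_trans hi).
Qed.

Lemma nash_derivn m (U : set 'rV[R]_m) p j : nash_poly U p -> nash_poly U (fun x => (p x)^`(j)).
Proof.
move=> np; elim: j => [|j IH]; first by [].
by move: (nash_poly_deriv IH) => h i; apply: nash_fext (h i) => x; rewrite derivnS.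
Qed.

Lemma size_derivn_le (p : {poly R}) d j : (size p <= d.+1)%N -> (j <= d)%N ->
  (size p^`(j) <= (d - j).+1)%N.
Proof.
move=> sp jd; apply/leq_sizeP => i hi; rewrite coef_derivn nth_default ?mul0rn //.
apply: leq_trans sp _; have -> : d.+1 = (j + (d - j).+1)%N by rewrite addnS subnKC.
by rewrite leq_add2l.
Qed.

(** The candidates are the separating functions of all derivatives of [p], including [p] itself.
    Near a root farther than [T x ^- K] from all of them, no derivative changes sign up to the
    tolerance [T x ^- E]; then [poly_rigid] would make [p] nonzero at the root. *)
Lemma nash_root_cover m (U : set 'rV[R]_m) (T : 'rV[R]_m -> R) d (p : 'rV[R]_m -> {poly R})
    (M N K : nat) :
  popen U -> dP U -> nash U T -> (forall x, U x -> 2 <= T x) ->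
  nash_poly U p -> (forall x, (size (p x) <= d.+1)%N) -> (forall x, U x -> 0 <= (p x)`_d) ->
  exists (I : finType) (rho : I -> 'rV[R]_m -> R), (forall i, nash U (rho i)) /\
    forall x y, U x -> T x ^- N <= (p x)`_d -> `|y| <= T x ^+ M -> (p x).[y] = 0 ->
      exists i, `|rho i x - y| <= T x ^- K.
Proof.
move=> oU dU nT T2 np sp lc.
have [c /andP[c0 c1] hc] := poly_rigid d.
have [C hC] : exists C : nat, c^-1 <= 2 ^+ C.
  exists (Num.bound c^-1); apply: le_trans (ltW (archi_boundP _)) _.
    by rewrite invr_ge0 ltW.
  by rewrite -natrX ler_nat ltnW // ltn_expl.
(* The summands absorb, in this order, the constant [c], the lower bound of the leading coefficient,
   the factor [(t / 2) ^+ d], and the requirement [T x ^- E <= t / 2], where [t = T x ^- K]. *)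
pose E := (C + N + K.+1 * d + K.+1)%N.
have T0 x : U x -> 0 < T x by move=> /T2; lra.
have nB : nash U (fun x => T x ^+ M.+1) by exact: nash_exp.
have ne : nash U (fun x => T x ^- E).
  apply: nash_inv; last exact: nash_exp.
  by move=> x /T0 Tx; rewrite gt_eqF // exprn_gt0.
have /choice[r hr] : forall j : 'I_d.+1, exists r : nat -> 'rV[R]_m -> R, (forall i, nash U (r i)) /\
    forall x, U x ->
    [/\ r 0%N x = - T x ^+ M.+1, r (d - j).+1 x = T x ^+ M.+1,
      forall i, (i <= d - j)%N -> r i x < r i.+1 x &
      forall i z, (i <= d - j)%N -> r i x + T x ^- E <= z <= r i.+1 x - T x ^- E ->
        - T x ^- E <= (-1) ^+ (d - j - i) * (p x)^`(j).[z]].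
  move=> j; have jd : (j <= d)%N by rewrite -ltnS.
  apply: nash_separation => //.
  - exact: nash_derivn.
  - by move=> x; exact: size_derivn_le.
  - by move=> x Ux; rewrite coef_derivn subnKC // mulrn_wge0 // lc.
  - by move=> x /T0 Tx; rewrite exprn_gt0.
  - by move=> x /T0 Tx; rewrite invr_gt0 exprn_gt0.
exists ('I_d.+1 * 'I_d.+2)%type, (fun ij : 'I_d.+1 * 'I_d.+2 => r ij.1 ij.2); split.
  by move=> [i j]; exact: (hr i).1.
move=> x y Ux hN hy py.
apply: contrapT => nex.
have Tx := T2 x Ux; have Tx0 := T0 x Ux; have Tx1 : 1 <= T x by lra.
pose t := T x ^- K.
have t0 : 0 < t by rewrite invr_gt0 exprn_gt0.
have far (j : 'I_d.+1) i : (i <= (d - j).+1)%N -> t < `|r j i x - y|.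
  move=> id; rewrite ltNge; apply/negP => h; apply: nex.
  have id' : (i < d.+2)%N by rewrite ltnS (leq_trans id) // ltnS leq_subr.
  by exists (j, Ordinal id').
have tE : T x ^- E <= t / 2.
  rewrite /t -invfM lef_pV2 ?posrE ?mulr_gt0 ?exprn_gt0 //.
  apply: (@le_trans _ _ (T x ^+ K.+1)); first by rewrite exprSr ler_wpM2l // exprn_ge0 // ltW.
  by apply: ler_weXn2l => //; rewrite /E leq_addl.
have t21 : 0 < t / 2 <= 1.
  rewrite divr_gt0 //= ler_pdivrMr // mul1r; apply: (@le_trans _ _ 1); last by lra.
  by rewrite /t invf_le1 ?exprn_gt0 // exprn_ege1.
have yB : - T x ^+ M.+1 <= y <= T x ^+ M.+1.
  rewrite -ler_norml; apply: le_trans hy _; exact: ler_weXn2l.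
have sgn (j : 'I_d.+1) : exists s, (s = 1 \/ s = -1) /\ forall z, `|z - y| <= t / 2 ->
    - T x ^- E <= s * (p x)^`(j).[z].
  have [h1 h2 h3 h4] := (hr j).2 x Ux.
  have [||i id /andP[ri1 ri2]] := @find_interval (fun i => r j i x) (d - j) y.
  - by rewrite h1; case/andP: yB.
  - by rewrite h2; case/andP: yB.
  exists ((-1) ^+ (d - j - i)); split.
    by rewrite -signr_odd; case: odd; [right|left].
  move=> z hz; apply: h4 => //.
  have f1 := far j i (leqW id); have f2 := far j i.+1 id.
  rewrite distrC ger0_norm ?subr_ge0 // in f1; rewrite ger0_norm ?subr_ge0 // in f2.
  by move: hz; rewrite ler_norml => /andP[z1 z2]; apply/andP; split; lra.
have /choice[s hs] : forall j : nat, exists s, (s = 1 \/ s = -1) /\ ((j <= d)%N ->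
   forall z, `|z - y| <= t / 2 -> - T x ^- E <= s * (p x)^`(j).[z]).
  move=> j; have [jd|jd] := leqP j d; last by exists 1; split; [left|].
  by have [s [s1 s2]] := sgn (Ordinal (jd : (j < d.+1)%N)); exists s; split.
have al0 : 0 < T x ^- N by rewrite invr_gt0 exprn_gt0.
have [|||sg sg1 hsg] := hc (p x) y (T x ^- N) (t / 2) (T x ^- E) s (sp x) hN al0 t21.
- have -> : c * T x ^- N * (t / 2) ^+ d = (c^-1 * T x ^+ N * (T x ^+ K * 2) ^+ d)^-1.
    by rewrite /t -invfM exprVn !invfM invrK.
  rewrite lef_pV2 ?posrE; last 2 first.
  - by rewrite exprn_gt0.
  - by rewrite !mulr_gt0 ?invr_gt0 ?exprn_gt0 // mulr_gt0 // exprn_gt0.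
  rewrite /E -addnA exprD; apply: ler_pM.
  - by rewrite mulr_ge0 ?invr_ge0 ?exprn_ge0 // ltW.
  - by rewrite exprn_ge0 // mulr_ge0 // exprn_ge0 // ltW.
  - rewrite exprD ler_wpM2r ?exprn_ge0 ?(ltW Tx0) //; apply: le_trans hC _.
    by apply: lerXn2r; rewrite ?nnegrE ?(ltW Tx0).
  - apply: (@le_trans _ _ (T x ^+ (K.+1 * d))).
      rewrite exprM; apply: lerXn2r; rewrite ?nnegrE ?mulr_ge0 ?exprn_ge0 ?(ltW Tx0) //.
      by rewrite exprSr ler_wpM2l // exprn_ge0 // ltW.
    by apply: ler_weXn2l => //; exact: leq_addr.
- by move=> j; exact: (hs j).1.
- by move=> j z jd zt; exact: (hs j).2.
have := hsg y; rewrite subrr normr0 py mulr0 => h.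
have [t20 t2l] := andP t21.
have : c * T x ^- N * (t / 2) ^+ d <= 0 by apply: h; rewrite mulr_ge0 // ltW.
by rewrite leNgt mulr_gt0 ?exprn_gt0 // mulr_gt0.
Qed.

End RootCover.

(** * Nash selections *)

Section Approximable.
Variable R : realType.
Variables (m : nat) (S : 'rV[R]_m -> Prop) (T : 'rV[R]_m -> R) (U : set 'rV[R]_m).
Hypotheses (oU : popen U) (dU : dP U) (SU : S `<=` U) (nT : nash U T) (eST : exhaustion S T).

Definition wcont (f : 'rV[R]_m -> R) := forall x, S x -> forall e, 0 < e ->
  exists2 d, 0 < d & forall h, `|h| < d -> S (x + h) -> `|f (x + h) - f x| < e.

Definition nash_near (g : 'rV[R]_m -> R) :=
  exists V : set 'rV[R]_m, [/\ popen V, dP V, S `<=` V & nash V g].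

(** Approximation to every order in [T], by Nash functions whose domains may depend on the order.
    The class contains the positive parts of its members, hence the weights needed for gluing. *)
Definition appr (f : 'rV[R]_m -> R) := [/\ dfun f, wcont f &
  forall N, exists2 g, nash_near g & forall x, S x -> `|f x - g x| <= T x ^- N].

Let T2 x : S x -> 2 <= T x. Proof. by case: eST => _ _ h _; exact: h. Qed.
Let T0 x : S x -> 0 < T x. Proof. by move=> /T2; lra. Qed.
Let TN0 x N : S x -> 0 < T x ^- N. Proof. by move=> /T0 h; rewrite invr_gt0 exprn_gt0. Qed.

Lemma TV_half x N : S x -> T x ^- N.+1 <= T x ^- N / 2.
Proof.
move=> Sx; rewrite exprSr invfM ler_pM2l ?TN0 //.
by rewrite lef_pV2 ?posrE ?T0 // T2.
Qed.

Lemma TV_le x M N : (M <= N)%N -> S x -> T x ^- N <= T x ^- M.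
Proof.
move=> MN Sx; rewrite lef_pV2 ?posrE ?exprn_gt0 ?T0 //; apply: ler_weXn2l => //.
by have := T2 Sx; lra.
Qed.

Lemma nash_near_U g : nash U g -> nash_near g.
Proof. by exists U. Qed.

Lemma nash_nearT g : nash setT g -> nash_near g.
Proof. by exists setT; split => //; [exact: popenT|exact: dP_cst]. Qed.

Lemma nash_near2 f g : nash_near f -> nash_near g ->
  exists V : set 'rV[R]_m, [/\ popen V, dP V, S `<=` V & nash V f /\ nash V g].
Proof.
move=> [V [oV dV SV [sf df]]] [W [oW dW SW [sg dg]]]; exists (V `&` W); split.
- exact: popenI.
- exact: dP_and.
- by move=> x Sx; split; [exact: SV|exact: SW].
- by split; split=> // k; [apply: Dk_sub (sf k)|apply: Dk_sub (sg k)] => x [].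
Qed.

Lemma nash_near_V N : nash_near (fun x => T x ^- N).
Proof.
exists (fun x => U x /\ 0 < T x); split.
- by apply: popen_gt0 => // x Ux; exact: smooth_pcont nT.1 Ux.
- have dT := nT.2; apply: dP_and => //; apply: dP_lt => //; exact: dfun_cst.
- by move=> x Sx; split; [exact: SU|exact: T0].
apply: nash_inv; first by move=> x [_ h]; rewrite gt_eqF // exprn_gt0.
apply: nash_exp; case: nT => sT dT; split=> // k.
by apply: Dk_sub (sT k) => x [].
Qed.

Lemma nash_near_wcont g : nash_near g -> wcont g.
Proof.
move=> [V [oV _ SV [sg _]]] x Sx e e0.
have [d d0 hd] := smooth_pcont sg (SV x Sx) e0.
by exists d => // h /hd.
Qed.

Lemma nash_near_appr g : nash_near g -> appr g.
Proof.
move=> ng; split; last by move=> N; exists g => // x Sx; rewrite subrr normr0 ltW // TN0.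
  by case: ng => V [_ _ _ []].
exact: nash_near_wcont.
Qed.

Lemma wcont_bounded f : dfun f -> wcont f ->
  exists N, forall M x, (N <= M)%N -> S x -> `|f x| <= T x ^+ M.
Proof.
move=> df cf; apply: lojasiewicz_ub => // x Sx.
have [d d0 hd] := cf x Sx 1 ltr01.
have D0 : 0 < `|f x| + 1 by rewrite ltr_wpDl.
exists (Num.min d (`|f x| + 1)^-1) => [|h]; first by rewrite lt_min d0 invr_gt0.
rewrite lt_min => /andP[hh _] Sh.
have H : `|f (x + h)| <= `|f x| + 1.
  rewrite -[f (x + h)](subrK (f x)); apply: le_trans (ler_normD _ _) _.
  by rewrite addrC lerD2l ltW // hd.
apply: le_trans H _; rewrite -[leLHS]invrK lef_pV2 ?posrE ?lt_min ?d0 ?invr_gt0 //.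
by rewrite ge_min lexx orbT.
Qed.

Lemma wcont_lb f : dfun f -> wcont f -> (forall x, S x -> 0 < f x) ->
  exists N, forall M x, (N <= M)%N -> S x -> T x ^- M <= f x.
Proof.
move=> df cf f0; apply: lojasiewicz_lb => // x Sx.
have f20 : 0 < f x / 2 by rewrite divr_gt0 // f0.
have [d d0 hd] := cf x Sx _ f20.
exists (Num.min d (f x / 2)) => [|h]; first by rewrite lt_min d0.
rewrite lt_min => /andP[hh _] Sh; rewrite ge_min; apply/orP; right.
by have := hd h hh Sh; rewrite ltr_norml => /andP[]; lra.
Qed.

Lemma appr_add f g : appr f -> appr g -> appr (fun x => f x + g x).
Proof.
move=> [df cf af] [dg cg ag]; split; first by dtac.
  move=> x Sx e e0; have e20 : 0 < e / 2 by rewrite divr_gt0.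
  have [d1 d10 h1] := cf x Sx _ e20; have [d2 d20 h2] := cg x Sx _ e20.
  exists (Num.min d1 d2) => [|h]; first by rewrite lt_min d10.
  rewrite lt_min => /andP[hh1 hh2] Sh.
  have -> : f (x + h) + g (x + h) - (f x + g x) = (f (x + h) - f x) + (g (x + h) - g x) by ring.
  apply: le_lt_trans (ler_normD _ _) _; rewrite [e]splitr ltrD //; [exact: h1|exact: h2].
move=> N; have [f' nf' hf'] := af N.+1; have [g' ng' hg'] := ag N.+1.
exists (fun x => f' x + g' x).
  have [V [oV dV SV [nf ng]]] := nash_near2 nf' ng'.
  by exists V; split=> //; exact: nash_add.
move=> x Sx; have -> : f x + g x - (f' x + g' x) = (f x - f' x) + (g x - g' x) by ring.
apply: le_trans (ler_normD _ _) _; have := TV_half N Sx; have := hf' x Sx; have := hg' x Sx.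
by lra.
Qed.

Lemma appr_mul f g : appr f -> appr g -> appr (fun x => f x * g x).
Proof.
move=> [df cf af] [dg cg ag]; split; first by dtac.
  move=> x Sx e e0.
  pose C := `|f x| + `|g x| + 1.
  have nf := normr_ge0 (f x); have ng := normr_ge0 (g x).
  have C0 : 0 < C by rewrite /C; lra.
  pose e1 := Num.min 1 (e / (2 * C)).
  have e10 : 0 < e1 by rewrite lt_min ltr01 divr_gt0 // mulr_gt0.
  have [d1 d10 h1] := cf x Sx _ e10; have [d2 d20 h2] := cg x Sx _ e10.
  exists (Num.min d1 d2) => [|h]; first by rewrite lt_min d10.
  rewrite lt_min => /andP[hh1 hh2] Sh.
  have -> : f (x + h) * g (x + h) - f x * g x =
     (f (x + h) - f x) * (g (x + h) - g x) + (f x * (g (x + h) - g x) + g x * (f (x + h) - f x)).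
    by ring.
  have {h1}h1 := h1 h hh1 Sh; have {h2}h2 := h2 h hh2 Sh.
  apply: le_lt_trans (ler_normD _ _) _; rewrite normrM.
  apply: (@le_lt_trans _ _ (e1 * C)).
    have h3 : `|f (x + h) - f x| * `|g (x + h) - g x| <= e1 * 1.
      by apply: ler_pM => //; apply: ltW => //; apply: lt_le_trans h2 _; rewrite ge_min lexx.
    have h4 : `|f x * (g (x + h) - g x) + g x * (f (x + h) - f x)| <= `|f x| * e1 + `|g x| * e1.
      apply: le_trans (ler_normD _ _) _; rewrite !normrM.
      by apply: lerD; apply: ler_wpM2l => //; exact: ltW.
    by rewrite /C; lra.
  apply: (@le_lt_trans _ _ (e / (2 * C) * C)).
    by apply: ler_wpM2r; [exact: ltW|rewrite /e1 ge_min lexx orbT].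
  rewrite invfM mulrA divfK ?gt_eqF //; lra.
have [M1 hM1] := wcont_bounded df cf; have [M2 hM2] := wcont_bounded dg cg.
move=> N; pose M := maxn M1 M2; pose K := (N.+2 + M)%N.
have [f' nf' hf'] := af K; have [g' ng' hg'] := ag K.
exists (fun x => f' x * g' x).
  have [V [oV dV SV [nf ng]]] := nash_near2 nf' ng'.
  by exists V; split=> //; exact: nash_mul.
move=> x Sx.
have -> : f x * g x - f' x * g' x = f x * (g x - g' x) + g x * (f x - f' x) - (f x - f' x) * (g x - g' x).
  by ring.
have t2 := T2 Sx; have t0 := T0 Sx; have q1 := hf' x Sx; have q2 := hg' x Sx.
have b1 : `|f x| <= T x ^+ M by apply: hM1 => //; exact: leq_maxl.
have b2 : `|g x| <= T x ^+ M by apply: hM2 => //; exact: leq_maxr.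
have KE : T x ^+ M * T x ^- K = T x ^- N.+2.
  by rewrite /K exprD invfM mulrCA divff ?mulr1 // gt_eqF // exprn_gt0.
have p1 : `|f x * (g x - g' x)| <= T x ^- N.+2.
  by rewrite normrM -KE; apply: ler_pM.
have p2 : `|g x * (f x - f' x)| <= T x ^- N.+2.
  by rewrite normrM -KE; apply: ler_pM.
have p3 : `|(f x - f' x) * (g x - g' x)| <= T x ^- N.+2.
  rewrite normrM -KE; apply: ler_pM => //; apply: le_trans q1 _.
  apply: (@le_trans _ _ 1); first by rewrite invf_le1 ?exprn_gt0 // exprn_ege1 //; lra.
  by rewrite exprn_ege1 //; lra.
apply: le_trans (ler_normB _ _) _; apply: le_trans (lerD (ler_normD _ _) (lexx _)) _.
have := TV_half N Sx; have := TV_half N.+1 Sx.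
have : 0 < T x ^- N.+2 by exact: TN0.
by lra.
Qed.

(** [sp (f x) 0] is the positive part. Replacing the 0 by [T x ^- N.+1] makes the square root smooth
    and costs half of that amount. *)
Lemma appr_sp0 f : appr f -> appr (fun x => sp (f x) 0).
Proof.
have lip (a b : R) : `|sp a 0 - sp b 0| <= `|a - b|.
  rewrite !sp0; have [h1|h1] := leP a 0; have [h2|h2] := leP b 0.
  - by rewrite subrr normr0.
  - by rewrite sub0r normrN gtr0_norm // distrC ger0_norm; lra.
  - by rewrite subr0 gtr0_norm // ger0_norm; lra.
  - by [].
move=> [df cf af]; split.
- by rewrite /sp; dtac.
- move=> x Sx e e0; have [d d0 hd] := cf x Sx e e0; exists d => // h hh Sh.
  by apply: le_lt_trans (lip _ _) _; exact: hd.
move=> N; have [g ng hg] := af N.+1.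
have [V [oV dV SV [[sg dg] [sV dVf]]]] := nash_near2 ng (nash_near_V N.+1).
pose V' (x : 'rV[R]_m) := V x /\ 0 < T x ^- N.+1.
have oV' : popen V' by apply: popen_gt0 => // x Vx; exact: smooth_pcont sV Vx.
exists (fun x => sp (g x) (T x ^- N.+1)).
  exists V'; split=> //.
  - by apply: dP_and => //; apply: dP_lt => //; exact: dfun_cst.
  - by move=> x Sx; split; [exact: SV|exact: TN0].
  have sg' : smooth V' g by move=> k; apply: Dk_sub (sg k) => x [].
  have sV' : smooth V' (fun x => T x ^- N.+1) by move=> k; apply: Dk_sub (sV k) => x [].
  split; last by rewrite /sp; dtac.
  move=> k; rewrite /sp; apply: Dk_mul; last exact: Dk_cst.
  apply: Dk_add; first exact: sg'.
  apply: Dk_sqrt => [x [_ h]|].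
    by rewrite ltr_wpDl ?sqr_ge0 // exprn_gt0.
  by apply: Dk_add; apply: Dk_exp; [exact: sg'|exact: sV'].
move=> x Sx; rewrite -[X in `|X|](subrKA (sp (g x) 0)); apply: le_trans (ler_normD _ _) _.
have := lip (f x) (g x); have := hg x Sx.
have slip := sp_lip (g x) 0 (T x ^- N.+1).
rewrite sub0r normrN (gtr0_norm (TN0 N.+1 Sx)) in slip.
have := TV_half N Sx; have := TN0 N.+1 Sx.
by lra.
Qed.

Lemma appr_inv f : appr f -> (forall x, S x -> 0 < f x) -> appr (fun x => (f x)^-1).
Proof.
move=> [df cf af] f0; have [L hL] := wcont_lb df cf f0; split; first by dtac.
- move=> x Sx e e0; have fx := f0 x Sx.
  pose e1 := Num.min (f x / 2) (e * f x ^+ 2 / 2).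
  have e10 : 0 < e1 by rewrite lt_min !divr_gt0 // mulr_gt0 // exprn_gt0.
  have [d d0 hd] := cf x Sx _ e10; exists d => // h hh Sh.
  have := hd h hh Sh; rewrite lt_min => /andP[a1 a2].
  have fh : f x / 2 < f (x + h) by move: a1; rewrite ltr_norml => /andP[]; lra.
  have fh0 : 0 < f (x + h) by lra.
  have -> : (f (x + h))^-1 - (f x)^-1 = - (f (x + h) - f x) / (f (x + h) * f x).
    by field; rewrite !gt_eqF.
  rewrite normrM normrN [`|_^-1|]gtr0_norm ?invr_gt0 ?mulr_gt0 // ltr_pdivrMr ?mulr_gt0 //.
  apply: lt_le_trans a2 _; rewrite -mulrA ler_pM2l //.
  by rewrite expr2 mulrAC ler_pM2r // ltW.
(* The difference of the inverses has [f * g] in its denominator, and both factors are at least of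
   order [T x ^- L]; the last unit pays for the factor one half in [gL]. *)
move=> N; pose K := (N + L + L).+1; have [g ng hg] := af K.
have gL x : S x -> T x ^- L / 2 <= g x.
  move=> Sx; have h1 := hL L x (leqnn _) Sx; have := hg x Sx.
  have h2 : T x ^- K <= T x ^- L / 2.
    apply: le_trans (TV_half L Sx); apply: TV_le => //.
    by rewrite /K ltnS leq_addl.
  by rewrite ler_norml => /andP[]; lra.
have g0 x : S x -> 0 < g x by move=> Sx; apply: lt_le_trans (gL x Sx); rewrite divr_gt0 // TN0.
exists (fun x => (g x)^-1).
  case: ng => V [oV dV SV [sg dg]]; exists (fun x => V x /\ 0 < g x); split.
  - by apply: popen_gt0 => // x Vx; exact: smooth_pcont sg Vx.
  - by apply: dP_and => //; apply: dP_lt => //; exact: dfun_cst.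
  - by move=> x Sx; split; [exact: SV|exact: g0].
  apply: nash_inv; first by move=> x [_ h]; rewrite gt_eqF.
  by split=> // k; apply: Dk_sub (sg k) => x [].
move=> x Sx; have fx := f0 x Sx; have gx := g0 x Sx; have t0 := T0 Sx.
have -> : (f x)^-1 - (g x)^-1 = - (f x - g x) / (f x * g x) by field; rewrite !gt_eqF.
rewrite normrM normrN [`|_^-1|]gtr0_norm ?invr_gt0 ?mulr_gt0 // ler_pdivrMr ?mulr_gt0 //.
apply: le_trans (hg x Sx) _.
apply: (@le_trans _ _ (T x ^- N * (T x ^- L * (T x ^- L / 2)))).
  apply: le_trans (TV_half _ Sx) _; rewrite !mulrA ler_pM2r ?invr_gt0 //.
  by rewrite !exprD !invfM.
apply: ler_wpM2l; first by rewrite ltW ?TN0.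
apply: ler_pM; rewrite ?divr_ge0 ?(ltW (TN0 L Sx)) //; last exact: gL.
exact: hL.
Qed.

Lemma appr_cst c : appr (fun _ => c).
Proof. by apply: nash_near_appr; apply: nash_nearT; exact: nash_cst. Qed.

Lemma appr_sum (I : Type) (r : seq I) (F : I -> 'rV[R]_m -> R) :
  (forall i, appr (F i)) -> appr (fun x => \sum_(i <- r) F i x).
Proof.
move=> hF; elim: r => [|i r IH].
  by rewrite (_ : (fun x => _) = (fun x => 0)); [exact: appr_cst|apply/funext => x; rewrite big_nil].
rewrite (_ : (fun x => _) = (fun x => F i x + \sum_(j <- r) F j x)); first exact: appr_add.
by apply/funext => x; rewrite big_cons.
Qed.

Lemma appr_prod (I : Type) (r : seq I) (F : I -> 'rV[R]_m -> R) :
  (forall i, appr (F i)) -> appr (fun x => \prod_(i <- r) F i x).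
Proof.
move=> hF; elim: r => [|i r IH].
  by rewrite (_ : (fun x => _) = (fun x => 1)); [exact: appr_cst|apply/funext => x; rewrite big_nil].
rewrite (_ : (fun x => _) = (fun x => F i x * \prod_(j <- r) F j x)); first exact: appr_mul.
by apply/funext => x; rewrite big_cons.
Qed.

Lemma polyfun_appr f : polyfun T f -> appr f.
Proof.
move=> pf; apply: nash_near_appr; apply: nash_near_U; case: nT => sT dT.
by split; [exact: polyfun_smooth sT pf|exact: polyfun_dfun dT pf].
Qed.

(** The finiteness theorem writes [W] as a finite union of basic open sets; the sum, over this
    union, of the products of positive parts of the defining functions is positive exactly there. *)
Lemma appr_bump (W : 'rV[R]_m -> Prop) : dP W -> relopen S W ->
  exists u, [/\ appr u, forall x, 0 <= u x & forall x, S x -> (0 < u x <-> W x)].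
Proof.
move=> dW oW; have [I [J [q [hq hW]]]] := finiteness eST dW oW.
have pr0 i x : 0 <= \prod_(j : J) sp (q i j x) 0.
  by apply: prodr_ge0 => j _; exact: sp_ge0.
exists (fun x => \sum_i \prod_j sp (q i j x) 0); split.
- apply: appr_sum => i; apply: appr_prod => j; apply: appr_sp0; exact: polyfun_appr.
- by move=> x; apply: sumr_ge0 => i _; exact: pr0.
move=> x Sx; rewrite hW //; split=> [h|[i hi]].
  apply: contrapT => nex; move: h; rewrite big1 ?ltxx // => i _.
  have [j hj] : exists j, q i j x <= 0.
    apply: contrapT => hn; apply: nex; exists i => j.
    by rewrite ltNge; apply/negP => h; apply: hn; exists j.
  by rewrite (bigD1 j) //= sp0 max_r // mul0r.
rewrite (bigD1 i) //= ltr_wpDr //; first by apply: sumr_ge0 => i' _; exact: pr0.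
by apply: prodr_gt0 => j _; rewrite sp0 lt_max hi.
Qed.

End Approximable.

(** * Polynomial equations satisfied by definable functions *)

Section GraphRoot.
Variable R : realType.

Fixpoint pcoef m (p : pexpr R (m + 1)) (x : 'rV[R]_m) : {poly R} :=
  match p with
  | PConst c => c%:P
  | PVar i => match fintype.split i with inl j => (x 0 j)%:P | inr _ => 'X end
  | PAdd p q => pcoef p x + pcoef q x
  | PMul p q => pcoef p x * pcoef q x
  end.

Lemma pcoefE m (p : pexpr R (m + 1)) x (y : R) :
  peval p (row_mx x (\row_j y)) = (pcoef p x).[y].
Proof.
elim: p => [c|i|p IHp q IHq|p IHp q IHq] /=.
- by rewrite hornerC.
- rewrite -{1}(splitK i); case: (fintype.split i) => j /=.
    by rewrite row_mxEl hornerC.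
  by rewrite row_mxEr mxE hornerX.
- by rewrite hornerD IHp IHq.
- by rewrite hornerM IHp IHq.
Qed.

Lemma pcoef_nash m (p : pexpr R (m + 1)) (U : set 'rV[R]_m) : nash_poly U (pcoef p).
Proof.
have ncoord (j : 'I_m) : nash U (fun x => x 0 j) by split; [move=> k; stac|dtac].
elim: p => [c|i|p IHp q IHq|p IHp q IHq] k /=.
- exact: nash_cst.
- case: (fintype.split i) => j; last exact: nash_cst.
  apply: (nash_fext (g := fun x => if k == 0%N then x 0 j else 0)).
    by move=> x; rewrite coefC.
  by case: (k == 0%N) => //; exact: nash_cst.
- by apply: nash_fext (nash_add (IHp k) (IHq k)) => x; rewrite coefD.
- apply: (nash_fext (g := fun x => \sum_(j < k.+1) (pcoef p x)`_j * (pcoef q x)`_(k - j))).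
    by move=> x; rewrite coefM.
  by apply: nash_sum => j; exact: nash_mul.
Qed.

Lemma pcoef_size m (p : pexpr R (m + 1)) : exists D, forall x, (size (pcoef p x) <= D)%N.
Proof.
elim: p => [c|i|p [D1 h1] q [D2 h2]|p [D1 h1] q [D2 h2]] /=.
- by exists 1%N => x; rewrite size_polyC leq_b1.
- exists 2%N => x; case: (fintype.split i) => j; last by rewrite size_polyX.
  by rewrite size_polyC; case: (_ != _).
- exists (maxn D1 D2) => x; apply: leq_trans (size_polyD _ _) _.
  by rewrite geq_max !leq_max h1 h2 orbT.
- exists (D1 + D2)%N => x; apply: leq_trans (size_polyMleq _ _) _.
  by apply: leq_trans (leq_pred _) _; rewrite leq_add.
Qed.

(** The polynomials are those of a sign description of the graph. If over some [x] each of them were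
    either identically zero in the last variable or nonzero at [f x], a small change of [f x] would
    alter no sign, and the graph would contain a second point over [x]. *)
Lemma graph_root m (f : 'rV[R]_m -> R) : dfun f ->
  exists (k : nat) (P : 'I_k -> 'rV[R]_m -> {poly R}),
    [/\ forall i U, nash_poly U (P i), exists D, forall i x, (size (P i x) <= D)%N &
        forall x, exists i, P i x != 0 /\ (P i x).[f x] = 0].
Proof.
move=> df; have [k [p hp]] := sa_signs df.
exists k, (fun i => pcoef (p i)); split.
- by move=> i U; exact: pcoef_nash.
- have /choice[D hD] : forall i, exists D, forall x, (size (pcoef (p i) x) <= D)%N.
    by move=> i; exact: pcoef_size.
  by exists (\max_i D i) => i x; apply: leq_trans (hD i x) _; exact: leq_bigmax.
move=> x; apply: contrapT => nex.
have H i : pcoef (p i) x = 0 \/ (pcoef (p i) x).[f x] != 0.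
  have [->|h] := eqVneq (pcoef (p i) x) 0; first by left.
  by right; apply/eqP => h0; apply: nex; exists i.
have /choice[d hd] : forall i, exists d, 0 < d /\ forall t, `|t| < d ->
    Num.sg (pcoef (p i) x).[f x] = Num.sg (pcoef (p i) x).[f x + t].
  move=> i; have [h|h] := H i; first by exists 1; split=> // t _; rewrite h !horner0.
  set q := pcoef (p i) x in h *.
  have q0 : 0 < `|q.[f x]| by rewrite normr_gt0.
  have /cvgrPdist_lt /(_ _ q0) /nbhs_ballP[d /= d0 hd] := @continuous_horner R q (f x).
  exists d; split=> // t ht.
  have : `|q.[f x] - q.[f x + t]| < `|q.[f x]|.
    by apply: (hd (f x + t)); rewrite -ball_normE /= opprD addNKr normrN.
  have [h0|h0|h0] := ltrgt0P q.[f x]; last by rewrite h0 eqxx in h.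
    by rewrite (gtr0_sg h0) ltr_norml => /andP[_ ?]; rewrite gtr0_sg //; lra.
  by rewrite (ltr0_sg h0) ltr_norml => /andP[? _]; rewrite ltr0_sg //; lra.
set t := (\big[Num.min/1]_i d i) / 2.
have m0 : 0 < \big[Num.min/1]_i d i.
  by apply/bigmin_gtP; split=> // i _; exact: (hd i).1.
have t0 : 0 < t by rewrite divr_gt0.
have td i : `|t| < d i.
  rewrite gtr0_norm //; apply: (@lt_le_trans _ _ (\big[Num.min/1]_i d i)).
    by rewrite /t ltr_pdivrMr // ltr_pMr // ltr1n.
  exact: bigmin_le_cond.
have := hp (row_mx x (\row_j f x)) (row_mx x (\row_j (f x + t))) _.
rewrite /= !row_mxKl !row_mxKr !mxE => E.
have : f x = f x + t.
  by apply/E => // i; rewrite !pcoefE; exact: (hd i).2.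
by move=> /eqP; rewrite -subr_eq0 opprD addNKr oppr_eq0 gt_eqF.
Qed.

End GraphRoot.

(** * Finitely many Nash candidates for a selection *)

Section Selection.
Variable R : realType.
Variables (m n : nat) (S : 'rV[R]_m -> Prop) (T : 'rV[R]_m -> R) (U : set 'rV[R]_m).
Hypotheses (oU : popen U) (dU : dP U) (SU : S `<=` U) (nT : nash U T).
Hypotheses (T2U : forall x, U x -> 2 <= T x) (eST : exhaustion S T).
Variable I : 'rV[R]_m -> 'rV[R]_n -> Prop.
Hypothesis dI : dP (fun p : 'rV[R]_m * 'rV[R]_n => I p.1 p.2).
Hypothesis oI : forall x v, S x -> I x v -> exists2 r, 0 < r &
  forall h k, `|h| < r -> `|k| < r -> S (x + h) -> I (x + h) (v + k).
Hypothesis neI : forall x, S x -> exists v, I x v.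
Hypothesis cvI : forall x v w (l : R), S x -> I x v -> I x w -> 0 <= l <= 1 ->
  I x (l *: v + (1 - l) *: w).

(** A ball in one fibre persists, after shrinking, in the nearby fibres. The single variable [y]
    controls both its radius and, through [y^-1], the size of its centre, so one use of
    Lojasiewicz's inequality bounds both. *)
Lemma deep_points : exists N, forall x, S x ->
  exists v, `|v| < T x ^+ N /\ forall k, `|k| < T x ^- N -> I x (v + k).
Proof.
have [|x y y' Sx /andP[y0 yy] [v [hv hk]]|x Sx|N hN] := @lojasiewicz R m S T (fun x y =>
  exists v : 'rV[R]_n, `|v| < y^-1 /\ forall k : 'rV[R]_n, `|k| < y -> I x (v + k)) eST.
- by dtac.
- exists v; split; last by move=> k ky; apply: hk; exact: lt_le_trans ky yy.
  by apply: lt_le_trans hv _; rewrite lef_pV2 // posrE; exact: lt_le_trans yy.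
- have [v Iv] := neI Sx; have [r r0 hr] := oI Sx Iv.
  have v0 : 0 < `|v| + 1 by rewrite ltr_wpDl.
  exists (Num.min r (`|v| + 1)^-1) => [|h]; first by rewrite lt_min r0 invr_gt0.
  rewrite lt_min => /andP[hr1 _] Sh; exists v; split=> [|k].
    apply: (@lt_le_trans _ _ (`|v| + 1)); first by rewrite ltrDl.
    rewrite -[leLHS]invrK lef_pV2 ?posrE ?lt_min ?r0 ?invr_gt0 //.
    by rewrite ge_min lexx orbT.
  by rewrite lt_min => /andP[kr _]; exact: hr.
by exists N => x Sx; have [v [h1 h2]] := hN N x (leqnn _) Sx; rewrite invrK in h1; exists v.
Qed.

(* The point of least Euclidean norm of the convex set [K x] of points at depth
   [T x ^- N] in the fibre [I x] is a definable, possibly discontinuous,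
   selection of moderate growth. *)
Lemma definable_selection : exists N (s : 'rV[R]_m -> 'rV[R]_n), dfun s /\ forall x, S x ->
  `|s x| <= T x ^+ (N + n) /\ forall k, `|k| < T x ^- N -> I x (s x + k).
Proof.
have [dS dT T2 cT] := eST.
have [N hN] := deep_points; exists N.
pose K x (v : 'rV[R]_n) := forall k : 'rV[R]_n, `|k| < T x ^- N -> I x (v + k).
have dK : dP (fun p : 'rV[R]_m * 'rV[R]_n => K p.1 p.2) by rewrite /K; dtac.
have uniq x v w : S x -> K x v -> K x w -> (forall u, K x u -> dot v v <= dot u u) ->
    (forall u, K x u -> dot w w <= dot u u) -> v = w.
  move=> Sx Kv Kw hv hw.
  (* The midpoint of two distinct points of least norm would be a point of [K x] of smaller norm. *)
  have Km : K x (2^-1 *: v + (1 - 2^-1) *: w).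
    move=> k kT; have -> : 2^-1 *: v + (1 - 2^-1) *: w + k =
       2^-1 *: (v + k) + (1 - 2^-1) *: (w + k).
      by rewrite !scalerDr addrACA -scalerDl addrCA subrr addr0 scale1r.
    by apply: cvI => //; [exact: Kv|exact: Kw|apply/andP; lra].
  have h1 := hv _ Km; have h2 := hw _ Kv; have h3 := hv _ Kw.
  have d0 : dot (v - w) (v - w) <= 0.
    move: h1; rewrite !(dotDl, dotDr, dotZl, dotZr, dotNl, dotNr) (dotC w v).
    by move: (dot v v) (dot w w) (dot v w) h2 h3 => a b c; lra.
  have : `|v - w| ^+ 2 <= 0 by exact: le_trans (dot_ge _) d0.
  by rewrite exprn_even_le0 //= normr_eq0 subr_eq0 => /eqP.
have ex x : S x -> exists v, K x v /\ forall u, K x u -> dot v v <= dot u u.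
  move=> Sx; have [v0 [_ Kv0]] := hN x Sx.
  have ct y : pcont (fun v : 'rV[R]_n => dot v v) y.
    by apply: (@smooth_pcont _ _ setT) => //; exact: smooth_dot.
  pose A : set 'rV[R]_n := [set v | K x v /\ dot v v <= dot v0 v0].
  have A0 : A !=set0 by exists v0.
  have cA : compact A.
    apply: (@compact_bounded_closed _ _ _ (1 + dot v0 v0)).
      move=> v /= [_ hv]; have := le_trans (dot_ge v) hv; have := dot_ge0 v0.
      by have := normr_ge0 v; nra.
    (* [K x] is closed: a displacement [k] leading out of the fibre is strictly shorter than the
       depth, so [k - h] is still admissible and excludes [v + h] for small [h]. *)
    move=> v /= nv; have [Kv|/existsNP[k /not_implyP[kT nI]]] := pselect (K x v); last first.
      exists (T x ^- N - `|k|) => [|h hh [Kh _]]; first by rewrite subr_gt0.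
      apply: nI; have -> : v + k = v + h + (k - h) by rewrite addrACA subrr addr0.
      apply: Kh; apply: le_lt_trans (ler_normB _ _) _.
      by rewrite addrC -ltrBrDr.
    have lt0 : 0 < dot v v - dot v0 v0.
      by rewrite subr_gt0 ltNge; apply/negP => h; apply: nv.
    have [d d0 hd] := ct v _ lt0; exists d => // h /hd hh [_ /= hvh].
    by move: hh; rewrite ltr_norml => /andP[]; lra.
  have cf : {within A, continuous (fun v : 'rV[R]_n => dot v v)}.
    apply/within_continuousP => v Av e e0; have [d d0 hd] := ct v e e0.
    by exists d => // h /hd.
  have [v + hmin] := EVT_min_rV A0 cA cf; rewrite inE => -[Kv hv].
  exists v; split=> // u Ku; have [h|h] := leP (dot u u) (dot v0 v0).
    by apply: hmin; rewrite inE.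
  by apply: le_trans hv (ltW h).
have /choice[s hs] : forall x, exists v, (S x -> K x v /\ forall u, K x u -> dot v v <= dot u u) /\
    (~ S x -> v = 0).
  move=> x; have [Sx|nS] := pselect (S x); last by exists 0.
  by have [v hv] := ex x Sx; exists v.
exists s; split.
  apply: (@dfun_unique _ _ _ _ _ (fun x v => (S x /\ K x v /\ forall u, K x u -> dot v v <= dot u u)
    \/ (~ S x /\ v = 0))).
    apply: dP_or; last by dtac.
    apply: dP_and; first by dtac.
    apply: dP_and; first by dtac.
    apply: dP_all; apply: dP_imp; first by dtac.
    by apply: dP_le; apply: dfun_dot; dtac.
  move=> x v; split=> [<-|[[Sx [Kv hv]]|[nS ->]]]; last exact: (hs x).2.
    have [Sx|nS] := pselect (S x); first by left; split=> //; exact: (hs x).1.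
    by right; split=> //; exact: (hs x).2.
  by have [Ks hss] := (hs x).1 Sx; exact: (uniq x).
move=> x Sx; have [Ks hss] := (hs x).1 Sx; split=> //.
have [v0 [v0N Kv0]] := hN x Sx.
have T0 : 0 < T x by have := T2 x Sx; lra.
rewrite -ler_sqr ?nnegrE ?exprn_ge0 ?(ltW T0) //.
apply: le_trans (dot_ge _) _; apply: le_trans (hss v0 Kv0) _.
apply: le_trans (ler_norm _) _; apply: le_trans (dot_le _ _) _.
have -> : n%:R * `|v0| * `|v0| = n%:R * `|v0| ^+ 2 by rewrite -mulrA -expr2.
have -> : (T x ^+ (N + n)) ^+ 2 = (T x ^+ n) ^+ 2 * (T x ^+ N) ^+ 2.
  by rewrite exprD exprMn mulrC.
have T1 : 1 <= T x by have := T2 x Sx; lra.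
(* The [n] additional powers of [T >= 2] absorb the factor [n] between the Euclidean and the maximum
   norm. *)
have n1 : n%:R <= (T x ^+ n) ^+ 2.
  apply: (@le_trans _ _ (2 ^+ n)); first by rewrite -natrX ler_nat ltnW // ltn_expl.
  apply: (@le_trans _ _ (T x ^+ n)).
    by apply: lerXn2r; [rewrite nnegrE|rewrite nnegrE; exact: ltW|exact: T2].
  by rewrite expr2 ler_peMr ?exprn_ege1 //; apply: exprn_ge0; exact: ltW.
have n2 : `|v0| ^+ 2 <= (T x ^+ N) ^+ 2.
  by apply: lerXn2r; [rewrite nnegrE|rewrite nnegrE; apply: exprn_ge0; exact: ltW|exact: ltW].
by apply: ler_pM.
Qed.

(* The candidates are Nash approximations of the roots of the polynomials
   satisfied by the coordinates of a definable selection.  On the part of [S]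
   where the degrees of these polynomials in the last variable drop, leading
   coefficients are small; so the degrees are handled in increasing order, the
   points near which they drop being already covered. *)
Lemma nash_candidates : exists (L : finType) (rho : L -> 'rV[R]_m -> 'rV[R]_n),
  (forall l j, nash U (fun x => rho l x 0 j)) /\ forall x, S x -> exists l, I x (rho l x).
Proof.
have [dS dT T2 cT] := eST.
have [N [s [ds hs]]] := definable_selection.
have gr (j : 'I_n) := graph_root (dfun_coord j ds).
pose kj j := sval (cid (gr j)); pose Pj j := sval (cid (svalP (cid (gr j)))).
pose A : finType := {j : 'I_n & 'I_(kj j)}.
pose P (a : A) : 'rV[R]_m -> {poly R} := Pj (tag a) (tagged a).
have nP a : nash_poly U (P a).
  by rewrite /P /Pj; case: (svalP (cid (svalP (cid (gr (tag a)))))) => h _ _; exact: h.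
have [D sP] : exists D, forall a x, (size (P a x) <= D)%N.
  have /choice[Dj hDj] : forall j, exists D, forall i x, (size (Pj j i x) <= D)%N.
    by move=> j; rewrite /Pj; case: (svalP (cid (svalP (cid (gr j))))).
  by exists (\max_j Dj j) => a x; apply: leq_trans (hDj _ _ x) _; exact: leq_bigmax.
have rP x j : exists a, P a x != 0 /\ (P a x).[s x 0 j] = 0.
  case: (svalP (cid (svalP (cid (gr j))))) => _ _ /(_ x)[i hi].
  by exists (Tagged (fun j => 'I_(kj j)) i).
have cP a i x : S x -> pcont (fun x => (P a x)`_i) x.
  by move=> Sx; exact: smooth_pcont (nP a i).1 (SU Sx).
(* The measure of the induction: it decreases when the degree of one of the polynomials drops. *)
pose sig x := (\sum_a size (P a x))%N.
suff Cov t : exists (L : finType) (rho : L -> 'rV[R]_m -> 'rV[R]_n),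
    (forall l j, nash U (fun x => rho l x 0 j)) /\
    forall x, S x -> (sig x < t)%N -> exists l, I x (rho l x).
  have [L [rho [h1 h2]]] := Cov (\sum_(a : A) D).+1.
  by exists L, rho; split=> // x Sx; apply: h2 => //; rewrite ltnS; apply: leq_sum.
elim: t => [|t [L [rho [nrho hrho]]]]; first by exists void, (fun _ _ => 0); split.
pose cov x := exists l, I x (rho l x).
have drho l : dfun (rho l) by apply: dfun_row => j; exact: (nrho l j).2.
have crho l x : S x -> forall e, 0 < e -> exists2 d, 0 < d & forall h, `|h| < d ->
    `|rho l (x + h) - rho l x| < e.
  move=> Sx e e0; have /choice[d hd] : forall j, exists d, 0 < d /\ forall h, `|h| < d ->
      `|rho l (x + h) 0 j - rho l x 0 j| < e.
    by move=> j; have [d d0 hd] := smooth_pcont (nrho l j).1 (SU Sx) e0; exists d.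
  exists (\big[Num.min/1]_j d j) => [|h /bigmin_gtP[_ hh]].
    by apply/bigmin_gtP; split=> // j _; exact: (hd j).1.
  by apply: norm_lt => // j; rewrite !mxE; apply: (hd j).2; exact: hh.
have ocov x : S x -> cov x -> exists2 d, 0 < d & forall h, `|h| < d -> S (x + h) -> cov (x + h).
  move=> Sx [l Il]; have [r r0 hr] := oI Sx Il; have [d d0 hd] := crho l x Sx r r0.
  exists (Num.min r d) => [|h]; first by rewrite lt_min r0.
  rewrite lt_min => /andP[h1 h2] Sh; exists l.
  by have := hr h _ h1 (hd h h2) Sh; rewrite [rho l x + _]addrC subrK.
have dcov : dP cov.
  by apply: dP_big_ex => l; have dl := drho l; dtac.
(* At a point not yet covered, sizes bounded by [g] with total [t] must be equal to [g]. So the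
   leading coefficients are nonzero there, and Lojasiewicz's inequality bounds them below by a power
   of [T]. *)
have leads (g : {ffun A -> 'I_D.+1}) : exists N, (\sum_a g a = t)%N ->
    forall M x, (N <= M)%N -> S x -> ~ cov x -> (forall a, (size (P a x) <= g a)%N) ->
      forall a, (0 < g a)%N -> T x ^- M <= `|(P a x)`_(g a).-1|.
  have [gt|] := pselect (\sum_a g a = t)%N; last by exists 0%N.
  have [||x Sx|N0 hN0] := @lojasiewicz R m S T (fun x y => ~ cov x ->
      (forall a (i : 'I_D), (g a <= i)%N -> (P a x)`_i = 0) ->
      forall a, (0 < g a)%N -> y <= `|(P a x)`_(g a).-1|) eST; last first.
  - exists N0 => _ M x NM Sx nc sg; apply: (hN0 M x NM Sx nc) => a i gi.
    by rewrite nth_default // (leq_trans (sg a)).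
  - have [cx|nc] := pselect (cov x).
      by have [d d0 hd] := ocov x Sx cx; exists d => // h hh Sh []; exact: hd.
    have [sg|] := pselect (forall a (i : 'I_D), (g a <= i)%N -> (P a x)`_i = 0); last first.
      move=> /existsNP[a /existsNP[i /not_implyP[gi /eqP ci]]].
      have c0 : 0 < `|(P a x)`_i| by rewrite normr_gt0.
      have [d d0 hd] := cP a i x Sx _ c0; exists d => // h /hd hh _ _ sg.
      by move: hh; rewrite (sg a i gi) sub0r normrN ltxx.
    have sle a : (size (P a x) <= g a)%N.
      apply/leq_sizeP => i gi; have [iD|iD] := ltnP i D; first exact: (sg a (Ordinal iD)).
      by rewrite nth_default // (leq_trans (sP a x)).
    have seq a : size (P a x) = g a.
      apply/eqP; rewrite eqn_leq sle leqNgt; apply/negP => lt_a; apply: nc; apply: hrho => //.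
      rewrite -gt /sig (bigD1 a) // [ltnRHS](bigD1 a) //= -addSn leq_add //.
      exact: leq_sum.
    have c0 a : (0 < g a)%N -> 0 < `|(P a x)`_(g a).-1|.
      move=> ga; rewrite normr_gt0 -seq -[_`_ _]/(lead_coef _) lead_coef_eq0 -size_poly_gt0.
      by rewrite seq.
    have /choice[d hd] : forall a, exists d, 0 < d /\ ((0 < g a)%N -> forall h, `|h| < d ->
        d <= `|(P a (x + h))`_(g a).-1|).
      move=> a; have [ga|ga] := posnP (g a); first by exists 1; split=> //; rewrite ga.
      have h0 : 0 < `|(P a x)`_(g a).-1| / 2 by rewrite divr_gt0 // c0.
have [d d0 hd] := cP a (g a).-1 x Sx _ h0.
      exists (Num.min d (`|(P a x)`_(g a).-1| / 2)); split=> [|_ h]; first by rewrite lt_min d0.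
      rewrite lt_min => /andP[/hd hh _]; rewrite ge_min; apply/orP; right.
      have := ler_distD 0 (P a x)`_(g a).-1 (P a (x + h))`_(g a).-1.
      have := lerB_dist (P a x)`_(g a).-1 (P a (x + h))`_(g a).-1.
      by rewrite distrC in hh; lra.
    exists (\big[Num.min/1]_a d a) => [|h /bigmin_gtP[_ hh] Sh _ _ a ga].
      by apply/bigmin_gtP; split=> // a _; exact: (hd a).1.
    by apply: le_trans ((hd a).2 ga h (hh a isT)); exact: bigmin_le_cond.
  - by move=> x y y' _ /andP[_ yy] H nc sg a ga; exact: le_trans yy (H nc sg a ga).
  have dc a i : dfun (fun x => (P a x)`_i) := (nP a i).2.
  apply: dP_imp; first by dtac.
  apply: dP_imp.
    apply: dP_big_all => a; apply: dP_big_all => i; apply: dP_imp; first exact: dP_cst.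
    apply: dP_eq; last by dtac.
    by apply: (dfun_comp (dc a i)); dtac.
  apply: dP_big_all => a; apply: dP_imp; first exact: dP_cst.
  apply: dP_le; first by dtac.
  by apply: dfun_norm; apply: (dfun_comp (dc a (g a).-1)); dtac.
have /choice[Ng hNg] := leads.
pose N0 := \max_g Ng g.
(* Where [P a] has degree [i], this is [P a] times its leading coefficient. The top coefficient
   becomes a square, hence nonnegative, at the price of the exponent [N0 + N0]; truncation keeps the
   degree bounded at all other points. *)
pose q (ai : A * 'I_D) x := (P ai.1 x)`_ai.2 *: take_poly ai.2.+1 (P ai.1 x).
have hc (ai : A * 'I_D) := @nash_root_cover R m U T ai.2 (q ai) (N + n) (N0 + N0) N.+1 oU dU nT T2U.
have {}hc (ai : A * 'I_D) : exists (I : finType) (rho : I -> 'rV[R]_m -> R), (forall i, nash U (rho i)) /\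
    forall x y, U x -> T x ^- (N0 + N0) <= (q ai x)`_ai.2 -> `|y| <= T x ^+ (N + n) ->
      (q ai x).[y] = 0 -> exists i, `|rho i x - y| <= T x ^- N.+1.
  apply: hc => [i|x|x Ux].
  - rewrite /q; apply: (nash_fext (g := fun x => (P ai.1 x)`_ai.2 *
        (if (i < ai.2.+1)%N then (P ai.1 x)`_i else 0))).
      by move=> x; rewrite coefZ coef_take_poly.
    by apply: nash_mul; [exact: nP|case: (i < _)%N; [exact: nP|exact: nash_cst]].
  - by apply: leq_trans (size_scale_leq _ _) _; exact: size_take_poly.
  - by rewrite coefZ coef_take_poly ltnSn -expr2 sqr_ge0.
pose J ai := sval (cid (hc ai)).
pose rh ai : J ai -> 'rV[R]_m -> R := sval (cid (svalP (cid (hc ai)))).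
have hrh ai := svalP (cid (svalP (cid (hc ai)))).
(* A new candidate picks an approximate root for each coordinate independently. *)
pose L' : finType := (L + {ffun 'I_n -> {ai : A * 'I_D & J ai}})%type.
pose rho' (l : L + {ffun 'I_n -> {ai : A * 'I_D & J ai}}) : 'rV[R]_m -> 'rV[R]_n :=
  match l with inl l => rho l
   | inr c => fun x => \row_j rh (tag (c j)) (tagged (c j)) x end.
exists L', rho'; split.
  case=> [l|c] j; first exact: nrho.
  by apply: nash_fext ((hrh (tag (c j))).1 (tagged (c j))) => x; rewrite mxE.
move=> x Sx sx; have [[l hl]|nc] := pselect (cov x); first by exists (inl l).
have st : sig x = t.
  apply/eqP; rewrite eqn_leq -ltnS sx leqNgt; apply/negP => h; apply: nc; exact: hrho.
have lead a : P a x != 0 -> T x ^- N0 <= `|lead_coef (P a x)|.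
  move=> Pa; pose g := [ffun a => inord (size (P a x)) : 'I_D.+1].
  have gE b : g b = size (P b x) :> nat by rewrite ffunE inordK // ltnS.
  have := hNg g _ N0 x (leq_bigmax _) Sx nc _ a; rewrite !gE size_poly_gt0; apply => //.
    by rewrite -st; apply: eq_bigr => b _; rewrite gE.
  by move=> b; rewrite gE.
have /choice[c hc'] : forall j, exists c : {ai : A * 'I_D & J ai},
    `|rh (tag c) (tagged c) x - s x 0 j| <= T x ^- N.+1.
  move=> j; have [a [Pa ra]] := rP x j.
  have sa : (0 < size (P a x))%N by rewrite size_poly_gt0.
  have iD : ((size (P a x)).-1 < D)%N by rewrite prednK.
  pose ai : A * 'I_D := (a, Ordinal iD).
  have E : q ai x = lead_coef (P a x) *: P a x.
    by rewrite /q /= prednK // take_poly_id.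
  have [hs1 hs2] := hs x Sx.
  have [||i hi] := (hrh ai).2 x (s x 0 j) (SU Sx) _ (le_trans (norm_coord _ _) hs1).
  - rewrite E coefZ /= -[(P a x)`__]/(lead_coef _) -expr2 -real_normK ?num_real //.
    rewrite exprD invfM expr2; apply: ler_pM; try exact: lead.
      by apply: ltW; exact: exhaustion_V eST Sx.
    by apply: ltW; exact: exhaustion_V eST Sx.
  - by rewrite E hornerZ ra mulr0.
  by exists (Tagged J i).
exists (inr [ffun j => c j]).
rewrite /=; have -> : \row_j rh (tag ([ffun j => c j] j)) (tagged ([ffun j => c j] j)) x =
  s x + (\row_j rh (tag (c j)) (tagged (c j)) x - s x).
  by apply/rowP => j; rewrite !mxE ffunE addrC subrK.
apply: (hs x Sx).2.
have TN : 0 < T x ^- N by exact: exhaustion_V eST Sx.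
apply: norm_lt => // j; rewrite !mxE; apply: le_lt_trans (hc' j) _.
by apply: le_lt_trans (TV_half eST N Sx) _; rewrite ltr_pdivrMr // ltr_pMr // ltr1n.
Qed.

End Selection.

Section Convexity.
Variable R : realType.

(** Points of weight 0 may lie outside [C], as happens for candidates at points where they leave the
    fibre. *)
Lemma convex_barycenter n (C : 'rV[R]_n -> Prop) (L : Type) (a : L -> R) (v : L -> 'rV[R]_n)
    (s : seq L) :
  (forall x y (l : R), C x -> C y -> 0 <= l <= 1 -> C (l *: x + (1 - l) *: y)) ->
  (forall l, 0 <= a l) -> (forall l, 0 < a l -> C (v l)) -> 0 < \sum_(l <- s) a l ->
  C ((\sum_(l <- s) a l)^-1 *: \sum_(l <- s) a l *: v l).
Proof.
move=> cC a0 hv; elim: s => [|l s IH]; first by rewrite big_nil ltxx.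
rewrite !big_cons; set A := \sum_(i <- s) a i; set B := \sum_(i <- s) _ *: _.
have A0 : 0 <= A by apply: sumr_ge0.
move: (A0); rewrite le0r => /orP[/eqP A00|Ap].
  have -> : B = 0.
    rewrite /B; move: A00; rewrite /A; elim: (s) => [|k t IHt]; first by rewrite !big_nil.
    rewrite !big_cons => /eqP; rewrite paddr_eq0 //; last by apply: sumr_ge0.
    by move=> /andP[/eqP -> /eqP /IHt ->]; rewrite scale0r addr0.
  rewrite A00 !addr0 => al; rewrite scalerA mulVf ?scale1r; last by rewrite gt_eqF.
  exact: hv.
move: (a0 l); rewrite le0r => /orP[/eqP -> _|al Dp]; first by rewrite !add0r scale0r add0r; exact: IH.
have -> : (a l + A)^-1 *: (a l *: v l + B) =
    (a l / (a l + A)) *: v l + (1 - a l / (a l + A)) *: (A^-1 *: B).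
  rewrite scalerDr !scalerA mulrC; congr (_ + _ *: _).
  by field; rewrite !gt_eqF // addr_gt0.
apply: cC; [exact: hv|exact: IH|].
by rewrite divr_ge0 ?(ltW Dp) //= ler_pdivrMr // mul1r lerDl.
Qed.

End Convexity.

(** * Gluing the candidates by convex combinations *)

Section NashSelection.
Variable R : realType.
Variables (m n : nat) (S : set 'rV[R]_m).
Hypotheses (sS : semialgebraic S) (lcS : locally_compact_set S).
Variable I : 'rV[R]_m -> 'rV[R]_n -> Prop.
Hypothesis dI : dP (fun p : 'rV[R]_m * 'rV[R]_n => I p.1 p.2).
Hypothesis oI : forall x v, S x -> I x v -> exists2 r, 0 < r &
  forall h k, `|h| < r -> `|k| < r -> S (x + h) -> I (x + h) (v + k).
Hypothesis neI : forall x, S x -> exists v, I x v.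
Hypothesis cvI : forall x v w (l : R), S x -> I x v -> I x w -> 0 <= l <= 1 ->
  I x (l *: v + (1 - l) *: w).

Lemma nash_near_row (G : 'I_n -> 'rV[R]_m -> R) : (forall j, nash_near S (G j)) ->
  exists V : set 'rV[R]_m, [/\ popen V, dP V, S `<=` V & forall j, nash V (G j)].
Proof.
move=> /choice[V hV]; exists (fun x => forall j, V j x); split.
- move=> x Vx; have /choice[d hd] : forall j, exists d, 0 < d /\ forall h, `|h| < d -> V j (x + h).
    by move=> j; have [oV _ _ _] := hV j; have [d d0 hd] := oV x (Vx j); exists d.
  exists (\big[Num.min/1]_j d j) => [|h /bigmin_gtP[_ hh] j].
    by apply/bigmin_gtP; split=> // j _; exact: (hd j).1.
  by apply: (hd j).2; exact: hh.
- by apply: dP_big_all => j; have [_ dV _ _] := hV j.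
- by move=> x Sx j; have [_ _ SV _] := hV j; exact: SV.
- move=> j; have [_ _ _ [sG dG]] := hV j; split=> // k.
  by apply: (Dk_sub (U := V j)) (sG k) => x; exact.
Qed.

Theorem nash_selection : exists V (G : 'rV[R]_m -> 'rV[R]_n),
  [/\ popen V /\ dP V, S `<=` V, forall j, nash V (fun x => G x 0 j) & forall x, S x -> I x (G x)].
Proof.
have [U [T [[oU dU] SU nT T2U eST]]] := locally_compact_exhaustion sS lcS.
have [L [rho [nrho hrho]]] := nash_candidates oU dU SU nT T2U eST dI oI neI cvI.
have T0 x : S x -> 0 < T x by move=> Sx; have := T2U x (SU x Sx); lra.
have arho l j : appr S T (fun x => rho l x 0 j).
  by apply: (nash_near_appr eST); exact: (nash_near_U oU dU SU).
have crho l x : S x -> forall e, 0 < e -> exists2 d, 0 < d & forall h, `|h| < d -> S (x + h) ->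
    `|rho l (x + h) - rho l x| < e.
  move=> Sx e e0; have /choice[d hd] : forall j, exists d, 0 < d /\ forall h, `|h| < d ->
      S (x + h) -> `|rho l (x + h) 0 j - rho l x 0 j| < e.
    by move=> j; have [_ + _] := arho l j => /(_ x Sx e e0)[d d0 hd]; exists d.
  exists (\big[Num.min/1]_j d j) => [|h /bigmin_gtP[_ hh] Sh].
    by apply/bigmin_gtP; split=> // j _; exact: (hd j).1.
  by apply: norm_lt => // j; rewrite !mxE; apply: (hd j).2 => //; exact: hh.
have drho l : dfun (rho l) by apply: dfun_row => j; exact: (nrho l j).2.
(* On [S], the weight of a candidate is positive exactly where the candidate lies in the fibre. *)
have /choice[u hu] : forall l, exists u : 'rV[R]_m -> R, [/\ appr S T u, forall x, 0 <= u x &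
    forall x, S x -> (0 < u x <-> I x (rho l x))].
  move=> l; apply: (appr_bump oU dU SU nT eST); first by have dl := drho l; dtac.
  move=> x Sx Ix; have [r r0 hr] := oI Sx Ix; have [d d0 hd] := crho l x Sx r r0.
  exists (Num.min r d) => [|h]; first by rewrite lt_min r0.
  rewrite lt_min => /andP[h1 h2] Sh.
  by have := hr h _ h1 (hd h h2 Sh) Sh; rewrite [rho l x + _]addrC subrK.
pose D x := \sum_l u l x.
have D0 x : S x -> 0 < D x.
  move=> Sx; have [l Il] := hrho x Sx; rewrite /D (bigD1 l) //=.
  apply: ltr_pwDl; first by have [_ _ h] := hu l; exact/h.
  by apply: sumr_ge0 => k _; have [] := hu k.
have aD : appr S T D by apply: appr_sum => // l; have [] := hu l.
pose g x := (D x)^-1 *: \sum_l u l x *: rho l x.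
have ag j : appr S T (fun x => g x 0 j).
  rewrite (_ : (fun x => _) = (fun x => (D x)^-1 * \sum_l u l x * rho l x 0 j)).
    apply: (appr_mul eST); first exact: (appr_inv eST aD D0).
    by apply: appr_sum => // l; apply: (appr_mul eST) => //; have [] := hu l.
  apply/funext => x; rewrite mxE summxE; congr (_ * _); apply: eq_bigr => l _.
  by rewrite mxE.
have Ig x : S x -> I x (g x).
  move=> Sx; apply: convex_barycenter; last exact: D0.
  - by move=> v w l Iv Iw l01; exact: cvI.
  - by move=> l; have [] := hu l.
  - by move=> l ul; have [_ _ h] := hu l; exact/h.
have dg : dfun g by apply: dfun_row => j; have [] := ag j.
clearbody g.
(* The barycentre [g] is a selection, but its coordinates are only approximable. The fibres leave a
   room of at least [T x ^- N] around it, so a Nash approximation of order [N.+1] is still a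
   selection. *)
have [|x y y' _ /andP[_ yy] H k ky|x Sx|N hN] := @lojasiewicz R m S T (fun x y =>
    forall k : 'rV[R]_n, `|k| < y -> I x (g x + k)) eST.
- by dtac.
- by apply: H; exact: lt_le_trans ky yy.
- have [r r0 hr] := oI Sx (Ig x Sx); have r20 : 0 < r / 2 by rewrite divr_gt0.
  have /choice[d hd] : forall j, exists d, 0 < d /\ forall h, `|h| < d ->
      S (x + h) -> `|g (x + h) 0 j - g x 0 j| < r / 2.
    by move=> j; have [_ + _] := ag j => /(_ x Sx _ r20)[d d0 hd]; exists d.
  exists (Num.min (r / 2) (\big[Num.min/1]_j d j)) => [|h].
    by rewrite lt_min r20; apply/bigmin_gtP; split=> // j _; exact: (hd j).1.
  rewrite lt_min => /andP[h1 /bigmin_gtP[_ hh]] Sh k.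
  rewrite lt_min => /andP[k1 _].
  have h2 : `|g (x + h) - g x| < r / 2.
    by apply: norm_lt => // j; rewrite !mxE; apply: (hd j).2 => //; exact: hh.
  have -> : g (x + h) + k = g x + (g (x + h) - g x + k) by rewrite addrA [g x + _]addrC subrK.
  apply: hr => //; first by lra.
  by apply: le_lt_trans (ler_normD _ _) _; lra.
have /choice[G hG] : forall j, exists G, nash_near S G /\
    forall x, S x -> `|g x 0 j - G x| <= T x ^- N.+1.
  by move=> j; have [_ _ /(_ N.+1)[G h1 h2]] := ag j; exists G.
have [V [oV dV SV nV]] := nash_near_row (fun j => (hG j).1).
exists V, (fun x => \row_j G j x); split=> // [j|x Sx].
  by apply: nash_fext (nV j) => x; rewrite mxE.
have -> : \row_j G j x = g x + (\row_j G j x - g x) by rewrite addrC subrK.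
apply: (hN N) => //; have TN : 0 < T x ^- N by exact: exhaustion_V eST Sx.
apply: norm_lt => // j; rewrite !mxE distrC; apply: le_lt_trans ((hG j).2 x Sx) _.
have := TV_half eST N Sx; lra.
Qed.

End NashSelection.

(** * Estimates in charts *)

Section Estimates.
Variable R : realType.

(* Eventually: for all large constants [C] and small radii [r]. *)
Definition ev (P : R -> R -> Prop) := exists C r : R, 0 < r /\
  forall C' r', C <= C' -> 0 < r' <= r -> P C' r'.

Lemma ev_ex P : ev P -> exists C r : R, [/\ 1 <= C, 0 < r & P C r].
Proof.
move=> [C [r [r0 h]]]; exists (Num.max 1 C), r.
by rewrite le_max lexx r0; split=> //; apply: h; rewrite ?le_max ?lexx ?orbT ?r0.
Qed.

Lemma ev_mono P C r : 0 < r -> P C r ->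
  (forall C' r', C <= C' -> r' <= r -> P C r -> P C' r') -> ev P.
Proof. by move=> r0 PC mono; exists C, r; split=> // C' r' CC /andP[_ rr]; exact: mono. Qed.

Lemma ev_sub (P P' : R -> R -> Prop) : (forall C r, 0 <= C -> 0 < r -> P C r -> P' C r) -> ev P -> ev P'.
Proof.
move=> h [C [r [r0 hP]]]; exists (Num.max 0 C), r; split=> // C' r'.
rewrite ge_max => /andP[C0 CC] /andP[r'0 rr]; apply: h => //; apply: hP => //.
by rewrite r'0.
Qed.

Lemma ev_and P P' : ev P -> ev P' -> ev (fun C r => P C r /\ P' C r).
Proof.
move=> [C1 [r1 [r10 h1]]] [C2 [r2 [r20 h2]]]; exists (Num.max C1 C2), (Num.min r1 r2).
rewrite lt_min r10 r20; split=> // C r; rewrite ge_max le_min => /andP[c1 c2] /and3P[r0 l1 l2].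
by split; [apply: h1|apply: h2]; rewrite ?r0.
Qed.

Lemma ev_all (I : finType) (P : I -> R -> R -> Prop) :
  (forall i, ev (P i)) -> ev (fun C r => forall i, P i C r).
Proof.
move=> hP; suff : ev (fun C r => forall i, i \in enum I -> P i C r).
  by apply: ev_sub => C r _ _ h i; apply: h; rewrite mem_enum.
elim: (enum I) => [|i s IH]; first by exists 0, 1; split.
apply: ev_sub (ev_and (hP i) IH) => C r _ _ [h1 h2] j.
by rewrite inE => /orP[/eqP ->|/h2].
Qed.

Lemma mvt_segment m (f : 'rV[R]_m -> R) (G : 'rV[R]_m -> 'rV[R]_m) (x h : 'rV[R]_m) :
  (forall s : R, `|s| <= 1 -> hasgrad f (x + s *: h) (G (x + s *: h))) ->
  exists2 c : R, `|c| <= 1 & f (x + h) - f x = dot (G (x + c *: h)) h.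
Proof.
move=> hf; pose f1 (s : 'rV[R]_1) := f (x + s 0 0 *: h).
have hf1 (s : R) : `|s| <= 1 ->
    hasgrad f1 (0 + s *: ebasis R 0) (\sum_j G (x + s *: h) 0 j *: (h 0 j *: delta_mx 0 0)).
  move=> s1; have E : (0 + s *: ebasis R 0 : 'rV[R]_1) 0 0 = s by rewrite !mxE mulr1 add0r.
  apply: (hasgrad_comp (u := fun s : 'rV[R]_1 => x + s 0 0 *: h)) => [j|]; last by rewrite E; exact: hf.
  have -> : h 0 j *: delta_mx 0 0 = 0 + (h 0 j *: delta_mx 0 0 + (0 + s *: ebasis R 0 : 'rV[R]_1) 0 0 *: 0) :> 'rV[R]_1.
    by rewrite scaler0 addr0 add0r.
  apply: (hasgrad_ext (f := fun v : 'rV[R]_1 => x 0 j + v 0 0 * h 0 j)).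
    apply: hasgrad_add; first exact: hasgrad_cst.
    by apply: (hasgrad_mul (hasgrad_coord _ _) (hasgrad_cst _ _)).
  by exists 1 => // k _; rewrite !mxE.
have [s|c] := @mvt_line R 1 f1 0 0 1.
  by rewrite normr1 => /hf1 /(hasgrad_is_derive 0)[].
rewrite normr1 => c1; have [_ ->] := hasgrad_is_derive 0 (hf1 c c1).
rewrite /f1 !mxE !mulr1 !add0r scale0r addr0 scale1r => ->; exists c => //.
rewrite summxE /dot; apply: eq_bigr => j _; rewrite !mxE /= mulr1.
by [].
Qed.

Definition lipnear m p (u : 'rV[R]_m -> 'rV[R]_p) x (C r : R) :=
  forall y y', `|y - x| < r -> `|y' - x| < r -> `|u y - u y'| <= C * `|y - y'|.

Lemma lipnear_comp m p (u : 'rV[R]_m -> 'rV[R]_p) x :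
  (forall j, ev (fun C r => forall y y', `|y - x| < r -> `|y' - x| < r ->
     `|u y 0 j - u y' 0 j| <= C * `|y - y'|)) -> ev (lipnear u x).
Proof.
move=> /ev_all; apply: ev_sub => C r C0 _ h y y' hy hy'.
by apply: norm_le => [|j]; [exact: mulr_ge0|rewrite !mxE; exact: h].
Qed.

Lemma segment_near m (x y y' : 'rV[R]_m) (r c : R) : `|y - x| < r -> `|y' - x| < r -> `|c| <= 1 ->
  `|y' + c *: (y - y') - x| < 3 * r.
Proof.
move=> h1 h2 hc; have -> : y' + c *: (y - y') - x = (y' - x) + c *: ((y - x) - (y' - x)).
  by apply/rowP => i; rewrite !mxE; ring.
apply: le_lt_trans (ler_normD _ _) _; rewrite normrZ.
have hN := ler_normB (y - x) (y' - x); move: h1 h2 hN.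
move: (`|y - x|) (`|y' - x|) => a b; set N := `|_ - _| => h1 h2 hN.
have hcN : `|c| * N <= 1 * N by apply: ler_wpM2r => //; exact: normr_ge0.
rewrite mul1r in hcN; clearbody N; move: hcN; set M := _ * N => hcN.
clearbody M; lra.
Qed.

Lemma smooth_grad m (V : set 'rV[R]_m) (f : 'rV[R]_m -> R) x : popen V -> smooth V f -> V x ->
  exists2 G : 'rV[R]_m -> 'rV[R]_m, (forall x, V x -> hasgrad f x (G x)) &
    (forall i, smooth V (fun x => G x 0 i)) /\
    exists2 d, 0 < d & forall y, `|y - x| < d -> V y /\ `|G y| <= `|G x| + 1.
Proof.
move=> oV sf Vx; have [G hG sG] := smoothP oV sf; exists G => //; split=> //.
have /choice[d hd] : forall j, exists d, 0 < d /\ forall h, `|h| < d -> `|G (x + h) 0 j - G x 0 j| < 1.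
  by move=> j; have [d d0 hd] := smooth_pcont (sG j) Vx ltr01; exists d.
have [e e0 he] := oV x Vx.
exists (Num.min e (\big[Num.min/1]_j d j)) => [|y].
  by rewrite lt_min e0; apply/bigmin_gtP; split=> // j _; exact: (hd j).1.
have E : x + (y - x) = y by rewrite addrC subrK.
rewrite lt_min => /andP[/he + /bigmin_gtP[_ hh]]; rewrite E => Vy; split=> //.
apply: (@le_trans _ _ (`|G x| + `|G y - G x|)).
  by have := ler_normD (G x) (G y - G x); rewrite addrC subrK.
rewrite lerD2l; apply: norm_le => // j; rewrite !mxE; have := (hd j).2 _ (hh j isT).
by rewrite E => /ltW.
Qed.

Lemma lip_scalar m (V : set 'rV[R]_m) (f : 'rV[R]_m -> R) x : popen V -> smooth V f -> V x ->
  ev (fun C r => forall y y', `|y - x| < r -> `|y' - x| < r -> `|f y - f y'| <= C * `|y - y'|).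
Proof.
move=> oV sf Vx; have [G hG [_ [d d0 hd]]] := smooth_grad oV sf Vx.
apply: (@ev_mono _ (m%:R * (`|G x| + 1)) (d / 3)); first by rewrite divr_gt0.
  move=> y y' hy hy'.
  have hs c : `|c| <= 1 -> `|y' + c *: (y - y') - x| < d.
    by move=> /(segment_near hy hy'); rewrite mulrC divfK.
  have [s /hs /hd[Vs _]|c /hs /hd[_ hc]] := @mvt_segment m f G y' (y - y'); first exact: hG.
  rewrite [y' + (_ - _)]addrC subrK => ->; apply: le_trans (dot_le _ _) _.
  by apply: ler_wpM2r => //; apply: ler_wpM2l.
move=> C r CC rr h y y' hy hy'; apply: le_trans (h y y' (lt_le_trans hy rr) (lt_le_trans hy' rr)) _.
exact: ler_wpM2r.
Qed.

Lemma lip_smooth m p (V : set 'rV[R]_m) (u : 'rV[R]_m -> 'rV[R]_p) x : popen V ->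
  (forall j, smooth V (fun x => u x 0 j)) -> V x -> ev (lipnear u x).
Proof. by move=> oV su Vx; apply: lipnear_comp => j; exact: lip_scalar (su j) Vx. Qed.

Lemma taylor_scalar m (V : set 'rV[R]_m) (f : 'rV[R]_m -> R) (G : 'rV[R]_m -> 'rV[R]_m) x :
  popen V -> (forall x, V x -> hasgrad f x (G x)) -> (forall i, smooth V (fun x => G x 0 i)) -> V x ->
  ev (fun C r => forall y y', `|y - x| < r -> `|y' - x| < r ->
    `|f y - f y' - dot (G y') (y - y')| <= C * `|y - y'| ^+ 2).
Proof.
move=> oV hG sG Vx; have [C [r [C1 r0 lG]]] := ev_ex (lip_smooth oV sG Vx).
have [d d0 hd] := oV x Vx; pose r' := Num.min (r / 3) (d / 3).
apply: (@ev_mono _ (m%:R * C) r'); first by rewrite lt_min !divr_gt0.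
  move=> y y' hy hy'.
  have hs c : `|c| <= 1 -> `|y' + c *: (y - y') - x| < d /\ `|y' + c *: (y - y') - x| < r.
    move=> /(segment_near hy hy') h; split; apply: lt_le_trans h _; rewrite mulrC -ler_pdivlMr //.
      by rewrite ge_min lexx orbT.
    by rewrite ge_min lexx.
  have [s /hs[/hd + _]|c hc] := @mvt_segment m f G y' (y - y').
    by rewrite addrC subrK; exact: hG.
  rewrite [y' + (_ - _)]addrC subrK => ->; rewrite -dotBl; apply: le_trans (dot_le _ _) _.
  rewrite expr2 mulrA; apply: ler_wpM2r => //; rewrite -mulrA; apply: ler_wpM2l => //.
  apply: le_trans (lG _ _ (hs c hc).2 _) _.
    by apply: lt_le_trans hy' _; rewrite ge_min ler_pdivrMr // mulrC ler_peMl ?(ltW r0) //; lra.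
  apply: ler_wpM2l; first by lra.
  by rewrite addrC addKr normrZ ler_piMl.
move=> C' s CC rr h y y' hy hy'; apply: le_trans (h y y' (lt_le_trans hy rr) (lt_le_trans hy' rr)) _.
by apply: ler_wpM2r => //; exact: sqr_ge0.
Qed.

End Estimates.

Section Charts.
Variable R : realType.

(** One constant and one radius serve for all estimates, so that later arguments never shrink the
    chart. [J u] is the transposed Jacobian matrix of [psi], acting on rows from the right:
    [row j (J u)] is the image of the [j]-th coordinate direction, tangent to [Q] at points [psi u]
    of [Q] when [j < d]. *)
Record chart_est n (d k : nat) (Q : set 'rV[R]_n) (q : 'rV[R]_n) (phi psi : 'rV[R]_n -> 'rV[R]_n)
    (J : 'rV[R]_n -> 'M[R]_n) (V : set 'rV[R]_n) (C r : R) : Prop := ChartEst {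
  ce_r : 0 < r;
  ce_C : 1 <= C;
  ce_openV : popen V;
  ce_V : forall u, `|u - phi q| < r -> V u;
  ce_phiK : forall y, `|y - q| < r -> psi (phi y) = y;
  ce_Q : forall y, `|y - q| < r -> (Q y <-> quadrant d k (phi y));
  ce_Qpsi : forall u, `|u - phi q| < r -> (Q (psi u) <-> quadrant d k u);
  ce_phi : lipnear phi q C r;
  ce_psi : lipnear psi (phi q) C r;
  ce_psi_inv : forall u u', `|u - phi q| < r -> `|u' - phi q| < r ->
    `|u - u'| <= C * `|psi u - psi u'|;
  ce_taylor : forall u u', `|u - phi q| < r -> `|u' - phi q| < r ->
    `|psi u - psi u' - (u - u') *m J u'| <= C * `|u - u'| ^+ 2;
  ce_J : forall u u' (h : 'rV[R]_n), `|u - phi q| < r -> `|u' - phi q| < r ->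
    `|h *m J u - h *m J u'| <= C * `|u - u'| * `|h|;
  ce_inj : forall u (h : 'rV[R]_n), `|u - phi q| < r -> `|h| <= C * `|h *m J u|;
  ce_bound : forall u (h : 'rV[R]_n), `|u - phi q| < r -> `|h *m J u| <= C * `|h|;
  ce_smooth : forall j, smooth V (fun u => psi u 0 j);
  ce_smoothJ : forall i j, smooth V (fun u => J u i j) }.

Lemma chart_estP n (d k : nat) (Q : set 'rV[R]_n) (q : 'rV[R]_n) (U : set 'rV[R]_n)
    (phi : 'rV[R]_n -> 'rV[R]_n) : corner_chart Q q d k U phi ->
  exists psi J V C r, chart_est d k Q q phi psi J V C r.
Proof.
move=> [V [psi [Uq [[/open_popen oU /open_popen oV] sphi spsi hphi hpsi] hQ]]].
have Vq : V (phi q) := (hphi q Uq).1.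
have sfi i : smooth U (fun y => phi y 0 i) by move=> j; apply: Ck_Dk => //; exact: sphi.
have spi i : smooth V (fun y => psi y 0 i) by move=> j; apply: Ck_Dk => //; exact: spsi.
have /choice[F hF] : forall i, exists G : 'rV[R]_n -> 'rV[R]_n,
    [/\ forall x, U x -> hasgrad (fun y => phi y 0 i) x (G x), forall j, smooth U (fun x => G x 0 j)
    & exists2 d, 0 < d & forall y, `|y - q| < d -> U y /\ `|G y| <= `|G q| + 1].
  by move=> i; have [G h1 [h2 h3]] := smooth_grad oU (sfi i) Uq; exists G.
have /choice[G hG] : forall i, exists G : 'rV[R]_n -> 'rV[R]_n,
    [/\ forall x, V x -> hasgrad (fun y => psi y 0 i) x (G x), forall j, smooth V (fun x => G x 0 j)
    & exists2 d, 0 < d & forall y, `|y - phi q| < d -> V y /\ `|G y| <= `|G (phi q)| + 1].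
  by move=> i; have [H h1 [h2 h3]] := smooth_grad oV (spi i) Vq; exists H.
pose J u : 'M[R]_n := \matrix_(j, a) G a u 0 j.
have JE h u a : (h *m J u) 0 a = dot (G a u) h.
  by rewrite mxE /dot; apply: eq_bigr => j _; rewrite mxE mulrC.
have hG1 a := let: And3 h _ _ := hG a in h.
have hG2 a := let: And3 _ h _ := hG a in h.
have hF1 a := let: And3 h _ _ := hF a in h.
have evU : ev (fun C r => forall y, `|y - q| < r -> U y).
  have [e e0 he] := oU q Uq; exists 0, e; split=> // C' r' _ /andP[_ rr] y hy.
  by have := he (y - q); rewrite [q + _]addrC subrK; apply; exact: lt_le_trans hy rr.
have evV : ev (fun C r => forall y, `|y - phi q| < r -> V y).
  have [e e0 he] := oV _ Vq; exists 0, e; split=> // C' r' _ /andP[_ rr] y hy.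
  by have := he (y - phi q); rewrite [phi q + _]addrC subrK; apply; exact: lt_le_trans hy rr.
have evB (H : 'I_n -> 'rV[R]_n -> 'rV[R]_n) (W : set 'rV[R]_n) p : (forall i, exists2 d, 0 < d &
    forall y, `|y - p| < d -> W y /\ `|H i y| <= `|H i p| + 1) ->
    ev (fun C r => forall i y, `|y - p| < r -> `|H i y| <= C).
  move=> hH; apply: ev_all => i; have [e e0 he] := hH i.
  exists (`|H i p| + 1), e; split=> // C' r' CC /andP[_ rr] y hy.
  by apply: le_trans CC; exact: (he _ (lt_le_trans hy rr)).2.
have evF := evB F U q (fun i => let: And3 _ _ h := hF i in h).
have evG := evB G V (phi q) (fun i => let: And3 _ _ h := hG i in h).
have [C [r [C1 r0]]] := ev_ex (ev_and evU (ev_and evV (ev_and evF (ev_and evG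
  (ev_and (lip_smooth oU sfi Uq) (ev_and (lip_smooth oV spi Vq) (ev_and
  (ev_all (fun a => taylor_scalar oV (hG1 a) (hG2 a) Vq))
  (ev_all (fun a => lip_smooth oV (hG2 a) Vq))))))))).
move=> [hU [hV [hFb [hGb [lphi [lpsi [tay lG]]]]]]].
have C0 : 0 < C by lra.
(* The factor pays for passing from scalar products to norms. The radius [r / C] makes [psi] map the
   ball around [phi q] into the ball of radius [r] around [q]. *)
pose C' := n.+1%:R * C; pose r' := r / C.
have r'r : r' <= r by rewrite ler_pdivrMr // ler_peMr // ltW.
have CC : C <= C' by rewrite ler_peMl ?(ltW C0) // ler1n.
have nC : n%:R * C <= C' by rewrite ler_wpM2r ?(ltW C0) // ler_nat.
have small s : s < r' -> s < r by move=> /lt_le_trans; apply.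
have psi_near u : `|u - phi q| < r' -> `|psi u - q| < r.
  move=> hu; rewrite -[q in psi u - q](hphi q Uq).2; apply: le_lt_trans (lpsi _ _ _ _) _.
  - exact: small.
  - by rewrite subrr normr0.
  - by rewrite mulrC -ltr_pdivlMr.
exists psi, J, V, C', r'; split.
- by rewrite divr_gt0.
- by lra.
- exact: oV.
- by move=> u /small /hV.
- by move=> y /small /hU /hphi [].
- by move=> y /small /hU /hQ.
- by move=> u /small /hV /hpsi [/hQ h E]; rewrite h E.
- move=> y y' /small h1 /small h2; apply: le_trans (lphi _ _ h1 h2) _; exact: ler_wpM2r.
- move=> y y' /small h1 /small h2; apply: le_trans (lpsi _ _ h1 h2) _; exact: ler_wpM2r.
- move=> u u' h1 h2; have [_ E1] := hpsi _ (hV _ (small _ h1)).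
  have [_ E2] := hpsi _ (hV _ (small _ h2)).
  rewrite -[in leLHS]E1 -[in leLHS]E2; apply: le_trans (lphi _ _ (psi_near _ h1) (psi_near _ h2)) _.
  exact: ler_wpM2r.
- move=> u u' /small h1 /small h2; apply: norm_le => [|a].
    by apply: mulr_ge0; [lra|exact: sqr_ge0].
  have := tay a u u' h1 h2; rewrite -JE !mxE => /le_trans; apply.
  by apply: ler_wpM2r => //; exact: sqr_ge0.
- move=> u u' h /small h1 /small h2; apply: norm_le => [|a].
    by apply: mulr_ge0 => //; apply: mulr_ge0 => //; lra.
  have -> : (h *m J u - h *m J u') 0 a = dot (G a u - G a u') h by rewrite dotBl -!JE !mxE.
  apply: le_trans (dot_le _ _) _.
  apply: ler_wpM2r => //; apply: (@le_trans _ _ (n%:R * (C * `|u - u'|))).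
    by apply: ler_wpM2l => //; exact: lG.
  by rewrite mulrA; apply: ler_wpM2r.
- move=> u h h1; apply: norm_le => [|i]; first by apply: mulr_ge0 => //; lra.
  have Vu := hV _ (small _ h1); have [Up E] := hpsi u Vu.
  (* The injectivity estimate for [J u] comes from differentiating the identity
     [phi (psi v) = v]. *)
  have hc := hasgrad_comp (fun a => hG1 a u Vu)
    (hF1 i _ Up).
  have hi : hasgrad (fun v => phi (psi v) 0 i) u (delta_mx 0 i).
    apply: hasgrad_ext (hasgrad_coord u i) _; have [e e0 he] := oV u Vu.
    by exists e => // t /he /hpsi[_ ->].
  have -> : h 0 i = dot (F i (psi u)) (h *m J u).
    rewrite -dot_delta dotC -(hasgrad_unique hc hi) dot_suml; apply: eq_bigr => a _.
    by rewrite dotZl JE.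
  apply: le_trans (dot_le _ _) _; apply: ler_wpM2r => //; apply: le_trans nC.
  by apply: ler_wpM2l => //; apply: hFb; exact: psi_near.
- move=> u h /small h1; apply: norm_le => [|a]; first by apply: mulr_ge0 => //; lra.
  rewrite JE; apply: le_trans (dot_le _ _) _; apply: ler_wpM2r => //; apply: le_trans nC.
  by apply: ler_wpM2l => //; exact: hGb.
- exact: spi.
- move=> i j t; have [_ sG _] := hG j.
  by apply: (Dk_fext (g := fun u => G j u 0 i)); [move=> u; rewrite mxE|exact: sG].
Qed.

End Charts.

(** * The retraction of the tube *)

Section Gradients.
Variable R : realType.

Lemma small_zero (a K t0 : R) : 0 <= K -> 0 < t0 -> (forall t, 0 < t < t0 -> `|a| <= K * t) -> a = 0.
Proof.
move=> K0 t00 h; apply/eqP; rewrite -normr_le0 leNgt; apply/negP => a0.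
pose t := Num.min (t0 / 2) (`|a| / (2 * (K + 1))).
have K1 : 0 < K + 1 by lra.
have tp : 0 < t by rewrite lt_min !divr_gt0 // mulr_gt0.
have tt0 : t < t0 by apply: (@le_lt_trans _ _ (t0 / 2)); [rewrite ge_min lexx|lra].
have ht : t * (2 * (K + 1)) <= `|a| by rewrite -ler_pdivlMr ?mulr_gt0 // ge_min lexx orbT.
have := h t; rewrite tp tt0 => /(_ isT); nra.
Qed.

Lemma norm_row_mx m n (a : 'rV[R]_m) (b : 'rV[R]_n) c : 0 <= c -> `|a| <= c -> `|b| <= c ->
  `|row_mx a b| <= c.
Proof.
move=> c0 ha hb; apply: norm_le => // i; rewrite -(splitK i).
case: (fintype.split i) => j /=; rewrite ?row_mxEl ?row_mxEr.
  exact: le_trans (norm_coord _ _) ha.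
exact: le_trans (norm_coord _ _) hb.
Qed.

Lemma dot_row_mx m n (g : 'rV[R]_(m + n)) (a : 'rV[R]_m) (b : 'rV[R]_n) :
  dot g (row_mx a b) = dot (lsubmx g) a + dot (rsubmx g) b.
Proof.
rewrite /dot big_split_ord /=; congr (_ + _); apply: eq_bigr => i _.
  by rewrite row_mxEl mxE.
by rewrite row_mxEr mxE.
Qed.

Lemma hasgrad_exact m (f : 'rV[R]_m -> R) x g :
  (forall h, f (x + h) - f x = dot g h) -> hasgrad f x g.
Proof. by move=> hf e e0; exists 1 => // h _; rewrite hf subrr normr0 mulr_ge0 // ltW. Qed.

Lemma hasgrad_left m n (H : 'rV[R]_(m + n) -> R) a b g : hasgrad H (row_mx a b) g ->
  hasgrad (fun v => H (row_mx v b)) a (lsubmx g).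
Proof.
move=> hH e e0; have [d d0 hd] := hH e e0; exists d => // h hh.
have nh : `|row_mx h (0 : 'rV[R]_n)| <= `|h| by apply: norm_row_mx; rewrite ?normr0.
have := hd _ (le_lt_trans nh hh); rewrite add_row_mx addr0 dot_row_mx.
have -> : dot (rsubmx g) 0 = 0 by rewrite dotC dot0l.
by rewrite addr0 => /le_trans; apply; apply: ler_wpM2l => //; exact: ltW.
Qed.

Lemma hasgrad_right m n (H : 'rV[R]_(m + n) -> R) a b g : hasgrad H (row_mx a b) g ->
  hasgrad (fun v => H (row_mx a v)) b (rsubmx g).
Proof.
move=> hH e e0; have [d d0 hd] := hH e e0; exists d => // h hh.
have nh : `|row_mx (0 : 'rV[R]_m) h| <= `|h| by apply: norm_row_mx; rewrite ?normr0.
have := hd _ (le_lt_trans nh hh); rewrite add_row_mx addr0 dot_row_mx.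
have -> : dot (lsubmx g) 0 = 0 by rewrite dotC dot0l.
by rewrite add0r => /le_trans; apply; apply: ler_wpM2l => //; exact: ltW.
Qed.

Lemma unitmx_inj n (A : 'M[R]_n) : (forall v : 'rV[R]_n, v *m A = 0 -> v = 0) -> A \in unitmx.
Proof.
move=> h; rewrite -row_free_unit -kermx_eq0; apply/eqP/row_matrixP => i.
by rewrite row0; apply: h; rewrite -row_mul mulmx_ker row0.
Qed.

Lemma dot_mulmx n (h : 'rV[R]_n) (A : 'M[R]_n) w :
  dot w (h *m A) = \sum_j h 0 j * dot w (row j A).
Proof.
rewrite /dot; under eq_bigr => i _ do rewrite mxE mulr_sumr.
rewrite exchange_big; apply: eq_bigr => j _; rewrite mulr_sumr; apply: eq_bigr => i _.
by rewrite mxE mulrCA.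
Qed.

End Gradients.

(** * Foot points: uniqueness, Lipschitz dependence, orthogonality *)

Section Tube.
Variable R : realType.
Variables (n d : nat) (Q : set 'rV[R]_n).
Hypotheses (dQ : dP Q) (mQ : submanifold_corners d Q).

Definition tub (w y : 'rV[R]_n) := Q y /\ forall y', Q y' ->
  4 * `|dot (w - y) (y' - y)| <= dot (y' - y) (y' - y).

Definition tube w := exists y, tub w y.

Definition retr w : 'rV[R]_n := if pselect (tube w) is left h then sval (cid h) else 0.

Lemma retrP w : tube w -> tub w (retr w).
Proof. by move=> h; rewrite /retr; case: pselect => // h'; exact: svalP (cid h'). Qed.

Lemma tub_self q : Q q -> tub q q.
Proof. by move=> Qq; split=> // y' _; rewrite subrr dot0l normr0 mulr0 dot_ge0. Qed.

(** Each foot point is tested against the other. The sum of the two inequalities uses up half of the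
    squared distance of [y1] and [y2], and the other half is bounded by the scalar product of
    [w1 - w2] and [y1 - y2]. The factor [n] is due to the maximum norm. *)
Lemma tub_lip w1 w2 y1 y2 : tub w1 y1 -> tub w2 y2 -> `|y1 - y2| <= 2 * n%:R * `|w1 - w2|.
Proof.
move=> [Q1 h1] [Q2 h2]; have {h1} := h1 _ Q2; have {h2} := h2 _ Q1.
have E : dot (w1 - w2) (y1 - y2) =
   - dot (w1 - y1) (y2 - y1) + dot (y1 - y2) (y1 - y2) - dot (w2 - y2) (y1 - y2).
  by rewrite -dotNr opprB -dotDl -dotBl; congr dot; apply/rowP => i; rewrite !mxE; ring.
have E2 : dot (y2 - y1) (y2 - y1) = dot (y1 - y2) (y1 - y2).
  by rewrite -opprB dotNl dotNr opprK.
rewrite E2 => h2 h1.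
have h3 : dot (y1 - y2) (y1 - y2) <= 2 * (n%:R * `|w1 - w2| * `|y1 - y2|).
  have := dot_le (w1 - w2) (y1 - y2).
  have := ler_norm (dot (w1 - w2) (y1 - y2)); rewrite E.
  have := ler_norm (dot (w1 - y1) (y2 - y1)); have := ler_norm (dot (w2 - y2) (y1 - y2)).
  by move: h1 h2; lra.
have h4 := le_trans (dot_ge (y1 - y2)) h3.
have [->|y0] := eqVneq `|y1 - y2| 0; first by rewrite !mulr_ge0.
rewrite -(ler_pM2r (_ : 0 < `|y1 - y2|)); last by rewrite lt_def y0 normr_ge0.
by move: h4; rewrite expr2 !mulrA.
Qed.

Lemma tub_unique w y1 y2 : tub w y1 -> tub w y2 -> y1 = y2.
Proof.
move=> h1 h2; apply/eqP; rewrite -subr_eq0 -normr_le0.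
by have := tub_lip h1 h2; rewrite subrr normr0 mulr0.
Qed.

Lemma retr_lip w1 w2 : tube w1 -> tube w2 -> `|retr w1 - retr w2| <= 2 * n%:R * `|w1 - w2|.
Proof. by move=> /retrP h1 /retrP h2; exact: tub_lip. Qed.

Lemma retr_id q : Q q -> retr q = q.
Proof. by move=> Qq; apply: (tub_unique (w := q)); [apply: retrP; exists q|]; exact: tub_self. Qed.

Lemma dP_tub : dP (fun p : 'rV[R]_n * 'rV[R]_n => tub p.1 p.2).
Proof.
rewrite /tub; apply: dP_and; first by dtac.
apply: dP_all; apply: dP_imp; first by dtac.
apply: dP_le; last by apply: dfun_dot; dtac.
by apply: dfun_mul; [dtac|apply: dfun_norm; apply: dfun_dot; dtac].
Qed.

Lemma dP_tube : dP tube.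
Proof. by have dt := dP_tub; rewrite /tube; dtac. Qed.

Lemma dfun_retr : dfun retr.
Proof.
have dt := dP_tub; have dG := dP_tube.
apply: (@dfun_unique _ _ _ _ _ (fun w y => tub w y \/ (~ tube w /\ y = 0))); first by dtac.
move=> w y; split=> [<-|[hy|[nw ->]]].
- have [h|h] := pselect (tube w); first by left; exact: retrP.
  by right; split=> //; rewrite /retr; case: pselect => // h'; case: (h h').
- by apply: (tub_unique _ hy); apply: retrP; exists y.
- by rewrite /retr; case: pselect => // h'; case: (nw h').
Qed.

Lemma chart_ex q : Q q -> exists k phi psi J V C r, chart_est d k Q q phi psi J V C r.
Proof.
move=> Qq; have [k [U [phi [_ /chart_estP h]]]] := mQ.2 q Qq.
by have [psi [J [V [C [r hr]]]]] := h; exists k, phi, psi, J, V, C, r.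
Qed.

Section InChart.
Variables (k : nat) (q : 'rV[R]_n) (phi psi : 'rV[R]_n -> 'rV[R]_n) (J : 'rV[R]_n -> 'M[R]_n).
Variables (V : set 'rV[R]_n) (C r : R).
Hypothesis ce : chart_est d k Q q phi psi J V C r.

(** Raising the [j]-th coordinate keeps [u] in the quadrant, and along this move the right side of
    the tube inequality is quadratic. The absolute value then makes the linear term vanish, although
    at a face only one direction of the move is available. *)
Lemma tub_normal_dir w u (j : 'I_n) : `|u - phi q| < r -> tub w (psi u) -> (j < d)%N ->
  dot (w - psi u) (row j (J u)) = 0.
Proof.
move=> ur [Qu hu] jd; have C1 := ce_C ce.
pose K := n%:R * C ^+ 2 + n%:R * `|w - psi u| * C.
apply: (@small_zero _ _ K (r - `|u - phi q|)).
- by rewrite addr_ge0 // !mulr_ge0 ?sqr_ge0 //; lra.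
- by rewrite subr_gt0.
move=> t /andP[t0 tr]; pose u' := u + t *: delta_mx 0 j.
have nd : `|t *: delta_mx 0 j : 'rV[R]_n| <= t.
  by rewrite normrZ gtr0_norm // -[leRHS]mulr1 ler_wpM2l ?norm_delta // ltW.
have ur' : `|u' - phi q| < r.
  rewrite /u' addrAC; apply: le_lt_trans (ler_normD _ _) _.
  by rewrite -ltrBrDl; exact: le_lt_trans nd tr.
have Qu' : Q (psi u').
  apply/(ce_Qpsi ce ur') => i; have [h1 h2] := (ce_Qpsi ce ur).1 Qu i.
  rewrite !mxE eqxx /=; split=> [/h1 hi|di]; first by rewrite addr_ge0 // mulr_ge0 // ltW.
  by rewrite (h2 di); case: eqP => [E|_]; [move: di; rewrite leqNgt E jd|rewrite mulr0 addr0].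
have := hu _ Qu'; set D := psi u' - psi u => hD.
have nu : `|u' - u| <= t by rewrite /u' addrC addKr.
have h1 : dot D D <= n%:R * (C * t) ^+ 2.
  apply: le_trans (ler_norm _) _; apply: le_trans (dot_le _ _) _.
  rewrite -mulrA -expr2; apply: ler_wpM2l => //.
  apply: lerXn2r; rewrite ?nnegrE //; first by rewrite mulr_ge0 ?(ltW t0) //; lra.
  by apply: le_trans (ce_psi ce ur' ur) _; apply: ler_wpM2l => //; lra.
have h2 : `|D - t *: row j (J u)| <= C * t ^+ 2.
  have := ce_taylor ce ur' ur; rewrite {2}/u' [u + _ - u]addrC addKr -scalemxAl -rowE.
  move=> /le_trans; apply; apply: ler_wpM2l; first by lra.
  by apply: lerXn2r; rewrite ?nnegrE ?(ltW t0).
have h3 := le_trans (dot_le (w - psi u) (D - t *: row j (J u))) (ler_wpM2l (mulr_ge0 (ler0n _ _) (normr_ge0 _)) h2).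
have h4 : t * `|dot (w - psi u) (row j (J u))| <= `|dot (w - psi u) D| + `|dot (w - psi u) (D - t *: row j (J u))|.
  rewrite -[X in X * _]gtr0_norm // -normrM -dotZr.
  have -> : dot (w - psi u) (t *: row j (J u)) = dot (w - psi u) D - dot (w - psi u) (D - t *: row j (J u)).
    by rewrite -dotBr; congr dot; rewrite opprB addrC subrK.
  exact: ler_normB.
rewrite -(ler_pM2l t0); apply: le_trans h4 _.
have -> : t * (K * t) = n%:R * (C * t) ^+ 2 + n%:R * `|w - psi u| * (C * t ^+ 2) by rewrite /K; ring.
apply: lerD h3; apply: le_trans _ h1; apply: le_trans _ hD.
by rewrite ler_peMl // ler1n.
Qed.

End InChart.

End Tube.

(** * Smoothness of the foot point by the implicit function theorem *)

Section Retraction.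
Variable R : realType.
Variables (n d : nat) (Q : set 'rV[R]_n).
Hypotheses (dQ : dP Q) (mQ : submanifold_corners d Q).

Definition tubeint (w : 'rV[R]_n) := exists2 e : R, 0 < e & forall h, `|h| < e -> tube Q (w + h).

Lemma tubeint_tube w : tubeint w -> tube Q w.
Proof. by move=> [e e0 he]; rewrite -[w]addr0; apply: he; rewrite normr0. Qed.

Lemma popen_tubeint : popen tubeint.
Proof.
move=> w [e e0 he]; exists (e / 2) => [|h hh]; first by rewrite divr_gt0.
exists (e / 2) => [|k hk]; first by rewrite divr_gt0.
by rewrite -addrA; apply: he; apply: le_lt_trans (ler_normD _ _) _; lra.
Qed.

Lemma dP_tubeint : dP tubeint.
Proof.
have dG := dP_tube dQ.
apply: (@dP_ext _ _ _ (fun w => exists e, 0 < e /\ forall h : 'rV[R]_n, `|h| < e -> tube Q (w + h))).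
  by move=> w; split=> [[e [e0 he]]|[e e0 he]]; exists e.
by dtac.
Qed.

Section InChart.
Variables (k : nat) (q : 'rV[R]_n) (phi psi : 'rV[R]_n -> 'rV[R]_n) (J : 'rV[R]_n -> 'M[R]_n).
Variables (V : set 'rV[R]_n) (C r : R).
Hypothesis ce : chart_est d k Q q phi psi J V C r.

(* First order conditions for [psi v] to be the foot point of [w]. *)
Definition foot_eq (j : 'I_n) (z : 'rV[R]_(n + n)) : R :=
  if (j < d)%N
  then \sum_a (z 0 (rshift n a) - psi (lsubmx z) 0 a) * J (lsubmx z) j a
  else z 0 (lshift n j).

Lemma foot_eqE j v w : foot_eq j (row_mx v w) =
  if (j < d)%N then dot (w - psi v) (row j (J v)) else v 0 j.
Proof.
rewrite /foot_eq row_mxEl row_mxKl; case: ifP => // _.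
by apply: eq_bigr => a _; rewrite row_mxEr !mxE.
Qed.

Let V' : set 'rV[R]_(n + n) := fun z => V (lsubmx z).

Lemma popen_V' : popen V'.
Proof.
move=> z /(ce_openV ce)[e e0 he]; exists e => // h hh.
rewrite /V' linearD; apply: he; apply: le_lt_trans hh; apply: norm_le => // i.
by rewrite mxE; exact: norm_coord.
Qed.

Lemma smooth_foot_eq j : smooth V' (foot_eq j).
Proof.
have sl t i : Dk t V' (fun z => (lsubmx z : 'rV[R]_n) 0 i).
  by apply: (Dk_fext (g := fun z : 'rV[R]_(n + n) => z 0 (lshift n i))) => [z|];
    [rewrite mxE|exact: Dk_coord].
move=> t; rewrite /foot_eq; case: (j < d)%N; last exact: Dk_coord.
apply: Dk_sum => a; apply: Dk_mul.
  apply: Dk_add; first exact: Dk_coord.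
  apply: Dk_opp; apply: (@Dk_comp _ _ _ _ V' V (fun v => psi v 0 a) (fun z => lsubmx z)) => //.
  exact: (ce_smooth ce).
apply: (@Dk_comp _ _ _ _ V' V (fun v => J v j a) (fun z => lsubmx z)) => //.
exact: (ce_smoothJ ce).
Qed.

Let W : set 'rV[R]_n := fun w => tubeint w /\ `|retr Q w - q| < r / C.

Lemma C_gt0 : 0 < C. Proof. by have := ce_C ce; lra. Qed.

Lemma W_r w : W w -> `|retr Q w - q| < r.
Proof.
move=> [_ h]; apply: lt_le_trans h _; rewrite ler_pdivrMr ?C_gt0 //.
by rewrite ler_peMr ?(ltW (ce_r ce)) //; exact: ce_C ce.
Qed.

Lemma W_phi w : W w -> `|phi (retr Q w) - phi q| < r.
Proof.
move=> Ww; apply: le_lt_trans (ce_phi ce (W_r Ww) _) _.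
  by rewrite subrr normr0; exact: ce_r ce.
by rewrite mulrC -ltr_pdivlMr ?C_gt0 //; exact: Ww.2.
Qed.

Lemma W_open x : W x -> exists2 e : R, 0 < e & forall h, `|h| < e ->
  W (x + h) /\ `|phi (retr Q (x + h)) - phi (retr Q x)| <= C * (2 * n%:R) * `|h|.
Proof.
move=> Wx; have [ti nx] := Wx; have [e e0 he] := popen_tubeint ti.
have x0 : 0 < r / C - `|retr Q x - q| by rewrite subr_gt0.
pose e' := (r / C - `|retr Q x - q|) / (2 * n%:R + 1).
have n1 : 0 < 2 * n%:R + 1 :> R by have := ler0n R n; lra.
exists (Num.min e e') => [|h]; first by rewrite lt_min e0 divr_gt0.
rewrite lt_min => /andP[h1 h2]; have ti' := he h h1.
have lip : `|retr Q (x + h) - retr Q x| <= 2 * n%:R * `|h|.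
  by have := retr_lip (tubeint_tube ti') (tubeint_tube ti); rewrite [x + h]addrC addrK.
have Wh : W (x + h).
  split=> //; move: h2; rewrite ltr_pdivlMr // => h2.
  have := ler_normD (retr Q (x + h) - retr Q x) (retr Q x - q); rewrite addrA subrK.
  by have := normr_ge0 h; lra.
split=> //; apply: le_trans (ce_phi ce (W_r Wh) (W_r Wx)) _.
by rewrite -mulrA; apply: ler_wpM2l => //; exact: ltW C_gt0.
Qed.

Lemma foot_eq0 w j : W w -> foot_eq j (row_mx (phi (retr Q w)) w) = 0.
Proof.
move=> Ww; rewrite foot_eqE; have t := retrP (tubeint_tube Ww.1).
have E := ce_phiK ce (W_r Ww); case: ifP => jd.
  by apply: (tub_normal_dir ce (W_phi Ww)) => //; rewrite E.
by apply: (((ce_Q ce (W_r Ww)).1 t.1) j).2; rewrite leqNgt jd.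
Qed.

(* The retraction is Lipschitz and defined on a whole neighborhood, so the
   equation forces any linear relation between the derivatives of the foot
   equations in the chart variable to also hold for those in [w]; these are
   visibly independent. *)
Lemma foot_unit x (g : 'I_n -> 'rV[R]_(n + n)) : W x ->
  (forall j, hasgrad (foot_eq j) (row_mx (phi (retr Q x)) x) (g j)) ->
  \matrix_(j, i) g j 0 (lshift n i) \in unitmx.
Proof.
move=> Wx hg; apply: unitmx_inj => l; set A := \matrix_(_, _) _ => lA.
pose H z := dot l (\row_j foot_eq j z); pose G := \sum_j l 0 j *: g j.
pose u w := phi (retr Q w).
have hH : hasgrad H (row_mx (u x) x) G.
  apply: (hasgrad_comp (F := dot l) (u := fun z => \row_j foot_eq j z)) => [j|].
    by apply: hasgrad_ext (hg j) _; exists 1 => // h _; rewrite mxE.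
  by apply: hasgrad_exact => h; rewrite dotDr addrC addKr.
have Gl : lsubmx G = 0.
  rewrite -lA; apply/rowP => i; rewrite !mxE summxE; apply: eq_bigr => j _.
  by rewrite !mxE.
have H0 w : W w -> H (row_mx (u w) w) = 0.
  move=> Ww; rewrite /H; have -> : \row_j foot_eq j (row_mx (u w) w) = 0 by apply/rowP => j; rewrite [LHS]mxE foot_eq0 // mxE.
  by rewrite dotC dot0l.
have Gr : rsubmx G = 0.
  apply: (@hasgrad_unique _ _ (fun _ => 0) x); last exact: hasgrad_cst.
  move=> e e0; have [e1 e10 he1] := W_open Wx.
  pose K := C * (2 * n%:R) + 1.
  have K1 : 1 <= K by rewrite lerDr !mulr_ge0 //; exact: ltW C_gt0.
  have [|e2 e20 he2] := hH (e / K); first by rewrite divr_gt0 //; lra.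
  exists (Num.min e1 (e2 / K)) => [|h]; first by rewrite lt_min e10 divr_gt0 //; lra.
  rewrite lt_min ltr_pdivlMr; last by lra.
  move=> /andP[/he1 [Wh hu] h2].
  have nz : `|row_mx (u (x + h) - u x) h| <= K * `|h|.
    apply: norm_row_mx; first by rewrite mulr_ge0 //; lra.
      by apply: le_trans hu _; apply: ler_wpM2r => //; rewrite lerDl.
    by rewrite ler_peMl.
  have nz2 : `|row_mx (u (x + h) - u x) h| < e2 by apply: le_lt_trans nz _; rewrite mulrC.
  have dE : dot G (row_mx (u (x + h) - u x) h) = dot (rsubmx G) h by rewrite dot_row_mx Gl dot0l add0r.
  have := he2 _ nz2; rewrite dE add_row_mx [u x + _]addrC subrK H0 // H0 //.
  move=> hh; rewrite /=; apply: le_trans hh _; rewrite -mulrA; apply: ler_wpM2l; first exact: ltW.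
  by rewrite mulrC ler_pdivrMr ?[_ * K]mulrC //; lra.
have hu : `|u x - phi q| < r := W_phi Wx.
pose l' : 'rV[R]_n := \row_j if (j < d)%N then l 0 j else 0.
have hr := hasgrad_right hH; rewrite Gr in hr.
have hr' : hasgrad (fun w => H (row_mx (u x) w)) x (l' *m J (u x)).
  apply: hasgrad_exact => h; rewrite /H /dot -sumrB -/(dot _ h) dotC dot_mulmx.
  apply: eq_bigr => j _; rewrite !mxE !foot_eqE; case: ifP => _; last by rewrite subrr mul0r.
  by rewrite -mulrBr -dotBl; congr (_ * dot _ _); apply/rowP => i; rewrite !mxE; ring.
have l'0 : l' = 0.
  apply/eqP; rewrite -normr_le0; apply: le_trans (ce_inj ce l' hu) _.
  by rewrite -(hasgrad_unique hr hr') normr0 mulr0.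
have l0 (j : 'I_n) : (j < d)%N -> l 0 j = 0.
  by move=> jd; have /rowP/(_ j) := l'0; rewrite !mxE jd.
(* With the coefficients of index below [d] gone, [H] is linear in the chart variable with
   coefficient vector [l], while its gradient in that variable is zero. *)
have hl := hasgrad_left hH; rewrite Gl in hl.
apply: (hasgrad_unique _ hl); apply: hasgrad_exact => h.
rewrite /H /dot -sumrB; apply: eq_bigr => j _; rewrite !mxE !foot_eqE; case: ifP => jd.
  by rewrite l0 // !mul0r subrr.
by rewrite !mxE mulrDr [_ + l 0 j * h 0 j]addrC addrK.
Qed.

Lemma smooth_retr_chart j : smooth W (fun w => retr Q w 0 j).
Proof.
have oW : popen W by move=> x /W_open[e e0 he]; exists e => // h /he [].
have /choice[g hg] : forall j, exists g, (forall z, V' z -> hasgrad (foot_eq j) z (g z)) /\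
    forall i, smooth V' (fun z => g z 0 i).
  by move=> i; have [g h1 h2] := smoothP popen_V' (smooth_foot_eq i); exists g.
have VW x : W x -> V' (row_mx (phi (retr Q x)) x).
  by move=> Wx; rewrite /V' row_mxKl; apply: (ce_V ce); exact: W_phi.
have su i : smooth W (fun w => phi (retr Q w) 0 i).
  apply: (@implicit_smooth _ _ _ W V' (fun w => phi (retr Q w)) foot_eq g) => //.
  - move=> x Wx e e0; have [e1 e10 he1] := W_open Wx; set K := C * _ in he1.
    have K0 : 0 <= K by rewrite !mulr_ge0 //; exact: ltW C_gt0.
    exists (Num.min e1 (e / (K + 1))) => [|h]; first by rewrite lt_min e10 divr_gt0 //; lra.
    rewrite lt_min ltr_pdivlMr => [/andP[/he1[_ h1] h2]|]; last by lra.
    by apply: le_lt_trans h1 _; have := normr_ge0 h; lra.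
  - by move=> x i' Wx; exact: foot_eq0.
  - by move=> i' z Vz; exact: (hg i').1.
  - by move=> i' a; exact: (hg i').2.
  - by move=> x Wx; apply: (foot_unit Wx) => i'; apply: (hg i').1; exact: VW.
move=> t; apply: (Dk_ext (f := fun w => psi (phi (retr Q w)) 0 j)) => //.
  by move=> w Ww; rewrite (ce_phiK ce) //; exact: W_r.
apply: (@Dk_comp _ _ _ _ W V (fun v => psi v 0 j) (fun w => phi (retr Q w))) => //.
- by move=> w Ww; apply: (ce_V ce); exact: W_phi.
- by move=> i; exact: su.
- exact: (ce_smooth ce).
Qed.

End InChart.

Lemma smooth_retr j : smooth tubeint (fun w => retr Q w 0 j).
Proof.
move=> t; apply: Dk_local => [|w tw]; first exact: popen_tubeint.
have Qw := (retrP (tubeint_tube tw)).1.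
have [k [phi [psi [J [V [C [r ce]]]]]]] := chart_ex mQ Qw.
exists (fun w' => tubeint w' /\ `|retr Q w' - retr Q w| < r / C); split.
- by move=> x /(W_open ce)[e e0 he]; exists e => // h /he [].
- by split=> //; rewrite subrr normr0 divr_gt0 ?(ce_r ce) // (C_gt0 ce).
- exact: (smooth_retr_chart ce).
Qed.

End Retraction.

(** * Inward directions *)

Section Inward.
Variable R : realType.

Lemma small_le0 (a K t0 : R) : 0 <= K -> 0 < t0 -> (forall t, 0 < t < t0 -> a <= K * t) -> a <= 0.
Proof.
move=> K0 t00 h; rewrite leNgt; apply/negP => a0.
suff E : a = 0 by rewrite E ltxx in a0.
by apply: (small_zero K0 t00) => t /h; rewrite gtr0_norm.
Qed.

Lemma coord_sub m (a b : 'rV[R]_m) i : (a - b) 0 i = a 0 i - b 0 i.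
Proof. by rewrite !mxE. Qed.

Variables (n d : nat) (Q : set 'rV[R]_n).

Section InChart.
Variables (k : nat) (q : 'rV[R]_n) (phi psi : 'rV[R]_n -> 'rV[R]_n) (J : 'rV[R]_n -> 'M[R]_n).
Variables (V : set 'rV[R]_n) (C r : R).
Hypothesis ce : chart_est d k Q q phi psi J V C r.

Lemma C_ge1 : 1 <= C. Proof. exact: ce_C ce. Qed.

(** [Q] is closed near [q]: off the quadrant some coordinate condition is violated by a fixed
    amount, and [phi] is Lipschitz. *)
Lemma compact_near rho : rho < r -> compact [set y | Q y /\ `|y - q| <= rho].
Proof.
move=> rr; apply: (@compact_bounded_closed _ _ _ (`|q| + rho)) => [y [_ hy]|v nv].
  by have := ler_normD (y - q) q; rewrite subrK; lra.
have [vr|vr] := leP `|v - q| rho; last first.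
  exists (`|v - q| - rho) => [|h hh [_ hv]]; first by rewrite subr_gt0.
  have := ler_normB (v + h - q) h; rewrite addrAC addrK; lra.
have vr' := le_lt_trans vr rr.
have nq : ~ quadrant d k (phi v) by move=> hq; apply: nv; split=> //; exact/(ce_Q ce vr').
have [i [e [e0 he]]] : exists i : 'I_n, exists e, 0 < e /\ forall z : 'rV[R]_n, quadrant d k z ->
    e <= `|z 0 i - phi v 0 i|.
  move: nq => /existsNP[i /not_andP[/not_implyP[ik /negP lt0]|/not_implyP[di /eqP z0]]]; exists i.
    rewrite -ltNge in lt0; exists (- phi v 0 i); split=> [|z /(_ i)[/(_ ik) zi _]]; first by lra.
    by apply: le_trans (ler_norm _); lra.
  exists `|phi v 0 i|; split=> [|z /(_ i)[_ /(_ di) ->]]; first by rewrite normr_gt0.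
  by rewrite sub0r normrN.
have C1 := C_ge1; exists (Num.min (r - `|v - q|) (e / C)) => [|h].
  by rewrite lt_min subr_gt0 vr' divr_gt0 //; lra.
rewrite lt_min ltr_pdivlMr => [/andP[h1 h2]|]; last by lra.
have hr : `|v + h - q| < r by rewrite addrAC; apply: le_lt_trans (ler_normD _ _) _; lra.
move=> [/(ce_Q ce hr) /he e1 _].
have := norm_coord (phi (v + h) - phi v) i; rewrite coord_sub => e2.
have := ce_phi ce hr vr'; rewrite [v + h]addrC addrK [h + v]addrC => e3.
by have := le_lt_trans (le_trans e1 (le_trans e2 e3)); rewrite mulrC => /(_ _ h2); rewrite ltxx.
Qed.

(** A nearest point among those of [Q] in a ball, since [Q] is only known to be closed locally. The
    strict inequality leaves room to vary the minimizer. *)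
Definition proj_min (rho : R) w y := [/\ Q y, `|y - q| < rho & forall y', Q y' -> `|y' - q| <= rho ->
  dot (w - y) (w - y) <= dot (w - y') (w - y')].

Lemma proj_min_ex rho w : 0 < rho < r -> Q q -> (n%:R + 2) * `|w - q| < rho ->
  exists y, proj_min rho w y /\ `|w - y| <= (n%:R + 1) * `|w - q|.
Proof.
move=> /andP[rho0 rr] Qq wq; pose A := [set y | Q y /\ `|y - q| <= rho].
have A0 : A !=set0 by exists q; split=> //; rewrite subrr normr0 ltW.
have cf : {within A, continuous (fun v : 'rV[R]_n => dot (w - v) (w - v))}.
  apply/within_continuousP => v Av e e0.
  have := @smooth_pcont _ _ setT (fun v : 'rV[R]_n => dot v v) (w - v) _ _ e e0.
  move=> []//; first exact: smooth_dot.
  move=> f f0 hf; exists f => // h hh _; rewrite opprD addrA; apply: hf.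
  by rewrite normrN.
have [y + hmin] := EVT_min_rV A0 (compact_near rr) cf; rewrite inE => -[Qy yr].
have hm y' : Q y' -> `|y' - q| <= rho -> dot (w - y) (w - y) <= dot (w - y') (w - y').
  by move=> Qy' hy'; apply: hmin; rewrite inE.
have n0 : 0 <= n%:R :> R := ler0n _ _.
have wy : `|w - y| <= (n%:R + 1) * `|w - q|.
  have p0 : 0 <= (n%:R + 1) * `|w - q| by rewrite mulr_ge0 // addr_ge0.
  rewrite -ler_sqr; [|by rewrite nnegrE|by rewrite nnegrE].
  apply: le_trans (dot_ge _) _; apply: le_trans (hm q Qq _) _; first by rewrite subrr normr0 ltW.
  apply: le_trans (ler_norm _) _; apply: le_trans (dot_le _ _) _.
  by have := sqr_ge0 `|w - q|; rewrite !expr2; nra.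
exists y; split=> //; split=> //.
have := ler_normB (w - q) (w - y); rewrite opprB addrC addrA subrK; lra.
Qed.

(** First variation of the squared distance when the [j]-th coordinate moves with sign [sg]. At a
    face only one sign is admissible, so an inequality is all that can be obtained. *)
Lemma proj_min_dir rho w u (j : 'I_n) (sg t0 : R) : rho <= r -> `|u - phi q| < r ->
  proj_min rho w (psi u) -> `|sg| <= 1 -> 0 < t0 ->
  (forall t, 0 < t < t0 -> quadrant d k (u + (sg * t) *: delta_mx 0 j)) ->
  sg * dot (w - psi u) (row j (J u)) <= 0.
Proof.
move=> rhor ur [Qu ur' hm] s1 t00 hq; have C1 := C_ge1.
pose t1 := Num.min t0 (Num.min (r - `|u - phi q|) ((rho - `|psi u - q|) / C)).
pose K := n%:R * C ^+ 2 + 2 * n%:R * `|w - psi u| * C.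
have K0 : 0 <= K by rewrite addr_ge0 // !mulr_ge0 ?sqr_ge0 //; lra.
apply: (@small_le0 _ K t1) => // [|t /andP[tp]].
  by rewrite !lt_min t00 subr_gt0 ur divr_gt0 ?subr_gt0 //; lra.
rewrite !lt_min ltr_pdivlMr; last by lra.
move=> /and3P[tt0 tt1 tt2]; pose u' := u + (sg * t) *: delta_mx 0 j.
have nd0 : `|(sg * t) *: delta_mx 0 j : 'rV[R]_n| <= t.
  rewrite normrZ normrM (gtr0_norm tp) mulrAC.
  by rewrite ler_piMl ?(ltW tp) // mulr_ile1 // norm_delta.
have nd : `|u' - u| <= t by rewrite /u' addrC addKr.
have ur1 : `|u' - phi q| < r by have := ler_normD (u' - u) (u - phi q); rewrite addrA subrK; lra.
set D := psi u' - psi u.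
have nD : `|D| <= C * t.
  by apply: le_trans (ce_psi ce ur1 ur) _; apply: ler_wpM2l => //; lra.
have Qu' : Q (psi u') by apply/(ce_Qpsi ce ur1); apply: hq; rewrite tp.
have hD := hm _ Qu' _.
have {hD} : dot (w - psi u) (w - psi u) <= dot (w - psi u') (w - psi u').
  by apply: hD; have := ler_normD D (psi u - q); rewrite /D addrA subrK; lra.
have -> : w - psi u' = (w - psi u) - D by rewrite /D opprB addrA subrK.
rewrite (dotBl (w - psi u) D) !(dotBr (w - psi u) D) (dotC D (w - psi u)) => hD.
have h1 : dot D D <= n%:R * (C * t) ^+ 2.
  apply: le_trans (ler_norm _) _; apply: le_trans (dot_le _ _) _.
  rewrite -mulrA -expr2; apply: ler_wpM2l => //.
  by apply: lerXn2r; rewrite ?nnegrE //; rewrite mulr_ge0 ?(ltW tp) //; lra.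
have h2 : `|D - (sg * t) *: row j (J u)| <= C * t ^+ 2.
  have := ce_taylor ce ur1 ur; rewrite {2}/u' [u + _ - u]addrC addKr -scalemxAl -rowE.
  move=> /le_trans; apply; apply: ler_wpM2l; first by lra.
  by apply: lerXn2r; rewrite ?nnegrE ?(ltW tp).
have h3 := le_trans (dot_le (w - psi u) (D - (sg * t) *: row j (J u))) (ler_wpM2l (mulr_ge0 (ler0n _ _) (normr_ge0 _)) h2).
have h4 : (sg * t) * dot (w - psi u) (row j (J u)) =
    dot (w - psi u) D - dot (w - psi u) (D - (sg * t) *: row j (J u)).
  by rewrite -dotBr -dotZr; congr dot; rewrite opprB addrC subrK.
have h5 := ler_norm (- dot (w - psi u) (D - (sg * t) *: row j (J u))); rewrite normrN in h5.
rewrite -(ler_pM2l tp).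
have -> : t * (K * t) = n%:R * (C * t) ^+ 2 + 2 * (n%:R * `|w - psi u| * (C * t ^+ 2)) by rewrite /K; ring.
have -> : t * (sg * dot (w - psi u) (row j (J u))) = (sg * t) * dot (w - psi u) (row j (J u)) by ring.
have p1 : 0 <= n%:R * (C * t) ^+ 2 by rewrite mulr_ge0 // sqr_ge0.
have p2 := le_trans (normr_ge0 _) h3; rewrite h4; lra.
Qed.

Lemma tub_of_normal w u dl : 0 <= dl -> `|u - phi q| < r -> Q (psi u) -> `|psi u - q| <= dl ->
  `|w - psi u| <= dl -> dl <= r / (2 * C) -> 4 * n%:R * C ^+ 3 * dl <= 1 ->
  4 * n%:R * dl <= r / (2 * C) ->
  (forall j : 'I_n, (j < d)%N -> dot (w - psi u) (row j (J u)) = 0) -> tub Q w (psi u).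
Proof.
move=> dl0 ur Qu uq wu h1 h2 h3 hn; have C1 := C_ge1; split=> // y' Qy'.
have C0 : 0 < C by lra.
have rC : r / C = r / (2 * C) + r / (2 * C) by field; rewrite gt_eqF.
have n0 : 0 <= n%:R :> R := ler0n _ _.
have [yr|yr] := ltP `|y' - q| (r / C); last first.
  have hy : r / (2 * C) <= `|y' - psi u|.
    have := ler_normD (y' - psi u) (psi u - q); rewrite addrA subrK; lra.
  apply: le_trans (dot_ge _); rewrite expr2.
  apply: (@le_trans _ _ (4 * n%:R * dl * `|y' - psi u|)).
    rewrite -!mulrA ler_pM2l ?ltr0n //; apply: le_trans (dot_le _ _) _.
    by rewrite mulrA; apply: ler_wpM2r => //; apply: ler_wpM2l.
  by apply: ler_wpM2r => //; exact: le_trans h3 hy.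
have yr' : `|y' - q| < r.
  by apply: lt_le_trans yr _; rewrite ler_pdivrMr // ler_peMr // ltW // (ce_r ce).
have Pr : `|phi y' - phi q| < r.
  apply: le_lt_trans (ce_phi ce yr' _) _; first by rewrite subrr normr0 (ce_r ce).
  by rewrite mulrC -ltr_pdivlMr.
have E := ce_phiK ce yr'.
have z0 : dot (w - psi u) ((phi y' - u) *m J u) = 0.
  rewrite dot_mulmx big1 // => j _; have [jd|jd] := ltnP j d; first by rewrite hn // mulr0.
  rewrite coord_sub (((ce_Q ce yr').1 Qy') j).2 //.
  by rewrite (((ce_Qpsi ce ur).1 Qu) j).2 // subrr mul0r.
have ht := ce_taylor ce Pr ur; rewrite E in ht.
have hi := ce_psi_inv ce Pr ur; rewrite E in hi.
apply: le_trans (dot_ge _); rewrite -[y' - psi u](subrK ((phi y' - u) *m J u)) in hi *.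
rewrite subrK in hi *.
have -> : dot (w - psi u) (y' - psi u) = dot (w - psi u) (y' - psi u - (phi y' - u) *m J u).
  by rewrite [RHS]dotBr z0 subr0.
apply: (@le_trans _ _ (4 * (n%:R * dl * (C * (C * `|y' - psi u|) ^+ 2)))).
  rewrite ler_pM2l ?ltr0n //; apply: le_trans (dot_le _ _) _; apply: ler_pM => //.
  - exact: ler_wpM2l.
  apply: le_trans ht _; apply: ler_wpM2l; first exact: ltW.
  by apply: lerXn2r; rewrite ?nnegrE // mulr_ge0 // ltW.
have -> : 4 * (n%:R * dl * (C * (C * `|y' - psi u|) ^+ 2)) =
   (4 * n%:R * C ^+ 3 * dl) * `|y' - psi u| ^+ 2 by ring.
by rewrite ler_piMl // sqr_ge0.
Qed.

End InChart.

End Inward.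

Section InwardCone.
Variable R : realType.
Variables (n d : nat) (Q : set 'rV[R]_n).

Let e : 'rV[R]_n := \row_j (j < d)%:R.

Lemma norm_e : `|e| <= 1.
Proof. by apply: norm_le => // j; rewrite mxE; case: (_ < _)%N; rewrite ?normr1 ?normr0. Qed.

Section InChart.
Variables (k : nat) (q : 'rV[R]_n) (phi psi : 'rV[R]_n -> 'rV[R]_n) (J : 'rV[R]_n -> 'M[R]_n).
Variables (V : set 'rV[R]_n) (C r : R).
Hypothesis ce : chart_est d k Q q phi psi J V C r.

(* With [c = s e + (u0 - u)], the vector [w - psi u] is close to [c *m J u], and
   [c] is at least [s] on the coordinates of the faces through [u]. *)
Lemma inward_normal x v' w u u0 (dl s : R) : tub Q x (psi u0) ->
  `|u0 - phi q| <= dl -> `|u - phi q| <= dl -> dl < r -> Q (psi u) -> `|x - psi u0| <= dl ->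
  0 < s -> w = x + s *: v' -> `|v' - e *m J (phi q)| <= dl -> n%:R * (8 * C ^+ 4) * dl < 1 ->
  (forall j : 'I_n, (j < d)%N -> dot (w - psi u) (row j (J u)) <= 0) ->
  (forall j : 'I_n, (j < d)%N -> (k <= j)%N \/ 0 < u 0 j -> dot (w - psi u) (row j (J u)) = 0) ->
  forall j : 'I_n, (j < d)%N -> dot (w - psi u) (row j (J u)) = 0.
Proof.
move=> tx hu0 hu dr Qu hx s0 wE hv hdl nle neq j0 j0d.
have C1 := ce_C ce; have n0 : 0 <= n%:R :> R := ler0n _ _.
have ur : `|u - phi q| < r := le_lt_trans hu dr.
have ur0 : `|u0 - phi q| < r := le_lt_trans hu0 dr.
have dl0 : 0 <= dl := le_trans (normr_ge0 _) hu.
have [kj|kj] := leqP k j0; first by apply: neq => //; left.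
have qu := (ce_Qpsi ce ur).1 Qu; have qu0 := (ce_Qpsi ce ur0).1 tx.1.
have [uj|uj] := ltP 0 (u 0 j0); first by apply: neq => //; right.
have {uj} uj : u 0 j0 = 0 by apply/eqP; rewrite eq_le uj; exact: (qu j0).1.
(* What remains is to exclude that the foot point lies on the face of index [j0]. There
   [c 0 j0 >= s], so [N] dominates [s] and, up to a factor 2, the displacement [u0 - u]: all errors
   can be measured in [N]. *)
exfalso; pose c := s *: e + (u0 - u); set N := `|c|; pose t := c *m J u.
have cE j : c 0 j = if (j < d)%N then s + (u0 0 j - u 0 j) else 0.
  rewrite !mxE; case: ltnP => jd; first by rewrite mulr1.
  by rewrite mulr0 add0r (qu j).2 // (qu0 j).2 // subr0.
have sN : s <= N.
  apply: le_trans (norm_coord c j0); apply: le_trans (ler_norm _).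
  by rewrite cE j0d uj subr0 lerDl; exact: (qu0 j0).1.
have N0 : 0 < N := lt_le_trans s0 sN.
have ct : dot (w - psi u) t <= 0.
  rewrite dot_mulmx; apply: sumr_le0 => j _; rewrite cE; case: ifP => jd; last by rewrite mul0r.
  have [kj'|kj'] := leqP k j; first by rewrite neq ?mulr0 //; left.
  have [uj'|uj'] := ltP 0 (u 0 j); first by rewrite neq ?mulr0 //; right.
  apply: mulr_ge0_le0; last exact: nle.
  by have := (qu0 j).1 kj'; lra.
have hc : `|u0 - u| <= 2 * N.
  have -> : u0 - u = c - s *: e by rewrite /c [s *: e + _]addrC addrK.
  apply: le_trans (ler_normB _ _) _; rewrite normrZ gtr0_norm // -/N.
  have := norm_e; have : s * `|e| <= s * 1 by apply: ler_wpM2l; [exact: ltW|exact: norm_e].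
  lra.
have hc2 : `|u0 - u| <= 2 * dl.
  have := ler_normB (u0 - phi q) (u - phi q); rewrite opprB addrA subrK; lra.
have tN : `|t| <= C * N := ce_bound ce c ur.
have Nt : N <= C * `|t| := ce_inj ce c ur.
have C0 : 0 < C by lra.
have e1 : `|dot (x - psi u0) t| <= n%:R * dl * (C * (2 * N) * N).
  have z0 : dot (x - psi u0) (c *m J u0) = 0.
    rewrite dot_mulmx big1 // => j _; rewrite cE; case: ifP => jd; last by rewrite mul0r.
    by rewrite (tub_normal_dir ce) // mulr0.
  have -> : dot (x - psi u0) t = dot (x - psi u0) (c *m J u - c *m J u0).
    by rewrite (dotBr (c *m J u)) z0 subr0.
  apply: le_trans (dot_le _ _) _; apply: ler_pM => //; first exact: ler_wpM2l.
  apply: le_trans (ce_J ce c ur ur0) _; apply: ler_wpM2r => //; apply: ler_wpM2l; first exact: ltW.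
  by rewrite distrC.
have e2 : `|dot (s *: (v' - e *m J u)) t| <= n%:R * (N * (2 * C * dl)) * (C * N).
  apply: le_trans (dot_le _ _) _; apply: ler_pM => //; apply: ler_wpM2l => //.
  rewrite normrZ gtr0_norm //; apply: ler_pM => //; first exact: ltW.
  have h1 := ler_normD (v' - e *m J (phi q)) (e *m J (phi q) - e *m J u).
  rewrite addrA subrK in h1; apply: le_trans h1 _.
  have q0 : `|phi q - phi q| < r by rewrite subrr normr0; exact: ce_r ce.
  have h2 := ce_J ce e q0 ur; rewrite distrC in hu.
  have h3 : C * `|phi q - u| * `|e| <= C * dl * 1.
    apply: ler_pM => //; [by rewrite mulr_ge0 // ltW| |exact: norm_e].
    by apply: ler_wpM2l => //; exact: ltW.
  have h4 : 1 * dl <= C * dl by apply: ler_wpM2r.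
  by rewrite mulr1 in h3; rewrite mul1r in h4; rewrite -mulrA mulrDl mul1r; lra.
have e3 : `|dot (psi u0 - psi u - (u0 - u) *m J u) t| <= n%:R * (C * (2 * dl * (2 * N))) * (C * N).
  apply: le_trans (dot_le _ _) _; apply: ler_pM => //; apply: ler_wpM2l => //.
  apply: le_trans (ce_taylor ce ur0 ur) _; rewrite expr2; apply: ler_wpM2l; first exact: ltW.
  exact: ler_pM.
have E : w - psi u = t + (x - psi u0) + s *: (v' - e *m J u) + (psi u0 - psi u - (u0 - u) *m J u).
  rewrite wE /t /c mulmxDl -scalemxAl; apply/rowP => j.
  by move: ((u0 - u) *m J u) (e *m J u) => a b; rewrite !mxE; ring.
(* The errors [e1], [e2] and [e3] contribute 2, 2 and 4 to the factor 8. Together with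
   [N <= C * |t|] this contradicts the smallness of [dl]. *)
have main : `|t| ^+ 2 <= n%:R * (8 * C ^+ 2) * dl * N ^+ 2.
  apply: le_trans (dot_ge _) _.
  have E2 : dot (w - psi u) t = dot t t + dot (x - psi u0) t + dot (s *: (v' - e *m J u)) t +
    dot (psi u0 - psi u - (u0 - u) *m J u) t by rewrite E !dotDl.
  have f1 := ler_norm (- dot (x - psi u0) t); have f2 := ler_norm (- dot (s *: (v' - e *m J u)) t).
  have f3 := ler_norm (- dot (psi u0 - psi u - (u0 - u) *m J u) t).
  rewrite !normrN in f1 f2 f3.
  have h5 : 2 * (n%:R * dl * N ^+ 2) * C <= 2 * (n%:R * dl * N ^+ 2) * C ^+ 2.
    apply: ler_wpM2l; first by apply: mulr_ge0 => //; apply: mulr_ge0; [exact: mulr_ge0|exact: sqr_ge0].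
    by rewrite expr2 ler_peMr // ltW.
  have a1 : n%:R * dl * (C * (2 * N) * N) = 2 * (n%:R * dl * N ^+ 2) * C by ring.
  have a2 : n%:R * (N * (2 * C * dl)) * (C * N) = 2 * (n%:R * dl * N ^+ 2) * C ^+ 2 by ring.
  have a3 : n%:R * (C * (2 * dl * (2 * N))) * (C * N) = 4 * (n%:R * dl * N ^+ 2) * C ^+ 2 by ring.
  have -> : n%:R * (8 * C ^+ 2) * dl * N ^+ 2 = 2 * (n%:R * dl * N ^+ 2) * C ^+ 2 +
     2 * (n%:R * dl * N ^+ 2) * C ^+ 2 + 4 * (n%:R * dl * N ^+ 2) * C ^+ 2 by ring.
  rewrite a1 in e1; rewrite a2 in e2; rewrite a3 in e3.
  by move: h5 e1 e2 e3; lra.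
have NN : N ^+ 2 <= C ^+ 2 * `|t| ^+ 2.
  rewrite -exprMn; apply: lerXn2r => //; rewrite nnegrE ?(ltW N0) //.
  by rewrite mulr_ge0 // ltW.
have N20 : 0 < N ^+ 2 by rewrite exprn_gt0.
have : N ^+ 2 < N ^+ 2; last by rewrite ltxx.
apply: le_lt_trans NN _.
apply: (@le_lt_trans _ _ (C ^+ 2 * (n%:R * (8 * C ^+ 2) * dl * N ^+ 2))).
  by apply: ler_wpM2l => //; exact: sqr_ge0.
have -> : C ^+ 2 * (n%:R * (8 * C ^+ 2) * dl * N ^+ 2) = n%:R * (8 * C ^+ 4) * dl * N ^+ 2 by ring.
by rewrite gtr_pMl.
Qed.

End InChart.

Definition inwardr (q v : 'rV[R]_n) (r : R) := forall (x v' : 'rV[R]_n) (s : R),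
  tube Q x -> `|x - q| < r -> `|v' - v| < r -> 0 < s < r -> tube Q (x + s *: v').

Definition inward (q v : 'rV[R]_n) := exists r : R, 0 < r /\ inwardr q v r.

Lemma dP_inwardr : dP Q -> dP (fun p : 'rV[R]_n * 'rV[R]_n * R => inwardr p.1.1 p.1.2 p.2).
Proof.
move=> dQ; have dt := dP_tube dQ; rewrite /inwardr.
do 3 apply: dP_all; apply: dP_imp; first by dtac.
apply: dP_imp; first by dtac.
apply: dP_imp; first by dtac.
apply: dP_imp; last by dtac.
apply: (@dP_ext _ _ _ (fun p => 0 < p.2 /\ p.2 < p.1.1.1.2)); last by dtac.
by move=> p /=; split=> /andP.
Qed.

Lemma dP_inward : dP Q -> dP (fun p : 'rV[R]_n * 'rV[R]_n => inward p.1 p.2).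
Proof.
move=> dQ; have di := dP_inwardr dQ; rewrite /inward.
by apply: dP_ex; apply: dP_and; [dtac|exact: di].
Qed.

Lemma inwardr_shift q v r h k (t : R) : inwardr q v r -> `|h| <= t -> `|k| <= t ->
  inwardr (q + h) (v + k) (r - t).
Proof.
move=> hr hh kk x v' s tx hx hv /andP[s0 sr].
apply: hr => //.
- by move: hx; have := ler_normD (x - (q + h)) h; rewrite opprD addrA subrK; lra.
- by move: hv; have := ler_normD (v' - (v + k)) k; rewrite opprD addrA subrK; lra.
- by rewrite s0; have := normr_ge0 h; lra.
Qed.

Lemma inward_open q v : inward q v -> exists2 r : R, 0 < r & forall h k, `|h| < r -> `|k| < r ->
  inward (q + h) (v + k).
Proof.
move=> [r [r0 hr]]; exists (r / 2) => [|h k hh kk]; first by rewrite divr_gt0.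
exists (r - r / 2); split; first by lra.
by apply: inwardr_shift => //; exact: ltW.
Qed.

(** The push along the convex combination is made in two stages, along [v] and then along [w], both
    directions being corrected by [z - m]. The denominator [2 + |v| + r1] leaves room for the
    displacement of the first stage. *)
Lemma inward_convex q v w (l : R) : inward q v -> inward q w -> 0 <= l <= 1 ->
  inward q (l *: v + (1 - l) *: w).
Proof.
move=> iv iw /andP[]; rewrite le0r => /orP[/eqP -> _|l0].
  by rewrite scale0r add0r subr0 scale1r.
rewrite le_eqVlt => /orP[/eqP ->|l1]; first by rewrite subrr scale0r addr0 scale1r.
have [r1 [r10 h1]] := iv; have [r2 [r20 h2]] := iw.
have K0 : 0 < 2 + `|v| + r1 by have := normr_ge0 v; lra.
exists (Num.min r1 (r2 / (2 + `|v| + r1))); split=> [|x z s tx]; first by rewrite lt_min r10 divr_gt0.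
rewrite !lt_min !ltr_pdivlMr // => /andP[x1 x2] /andP[z1 z2] /and3P[s0 s1 s2].
set m := l *: v + _ in z1 z2.
have -> : x + s *: z = x + (s * l) *: (v + (z - m)) + (s * (1 - l)) *: (w + (z - m)).
  by rewrite /m; apply/rowP => i; rewrite !mxE; ring.
have sl0 : 0 < s * l by rewrite mulr_gt0.
have sl1 : s * l <= s by rewrite ler_piMr // ltW.
have Kr a : 0 <= a -> a * (2 + `|v| + r1) < r2 -> a < r2.
  by move=> a0; apply: le_lt_trans; rewrite ler_peMr //; have := normr_ge0 v; lra.
have hz : `|v + (z - m)| <= `|v| + r1 by apply: le_trans (ler_normD _ _) _; lra.
apply: h2.
- apply: h1 => //; first by rewrite [v + _]addrC addrK.
  by rewrite sl0 /=; apply: le_lt_trans sl1 s1.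
- rewrite addrAC; apply: le_lt_trans (ler_normD _ _) _; rewrite normrZ (gtr0_norm sl0).
  have := ler_pM (ltW sl0) (normr_ge0 _) sl1 hz.
  by move: (s * l * _) => P hP; move: x2 s2; have := normr_ge0 (x - q); have := normr_ge0 v; nra.
- by rewrite [w + _]addrC addrK; exact: Kr.
- rewrite mulr_gt0 ?subr_gt0 //=; apply: (@le_lt_trans _ _ s); last by apply: Kr s2; exact: ltW.
  by rewrite ler_piMr //; lra.
Qed.

End InwardCone.

(** * Existence of inward directions *)

Section Existence.
Variable R : realType.

Lemma small_const (K b : R) : 0 <= K -> 0 < b ->
  exists2 t, 0 < t & forall x, 0 <= x -> x <= t -> K * x < b.
Proof.
move=> K0 b0; have K1 : 0 < K + 1 by lra.
exists (b / (K + 1)) => [|x x0]; first by rewrite divr_gt0.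
rewrite ler_pdivlMr // => h; have [->|xn] := eqVneq x 0; first by rewrite mulr0.
have xp : 0 < x by rewrite lt_def xn.
lra.
Qed.

(** The point of [Q] near [q] closest to [x + s *: v'] satisfies one-sided conditions at the faces.
    [inward_normal] improves them to orthogonality, and [tub_of_normal] recognizes a foot point. *)
Lemma inward_ex n d (Q : set 'rV[R]_n) q : submanifold_corners d Q -> Q q -> exists v, inward Q q v.
Proof.
move=> mQ Qq; have [k [phi [psi [J [V [C [r ce]]]]]]] := chart_ex mQ Qq.
have C1 := ce_C ce; have r0 := ce_r ce; have n0 : 0 <= n%:R :> R := ler0n _ _.
have C0 : 0 < C by lra.
have rC0 : 0 < r / (2 * C) by rewrite divr_gt0 // mulr_gt0.
have rCr : r / (2 * C) <= r / 2 by rewrite ler_pM2l // lef_pV2 ?posrE ?mulr_gt0 //; lra.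
have [t1 t10 h1] := small_const (K := 4 * n%:R * C ^+ 3) (b := 1) (mulr_ge0 (mulr_ge0 (ler0n _ 4) n0) (exprn_ge0 3 (ltW C0))) ltr01.
have [t2 t20 h2] := small_const (K := 4 * n%:R) (mulr_ge0 (ler0n _ 4) n0) rC0.
have [t3 t30 h3] := small_const (K := n%:R * (8 * C ^+ 4)) (b := 1) (mulr_ge0 n0 (mulr_ge0 (ler0n _ 8) (exprn_ge0 4 (ltW C0)))) ltr01.
(* [dl] bounds all deviations from [q] and [phi q]: [t1] and [t2] serve [tub_of_normal], and [t3]
   serves [inward_normal]. *)
pose dl := Num.min (r / (4 * C)) (Num.min t1 (Num.min t2 t3)).
have dl0 : 0 < dl by rewrite !lt_min t10 t20 t30 divr_gt0 // mulr_gt0.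
have : dl <= dl by []; rewrite {2}/dl !le_min => /and4P[d0 d1 d2 d3].
have d4 : r / (4 * C) < r / (2 * C).
  by rewrite ltr_pM2l // ltf_pV2 ?posrE ?mulr_gt0 //; lra.
have {}h1 := h1 dl (ltW dl0) d1; have {}h2 := h2 dl (ltW dl0) d2; have {}h3 := h3 dl (ltW dl0) d3.
clearbody dl; clear t1 t10 d1 t2 t20 d2 t3 t30 d3.
pose e : 'rV[R]_n := \row_j (j < d)%:R; pose v := e *m J (phi q).
(* [B * rho] dominates the distances from [q] to the foot point of [x] and to the nearest point of
   [w]; passing to the chart costs a further factor [C]. *)
pose B := (2 * n%:R + 1) * ((n%:R + 2) * (2 + `|v|)).
have b1 : 1 <= 2 * n%:R + 1 :> R by lra.
have b2 : 1 <= (n%:R + 2) * (2 + `|v|) by have := normr_ge0 v; nra.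
have B1 : 2 * n%:R + 1 <= B by rewrite ler_peMr //; lra.
have B2 : (n%:R + 2) * (2 + `|v|) <= B by rewrite ler_peMl //; lra.
have B0 : 0 < B by lra.
clearbody B; clear b1 b2.
pose rho := Num.min 1 (Num.min dl (dl / (C * B))).
have rho0 : 0 < rho by rewrite !lt_min ltr01 dl0 divr_gt0 // mulr_gt0.
have : rho <= rho by []; rewrite {2}/rho !le_min => /and3P[rho1 rhod].
rewrite ler_pdivlMr ?mulr_gt0 // => rhoB.
clearbody rho.
have qr : `|q - q| < r by rewrite subrr normr0.
exists v, rho; split=> // x v' s tx hx hv /andP[s0 s1].
have Brho : B * rho <= C * (B * rho) by rewrite ler_peMl // mulr_ge0 // ltW.
have CBrho : C * (B * rho) <= dl by rewrite mulrA mulrC.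
have r1 : (2 * n%:R + 1) * rho <= B * rho by apply: ler_wpM2r => //; exact: ltW.
have r2 : (n%:R + 2) * (2 + `|v|) * rho <= B * rho by apply: ler_wpM2r => //; exact: ltW.
have tq : tube Q q by exists q; exact: tub_self.
have Bdl : B * rho <= dl := le_trans Brho CBrho.
have dlr2 : dl < r / 2 := le_lt_trans d0 (lt_le_trans d4 rCr).
have dlr : dl < r by clear -dlr2 r0; lra.
have r3 : 2 * n%:R * rho <= B * rho by clear -r1 rho0; lra.
have yq : `|retr Q x - q| <= 2 * n%:R * rho.
  have := retr_lip tx tq; rewrite (retr_id Qq) => /le_trans; apply.
  by apply: ler_wpM2l; [exact: mulr_ge0|exact: ltW].
have yr : `|retr Q x - q| < r := le_lt_trans (le_trans yq (le_trans r3 Bdl)) dlr.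
have u0d : `|phi (retr Q x) - phi q| <= dl.
  apply: le_trans (ce_phi ce yr qr) _; apply: le_trans CBrho.
  by apply: ler_wpM2l; [exact: ltW|exact: le_trans yq r3].
pose w := x + s *: v'.
have wq : `|w - q| <= (2 + `|v|) * rho.
  rewrite /w addrAC; apply: le_trans (ler_normD _ _) _; rewrite normrZ gtr0_norm //.
  have v'1 : `|v'| <= `|v| + 1 by have := ler_normD (v' - v) v; rewrite subrK; clear -hv rho1; lra.
  have := ler_pM (ltW s0) (normr_ge0 _) (ltW s1) v'1; rewrite mulrDl; clear -hx; lra.
have nw : (n%:R + 2) * `|w - q| <= B * rho.
  by apply: le_trans r2; rewrite -mulrA; apply: ler_wpM2l => //; clear -n0; lra.
have [|//||y [hm wy]] := @proj_min_ex _ _ _ _ _ _ _ _ _ _ _ _ ce (r / 2) w.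
- by clear -r0; apply/andP; split; lra.
- exact: le_lt_trans (le_trans nw Bdl) dlr2.
have [Qy _ _] := hm.
have yq2 : `|y - q| <= (n%:R + 2) * `|w - q|.
  have := ler_normB (w - q) (w - y); rewrite opprB addrC addrA subrK => h.
  by move: wy h; rewrite !mulrDl !mul1r; clear; lra.
have yq3 := le_trans yq2 nw.
have yr2 : `|y - q| < r := le_lt_trans (le_trans yq3 Bdl) dlr.
have E := ce_phiK ce yr2; have Ey := ce_phiK ce yr.
have ud : `|phi y - phi q| <= dl.
  apply: le_trans (ce_phi ce yr2 qr) _; apply: le_trans CBrho.
  by apply: ler_wpM2l; [exact: ltW|exact: yq3].
have ur : `|phi y - phi q| < r := le_lt_trans ud dlr.
have qu := (ce_Q ce yr2).1 Qy.
have wyd : `|w - y| <= dl.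
  by move: wy (le_trans nw Bdl); rewrite !mulrDl !mul1r; have := normr_ge0 (w - q); clear; lra.
have nle (j : 'I_n) : (j < d)%N -> dot (w - psi (phi y)) (row j (J (phi y))) <= 0.
  move=> jd; rewrite -[dot _ _]mul1r; apply: (proj_min_dir ce (rho := r / 2) (t0 := 1)) => //.
  - by clear -r0; lra.
  - by rewrite E.
  - by rewrite normr1.
  move=> t /andP[t0 _] i; have [q1 q2] := qu i; rewrite !mxE eqxx mul1r /=; split.
    by move=> /q1 hi; rewrite addr_ge0 // mulr_ge0 // ltW.
  move=> di; rewrite (q2 di); case: eqP => [ij|_]; last by rewrite mulr0 addr0.
  by move: di; rewrite leqNgt ij jd.
have nge (j : 'I_n) : (j < d)%N -> (k <= j)%N \/ 0 < phi y 0 j ->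
    dot (w - psi (phi y)) (row j (J (phi y))) = 0.
  move=> jd hj; apply/eqP; rewrite eq_le nle //= -oppr_le0 -mulN1r.
  have [t0 t00 ht] : exists2 t0, 0 < t0 & forall t, t < t0 -> (j < k)%N -> 0 <= phi y 0 j - t.
    have [kj|kj] := leqP k j; first by exists 1.
    case: hj => [|hj]; first by rewrite leqNgt kj.
    by exists (phi y 0 j) => // t ht _; rewrite subr_ge0 ltW.
  apply: (proj_min_dir ce (rho := r / 2) (t0 := t0)) => //.
  - by clear -r0; lra.
  - by rewrite E.
  - by rewrite normrN normr1.
  move=> t /andP[tp tt] i; have [q1 q2] := qu i; rewrite !mxE eqxx mulN1r /=; split.
    case: eqP => [->|_] ik; last by rewrite mulr0 addr0; exact: q1.
    by rewrite mulr1; exact: ht.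
  move=> di; rewrite (q2 di); case: eqP => [ij|_]; last by rewrite mulr0 addr0.
  by move: di; rewrite leqNgt ij jd.
exists y; rewrite -E; apply: (@tub_of_normal _ _ _ _ _ _ _ _ _ _ _ _ ce _ _ dl) => //.
- exact: ltW.
- by rewrite E.
- by rewrite E; exact: le_trans yq3 Bdl.
- by rewrite E.
- by apply: le_trans d0 _; exact: ltW.
- by apply: ltW.
- by apply: ltW.
apply: (inward_normal ce (x := x) (v' := v') (u0 := phi (retr Q x)) (dl := dl) (s := s)) => //.
- by rewrite Ey; exact: retrP.
- by rewrite E.
- rewrite Ey; have := ler_normB (x - q) (retr Q x - q); rewrite opprB addrA subrK.
  by move: r1; rewrite mulrDl mul1r; clear -hx yq Bdl; lra.
- by apply: (@le_trans _ _ rho) => //; exact: ltW.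
Qed.

End Existence.

(** * Pushing inwards and retracting *)

Section Patching.
Variable R : realType.

(** [semialgebraic_map] constrains only the graph over [S]; a constant value elsewhere gives a map
    definable on the whole space. *)
Lemma dfun_patch m k (S : set 'rV[R]_m) (f : 'rV[R]_m -> 'rV[R]_k) (y0 : 'rV[R]_k) :
  dP S -> semialgebraic_map S f ->
  exists2 f0 : 'rV[R]_m -> 'rV[R]_k, dfun f0 & forall x, S x -> f0 x = f x.
Proof.
move=> dS sf; pose f0 x := if pselect (S x) is left _ then f x else y0.
exists f0; last by move=> x Sx; rewrite /f0; case: pselect.
pose Gr := [set z : 'rV[R]_(m + k) | exists2 x, S x & z = row_mx x (f x)].
have dG : dP Gr by exact: sf.
apply: (@dfun_unique _ _ _ _ _ (fun x y => Gr (row_mx x y) \/ (~ S x /\ y = y0))).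
  by apply: dP_or; dtac.
move=> x y; rewrite /f0; case: pselect => Sx; split.
- by move=> <-; left; exists x.
- by move=> [[x' _ /eq_row_mx[-> ->]]|[]].
- by move=> <-; right.
- by move=> [[x' Sx' /eq_row_mx[E _]]|[_ ->]] //; rewrite E in Sx; case: (Sx Sx').
Qed.

Lemma dfun_normv n : dfun (fun v : 'rV[R]_n => `|v|).
Proof.
apply: (@dfun_unique _ _ _ _ _ (fun (v : 'rV[R]_n) (c : R) => forall e : R, `|v| < e <-> c < e)).
  by dtac.
move=> v c; split=> [<- //|h]; apply/eqP; rewrite eq_le !leNgt.
by apply/andP; split; apply/negP => /h; rewrite ?ltxx // => /h; rewrite ltxx.
Qed.

Lemma enorm_le n (u : 'rV[R]_n) : enorm u <= (n%:R + 1) * `|u|.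
Proof.
have n0 : 0 <= n%:R :> R := ler0n _ _.
have p0 : 0 <= (n%:R + 1) * `|u| by rewrite mulr_ge0 // addr_ge0.
rewrite -(ger0_norm p0) -sqrtr_sqr; apply: ler_wsqrtr.
have -> : \sum_i u 0 i ^+ 2 = dot u u by rewrite /dot; apply: eq_bigr => i _; rewrite expr2.
apply: le_trans (ler_norm _) _; apply: le_trans (dot_le _ _) _.
by have := sqr_ge0 `|u|; rewrite !expr2; nra.
Qed.

Lemma nash_rV_cont m k (V : set 'rV[R]_m) (G : 'rV[R]_m -> 'rV[R]_k) x :
  (forall j, nash V (fun x => G x 0 j)) -> V x ->
  forall e, 0 < e -> exists2 t, 0 < t & forall h, `|h| < t -> `|G (x + h) - G x| < e.
Proof.
move=> nG Vx e e0; have /choice[t ht] : forall j, exists t, 0 < t /\ forall h, `|h| < t ->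
    `|G (x + h) 0 j - G x 0 j| < e.
  by move=> j; have [t t0 ht] := smooth_pcont (nG j).1 Vx e0; exists t.
exists (\big[Num.min/1]_j t j) => [|h /bigmin_gtP[_ hh]].
  by apply/bigmin_gtP; split=> // j _; exact: (ht j).1.
by apply: norm_lt => // j; rewrite coord_sub; apply: (ht j).2; exact: hh.
Qed.

Lemma convex_lt (a b a' b' l : R) : 0 <= l <= 1 -> a < b -> a' < b' ->
  l * a + (1 - l) * a' < l * b + (1 - l) * b'.
Proof.
move=> /andP[l0 l1] h h'; rewrite -subr_gt0.
have -> : l * b + (1 - l) * b' - (l * a + (1 - l) * a') = l * (b - a) + (1 - l) * (b' - a') by ring.
have [->|ln] := eqVneq l 0; first by rewrite mul0r add0r subr0 mul1r subr_gt0.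
apply: ltr_pwDl; first by rewrite mulr_gt0 ?subr_gt0 // lt_def ln.
by rewrite mulr_ge0 ?subr_ge0 // ltW.
Qed.

End Patching.

Section Pushing.
Variable R : realType.
Variables (n : nat) (Q : set 'rV[R]_n) (K : R).
Hypothesis K1 : 1 <= K.

(* [w] is obtained from [q] by an inward push so small that moving [w] back into
   [Q] displaces it by less than [ep]. *)
Definition push (q v : 'rV[R]_n) (ep : R) (w : 'rV[R]_n) := exists r s : R,
  [/\ inwardr Q q v r, 0 < s, s < r, r <= 1 /\ `|w - q - s *: v| < r * s & K * s * (`|v| + 1) < ep].

Lemma dP_push : dP Q ->
  dP (fun p : 'rV[R]_n * 'rV[R]_n * R * 'rV[R]_n => push p.1.1.1 p.1.1.2 p.1.2 p.2).
Proof.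
move=> dQ; have di := dP_inwardr dQ.
apply: (@dP_ext _ _ _ (fun p : 'rV[R]_n * 'rV[R]_n * R * 'rV[R]_n => exists r s : R,
  inwardr Q p.1.1.1 p.1.1.2 r /\ 0 < s /\ s < r /\ r <= 1 /\
  `|p.2 - p.1.1.1 - s *: p.1.1.2| < r * s /\ K * s * (`|p.1.1.2| + 1) < p.1.2)).
  move=> p; split=> [[r [s [h1 [h2 [h3 [h4 [h5 h6]]]]]]]|[r [s [h1 h2 h3 [h4 h5] h6]]]]; exists r, s => //.
do 2 apply: dP_ex; apply: dP_and; last first.
  by have dn := @dfun_normv R n; dtac.
by apply: (dP_fun (t := fun p : 'rV[R]_n * 'rV[R]_n * R * 'rV[R]_n * R * R =>
  (p.1.1.1.1.1, p.1.1.1.1.2, p.1.2)) di); dtac.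
Qed.

Lemma push_open q v ep w : push q v ep w -> exists2 t, 0 < t & forall hq hv he hw,
  `|hq| < t -> `|hv| < t -> `|he| < t -> `|hw| < t -> push (q + hq) (v + hv) (ep + he) (w + hw).
Proof.
have k1 := K1.
move=> [r [s [ir s0 sr [r1 ws] ks]]].
have Ks : 0 < K * s + 1 by rewrite addr_gt0 // mulr_gt0 //; lra.
pose t := Num.min (r - s) (Num.min ((r * s - `|w - q - s *: v|) / 4)
  ((ep - K * s * (`|v| + 1)) / (K * s + 1))).
have t0 : 0 < t by rewrite !lt_min subr_gt0 sr !divr_gt0 ?subr_gt0.
have : t <= t by []; rewrite {2}/t !le_min => /and3P[t1 t2]; rewrite ler_pdivlMr // => t3.
clearbody t; exists (t / 2) => [|hq hv he hw nq nv ne nw]; first by rewrite divr_gt0.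
have nh : 0 <= `|hq| by []. 
exists (r - t / 2), s; split=> //.
- by apply: inwardr_shift => //; exact: ltW.
- by lra.
- split; first by lra.
  have -> : w + hw - (q + hq) - s *: (v + hv) = (w - q - s *: v) + (hw - hq - s *: hv).
    by apply/rowP => i; rewrite !mxE; ring.
  apply: le_lt_trans (ler_normD _ _) _; have := ler_normB (hw - hq) (s *: hv).
  have := ler_normB hw hq; rewrite normrZ (gtr0_norm s0).
  have : s * `|hv| <= 1 * (t / 2) by apply: ler_pM => //; [exact: ltW|lra|exact: ltW].
  have : t / 2 * s <= t / 2 * 1 by apply: ler_wpM2l; lra.
  move: t2; rewrite mulrBl; lra.
have vv : K * s * (`|v + hv| + 1) <= K * s * (`|v| + 1) + K * s * (t / 2).
  rewrite -mulrDr; apply: ler_wpM2l; first by rewrite mulr_ge0 //; lra.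
  by have := ler_normD v hv; lra.
apply: le_lt_trans vv _; move: ne; rewrite ltr_norml => /andP[ne _].
have p0 : 0 <= K * s * t by rewrite !mulr_ge0 //; lra.
by move: t3; lra.
Qed.

Lemma push_convex q v ep w w' l : push q v ep w -> push q v ep w' -> 0 <= l <= 1 ->
  push q v ep (l *: w + (1 - l) *: w').
Proof.
move=> [r [s [ir s0 sr [r1 ws] ks]]] [r' [s' [ir' s'0 sr' [r1' ws'] ks']]] l01.
have /andP[l0 l1] := l01; have l1' : 0 <= 1 - l by lra.
(* Both pushes have the same direction [v], so the larger radius is admissible for both. *)
pose r2 := Num.max r r'; pose s2 := l * s + (1 - l) * s'.
have rr : r <= r2 by rewrite le_max lexx.
have rr' : r' <= r2 by rewrite le_max lexx orbT.
have i2 : inwardr Q q v r2 by rewrite /r2; case: leP.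
have r21 : r2 <= 1 by rewrite ge_max r1.
clearbody r2; exists r2, s2; split=> //.
- by have := convex_lt l01 s0 s'0; rewrite !mulr0 addr0.
- have := convex_lt l01 (lt_le_trans sr rr) (lt_le_trans sr' rr').
  by have -> : l * r2 + (1 - l) * r2 = r2 by ring.
- split=> //.
  have -> : l *: w + (1 - l) *: w' - q - s2 *: v =
      l *: (w - q - s *: v) + (1 - l) *: (w' - q - s' *: v).
    by rewrite /s2; apply/rowP => i; rewrite !mxE; ring.
  apply: le_lt_trans (ler_normD _ _) _; rewrite !normrZ !ger0_norm //.
  apply: lt_le_trans (convex_lt l01 ws ws') _.
  have -> : r2 * s2 = l * (r2 * s) + (1 - l) * (r2 * s') by rewrite /s2; ring.
  by apply: lerD; apply: ler_wpM2l => //; apply: ler_wpM2r => //; exact: ltW.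
have := convex_lt l01 ks ks'; have -> : l * ep + (1 - l) * ep = ep by ring.
by apply: le_lt_trans; rewrite /s2 le_eqVlt; apply/orP; left; apply/eqP; ring.
Qed.

Lemma push_ex q v ep : inward Q q v -> 0 < ep -> exists w, push q v ep w.
Proof.
have k1 := K1.
move=> [r [r0 ir]] ep0; have v1 : 0 < `|v| + 1 by rewrite ltr_wpDl.
have K0 : 0 < K by lra.
pose r1 := Num.min r 1; have r10 : 0 < r1 by rewrite lt_min r0 ltr01.
pose s := Num.min (r1 / 2) (ep / (2 * K * (`|v| + 1))).
have s0 : 0 < s by rewrite lt_min !divr_gt0 // !mulr_gt0.
have : s <= s by []; rewrite {2}/s le_min => /andP[h1]; rewrite ler_pdivlMr ?mulr_gt0 // => h2.
have rr : r1 <= r by rewrite ge_min lexx.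
have r11 : r1 <= 1 by rewrite ge_min lexx orbT.
clearbody s r1; exists (q + s *: v), r1, s; split=> //.
- move=> x v' s' tx xr vr /andP[p1 p2].
  by apply: ir => //; rewrite ?p1; exact: lt_le_trans rr.
- lra.
- split=> //; have -> : q + s *: v - q - s *: v = 0 by apply/rowP => i; rewrite !mxE; ring.
  by rewrite normr0 mulr_gt0.
have : K * s * (`|v| + 1) * 2 <= ep by apply: le_trans h2; rewrite le_eqVlt; apply/orP; left; apply/eqP; ring.
have : 0 < K * s * (`|v| + 1) by rewrite !mulr_gt0.
lra.
Qed.

(** Dividing by [s] exhibits every point near [w] as a push of [q] along a direction whose distance
    to [v] is less than [r]. *)
Lemma push_tubeint q v ep w : Q q -> push q v ep w -> tubeint Q w.
Proof.
move=> Qq [r [s [ir s0 sr [r1 ws] ks]]].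
exists (r * s - `|w - q - s *: v|) => [|h hh]; first by rewrite subr_gt0.
have -> : w + h = q + s *: (s^-1 *: (w + h - q)).
  by rewrite scalerA divff ?scale1r ?gt_eqF // [RHS]addrC subrK.
apply: ir; rewrite ?s0 //.
- by exists q; exact: tub_self.
- by rewrite subrr normr0; lra.
rewrite -(ltr_pM2l s0) -{1}(gtr0_norm s0) -normrZ.
have -> : s *: (s^-1 *: (w + h - q) - v) = (w - q - s *: v) + h.
  by rewrite scalerBr scalerA divff ?scale1r ?gt_eqF //; apply/rowP => i; rewrite !mxE; ring.
by apply: le_lt_trans (ler_normD _ _) _; rewrite [s * r]mulrC; lra.
Qed.

Lemma push_near q v ep w : push q v ep w -> K * `|w - q| < ep.
Proof.
have k1 := K1.
move=> [r [s [ir s0 sr [r1 ws] ks]]]; apply: le_lt_trans ks; rewrite -mulrA.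
apply: ler_wpM2l; first by lra.
have := ler_normD (w - q - s *: v) (s *: v); rewrite subrK normrZ (gtr0_norm s0).
have : r * s <= 1 * s by apply: ler_wpM2r => //; exact: ltW.
by rewrite mulrDr mulr1; lra.
Qed.

End Pushing.

Theorem theorem1p6 (R : realType) (m n : nat)
  (S : set 'rV[R]_m) (Q : set 'rV[R]_n) (f : 'rV[R]_m -> 'rV[R]_n)
  (eps : 'rV[R]_m -> R) :
  semialgebraic S -> locally_compact_set S ->
  Nash_manifold_divisorial_corners Q ->
  {within S, continuous f} -> semialgebraic_map S f -> (forall x, S x -> Q (f x)) ->
  {within S, continuous eps} -> semialgebraic_map S (as_row eps) ->
  (forall x, S x -> 0 < eps x) ->
  exists g : 'rV[R]_m -> 'rV[R]_n,
    [/\ Nash_on S g, (forall x, S x -> Q (g x)) &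
        forall x, S x -> enorm (f x - g x) < eps x].
Proof.
move=> sS lcS [d [[sQ mQ] _]] cf sf fQ ce se eps0.
have dS : dP S by exact: sS.
have dQ : dP Q by exact: sQ.
have [f0 df0 f0E] := dfun_patch 0 dS sf.
have [ep dep epE] : exists2 ep : 'rV[R]_m -> R, dfun ep & forall x, S x -> ep x = eps x.
  have [ep dep epE] := dfun_patch 0 dS se.
  by exists (fun x => ep x 0 0) => [|x Sx]; [dtac|rewrite epE // mxE].
have {}cf x : S x -> forall e, 0 < e -> exists2 t, 0 < t & forall h, `|h| < t -> S (x + h) ->
    `|f0 (x + h) - f0 x| < e.
  move=> Sx e e0; have [t t0 ht] := (within_continuousP _ _).1 cf x Sx e e0.
  by exists t => // h hh Sh; rewrite !f0E //; exact: ht.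
have {}ce x : S x -> forall e, 0 < e -> exists2 t, 0 < t & forall h, `|h| < t -> S (x + h) ->
    `|ep (x + h) - ep x| < e.
  move=> Sx e e0; have [t t0 ht] := (within_continuousP _ _).1 ce x Sx e e0.
  by exists t => // h hh Sh; rewrite !epE //; exact: ht.
have Qf x : S x -> Q (f0 x) by move=> Sx; rewrite f0E //; exact: fQ.
(* The first selection yields a Nash field of inward directions along [f]. *)
have [|x v Sx iv|x Sx|x v w l _|V1 [v [[oV1 dV1] SV1 nv iv]]] :=
  @nash_selection R m n S sS lcS (fun x v => inward Q (f0 x) v).
- by have di := dP_inward dQ; apply: (dP_fun2 di); dtac.
- have [r r0 hr] := inward_open iv; have [t t0 ht] := cf x Sx r r0.
  exists (Num.min r t) => [|h k]; first by rewrite lt_min r0.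
  rewrite !lt_min => /andP[_ h2] /andP[k1 _] Sh.
  by have := hr _ _ (ht h h2 Sh) k1; rewrite [f0 x + _]addrC subrK.
- by apply: (inward_ex mQ); exact: Qf.
- exact: inward_convex.
have n0 : 0 <= n%:R :> R := ler0n _ _.
(* [2 * n] is the Lipschitz constant of the retraction, which fixes [f x], and [n + 1] compares the
   Euclidean with the maximum norm. The summand 1 ensures [1 <= K]. *)
pose K : R := 2 * n%:R * (n%:R + 1) + 1.
have K1 : 1 <= K by rewrite lerDr !mulr_ge0 // addr_ge0.
have dv : dfun v by apply: dfun_row => j; exact: (nv j).2.
(* The second selection keeps the direction [v x] fixed; its continuity on [S] enters the openness
   of the relation. *)
have [|x w Sx pw|x Sx|x w w' l _|V2 [G [[oV2 dV2] SV2 nG pG]]] :=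
  @nash_selection R m n S sS lcS (fun x w => push Q K (f0 x) (v x) (ep x) w).
- have dp := dP_push K dQ.
  apply: (dP_fun (t := fun p : 'rV[R]_m * 'rV[R]_n => (f0 p.1, v p.1, ep p.1, p.2)) dp).
  by dtac.
- have [r r0 hr] := push_open K1 pw; have [t1 t10 h1] := cf x Sx r r0.
  have [t2 t20 h2] := ce x Sx r r0; have [t3 t30 h3] := nash_rV_cont nv (SV1 x Sx) r0.
  exists (Num.min r (Num.min t1 (Num.min t2 t3))) => [|h k]; first by rewrite !lt_min r0 t10 t20.
  rewrite !lt_min => /and4P[_ k1 k2 k3] /and4P[kr _ _ _] Sh.
  have := hr _ _ _ _ (h1 h k1 Sh) (h3 h k3) (h2 h k2 Sh) kr.
  by rewrite [f0 x + _]addrC subrK [v x + _]addrC subrK [ep x + _]addrC subrK.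
- by apply: (push_ex K1 (iv x Sx)); rewrite epE //; exact: eps0.
- exact: push_convex.
have dG : dfun G by apply: dfun_row => j; exact: (nG j).2.
have dT := dP_tubeint dQ; have dR := dfun_retr dQ.
exists (fun x => retr Q (G x)); split=> [|x Sx|x Sx].
(* The composite is Nash on the open set where [G] takes values in the interior of the tube; this
   set contains [S] by [push_tubeint]. *)
- pose U : set 'rV[R]_m := fun x => V2 x /\ tubeint Q (G x).
  have oU : popen U.
    move=> x [Vx tx]; have [t1 t10 h1] := oV2 x Vx; have [t2 t20 h2] := popen_tubeint tx.
    have [t3 t30 h3] := nash_rV_cont nG Vx t20.
    exists (Num.min t1 t3) => [|h]; first by rewrite lt_min t10.
    rewrite lt_min => /andP[k1 k3]; split; first exact: h1.
    by have := h2 _ (h3 h k3); rewrite [G x + _]addrC subrK.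
  have dU : dP U by rewrite /U; dtac.
  exists U, (fun x => retr Q (G x)); split=> //.
  + by split; [exact/open_popen|exact: dU].
  + by move=> x Sx; split; [exact: SV2|exact: push_tubeint (Qf x Sx) (pG x Sx)].
  + apply: smooth_Ck => // j t.
    apply: (@Dk_comp _ _ _ _ U (tubeint Q) (fun w => retr Q w 0 j) G).
    * by move=> x [].
    * by move=> i; apply: (Dk_sub (U := V2)); [move=> x []|exact: (nG i).1].
    * exact: (smooth_retr mQ).
  + have dE : dP (R := R) (fun z : 'rV[R]_(m + n) => exists x, U x /\ z = row_mx x (retr Q (G x))).
      by dtac.
    apply: (sa_ext _ dE).
      by move=> z; split=> [[x [Ux E]]|[x Ux E]]; exists x.
- exact: (retrP (tubeint_tube (push_tubeint (Qf x Sx) (pG x Sx)))).1.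
rewrite -f0E // -epE //; apply: le_lt_trans (enorm_le _) _.
have tG := tubeint_tube (push_tubeint (Qf x Sx) (pG x Sx)).
have tf : tube Q (f0 x) by exists (f0 x); apply: tub_self; exact: Qf.
have h : `|f0 x - retr Q (G x)| <= 2 * n%:R * `|G x - f0 x|.
  by rewrite -{1}(retr_id (Qf x Sx)) distrC; exact: retr_lip.
have := push_near K1 (pG x Sx); apply: le_lt_trans.
apply: (@le_trans _ _ ((n%:R + 1) * (2 * n%:R * `|G x - f0 x|))).
  by apply: ler_wpM2l => //; apply: addr_ge0.
have -> : (n%:R + 1) * (2 * n%:R * `|G x - f0 x|) = 2 * n%:R * (n%:R + 1) * `|G x - f0 x| by ring.
by apply: ler_wpM2r => //; rewrite lerDl.
Qed.
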